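(* Let $(M,\tau)$ be a tracial $W^*$-probability space and let $(X_1,\dots,X_n)$, $n\ge 2$, be an $n$-tuple of self-adjoint elements of $M$. Then for every self-adjoint element $Z$ of the center of $W^*(X_1,\dots,X_n)$, $$\|Z-\tau(Z)\|_2^2\le 2\,\frac{n-\delta^\star(X_1,\dots,X_n)}{n-1}\,\|Z\|^2 .$$ As a consequence, if $n-\delta^\star(X_1,\dots,X_n)=\liminf_{t\to 0}t\,\Phi^*(X_1+\sqrt t S_1,\dots,X_n+\sqrt t S_n)=0$, then $W^*(X_1,\dots,X_n)$ is a factor. Moreover, if $\delta^\star(X_1,\dots,X_n)>\frac{n+1}{2}$, then $W^*(X_1,\dots,X_n)$ has no central projection of trace $\frac12$; in particular it does not have diffuse center.
   Context: A tracial $W^*$-probability space $(M,\tau)$ is a von Neumann algebra $M$ with a faithful normal tracial state $\tau$; $\|x\|_2=\tau(x^*x)^{1/2}$, $\|x\|$ is the operator norm. $W^*(X_1,\dots,X_n)\subset M$ is the (unital) von Neumann subalgebra generated by $X_1,\dots,X_n$. $\partial_i:\mathbb{C}\langle t_1,\dots,t_n\rangle\to\mathbb{C}\langle t_1,\dots,t_n\rangle^{\otimes 2}$ is the derivation with $\partial_i(t_j)=\delta_{ij}\,1\otimes 1$ (bimodule actions $a\cdot(b\otimes c)\cdot d=ab\otimes cd$). For self-adjoint $Y_1,\dots,Y_n$ in a tracial $W^*$-probability space, the $i$-th conjugate variable, if it exists, is the unique $\xi_i\in L^2(W^*(Y_1,\dots,Y_n),\tau)$ with $\tau(\xi_iP(Y_1,\dots,Y_n))=(\tau\otimes\tau)\big((\partial_iP)(Y_1,\dots,Y_n)\big)$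 for all $P\in\mathbb{C}\langle t_1,\dots,t_n\rangle$. The non-microstates free Fisher information is $\Phi^*(Y_1,\dots,Y_n)=\sum_i\|\xi_i\|_2^2$ if all $\xi_i$ exist, and $\infty$ otherwise. $S_1,\dots,S_n$ is a free family of semicircular elements ($\tau(S_i)=0$, $\|S_i\|_2=1$, $\|S_i\|=2$), free with $\{X_1,\dots,X_n\}$, in a tracial $W^*$-probability space containing $(M,\tau)$. The variant of non-microstates free entropy dimension used is $$\delta^\star(X_1,\dots,X_n)=n-\liminf_{t\to 0}t\,\Phi^*(X_1+\sqrt tS_1,\dots,X_n+\sqrt tS_n).$$ A von Neumann algebra has diffuse center if its center has no minimal projection. *)

(* Defs.v *)
From HB Require Import structures.
From mathcomp Require Import all_boot all_order all_algebra all_field.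
From mathcomp Require Import complex finmap.
(* [monalg] has to be imported before MathComp-Analysis: their notations are
   incompatible in the other order. *)
From mathcomp Require Import monalg.
From mathcomp Require Import all_classical all_reals all_analysis.

Set Implicit Arguments.
Unset Strict Implicit.
Unset Printing Implicit Defensive.

Import Order.TTheory GRing.Theory Num.Theory.
Import numFieldNormedType.Exports.
Local Open Scope classical_set_scope.
Local Open Scope complex_scope.
Local Open Scope ring_scope.

Record hilbert (R : realType) := Hilbert {
  hilbert_space :> completeNormedModType R[i];
  inner : {dot hilbert_space for (@Num.conj R[i])};
  inner_norm : forall x, inner x x = `|x| ^+ 2 }.

(* Operators are plain functions [H -> H], with the pointwise vector space
   structure, [\o] as product and [idfun] as unit; linearity and boundedness
   are imposed by [bounded_op]. *)
Section Operators.
Context {R : realType} {H : hilbert R}.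
Implicit Types (S T : H -> H) (A B : set (H -> H)).

Definition bounded_op T :=
  linear T /\ exists K : R, forall x, `|T x| <= K%:C * `|x|.

(* Meaningful on bounded operators only. *)
Definition opnorm T : R :=
  inf [set K : R | 0 <= K /\ forall x, `|T x| <= K%:C * `|x|].

Definition is_adjoint T S := forall x y, inner H (T x) y = inner H x (S y).

(* The adjoint of [T]; it exists (and is unique) when [T] is bounded. *)
Definition adj T : H -> H := xget 0 [set S | is_adjoint T S].

Definition selfadjoint T := is_adjoint T T.

Definition projection T := T \o T = T /\ selfadjoint T.

(* The order of [R[i]] makes this say that [<(T - S) x, x>] is real and
   nonnegative. *)
Definition op_le S T := forall x, 0 <= inner H ((T - S) x) x.

Record unital_star_subalgebra A : Prop := {
  usa_bounded : forall T, A T -> bounded_op T;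
  usa_id : A idfun;
  usa_lin : forall (c : R[i]) S T, A S -> A T -> A (c *: S + T);
  usa_comp : forall S T, A S -> A T -> A (S \o T);
  usa_star : forall T, A T -> exists2 S, A S & is_adjoint T S }.

Definition wot_closed A :=
  forall T, bounded_op T ->
  (forall (F : seq (H * H)) (e : R), 0 < e ->
    exists2 S, A S & forall p, p \in F -> `|inner H ((T - S) p.1) p.2| < e%:C) ->
  A T.

Definition von_neumann A := unital_star_subalgebra A /\ wot_closed A.

Definition star_alg_gen B : set (H -> H) :=
  [set T | forall A, unital_star_subalgebra A -> B `<=` A -> A T].

(* [W^*(B)], the unital von Neumann algebra generated by [B]. *)
Definition vN_gen B : set (H -> H) :=
  [set T | forall A, von_neumann A -> B `<=` A -> A T].

Definition op_center A : set (H -> H) :=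
  [set Z | A Z /\ forall T, A T -> Z \o T = T \o Z].

Definition is_factor A :=
  forall Z, op_center A Z -> exists c : R[i], Z = c *: (idfun : H -> H).

Definition minimal_projection A T :=
  [/\ A T, projection T, T <> 0
    & forall S, A S -> projection S -> op_le S T -> S = 0 \/ S = T].

Definition diffuse_center A := ~ exists T, minimal_projection (op_center A) T.

(* [s] is the least upper bound of [D] among the self-adjoint elements
   of [A]. *)
Definition sa_lub A (D : set (H -> H)) s :=
  [/\ A s, selfadjoint s, (forall T, D T -> op_le T s)
    & forall s', A s' -> selfadjoint s' ->
        (forall T, D T -> op_le T s') -> op_le s s'].

(* Normality is preservation of suprema of upward directed sets. *)
Record faithful_normal_tracial_state A (tr : (H -> H) -> R[i]) : Prop := {
  state_lin : forall (c : R[i]) S T, A S -> A T ->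
    tr (c *: S + T) = c * tr S + tr T;
  state_id : tr idfun = 1;
  state_ge0 : forall T, A T -> 0 <= tr (adj T \o T);
  state_faithful : forall T, A T -> tr (adj T \o T) = 0 -> T = 0;
  state_tracial : forall S T, A S -> A T -> tr (S \o T) = tr (T \o S);
  state_normal : forall (D : set (H -> H)) s,
    D !=set0 ->
    (forall T, D T -> A T /\ selfadjoint T) ->
    (forall S T, D S -> D T -> exists2 V, D V & op_le S V /\ op_le T V) ->
    sa_lub A D s ->
    complex.Re (tr s) = sup [set complex.Re (tr T) | T in D] }.

End Operators.

Record tracial_wspace (R : realType) := TracialWspace {
  tw_hilbert : hilbert R;
  tw_alg : set (tw_hilbert -> tw_hilbert);
  tw_tr : (tw_hilbert -> tw_hilbert) -> R[i];
  tw_vN : von_neumann tw_alg;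
  tw_state : faithful_normal_tracial_state tw_alg tw_tr }.
Arguments tw_alg {R} _ _.
Arguments tw_tr {R} _ _.

Definition op (R : realType) (M : tracial_wspace R) : Type :=
  tw_hilbert M -> tw_hilbert M.

(* [emb] exhibits [N] as a tracial W*-probability space containing [M].
   Injectivity and normality of [emb] on [M] follow from preservation of the
   faithful normal traces. *)
Record trace_embedding (R : realType) (M N : tracial_wspace R)
    (emb : op M -> op N) : Prop := {
  emb_alg : forall T, tw_alg M T -> tw_alg N (emb T);
  emb_lin : forall (c : R[i]) (S T : op M), tw_alg M S -> tw_alg M T ->
    emb (c *: S + T) = c *: emb S + emb T;
  emb_id : emb idfun = idfun;
  emb_comp : forall S T : op M, tw_alg M S -> tw_alg M T ->
    emb (S \o T) = emb S \o emb T;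
  emb_adj : forall T, tw_alg M T -> emb (adj T) = adj (emb T);
  emb_tr : forall T, tw_alg M T -> tw_tr N (emb T) = tw_tr M T }.

Section NcPoly.
Context {R : realType} {n : nat}.

(* [C<t_1, ..., t_n>], the algebra of the free monoid on n letters. *)
Definition ncpoly := {malg R[i][{fmonom 'I_n}]}.

Definition ncpoly2 := {malg R[i][({fmonom 'I_n} * {fmonom 'I_n})%type]}.

(* The words [u (x) v] whose sum is [d_i w], from the Leibniz rule
   [d_i (t_j w) = delta_ij 1 (x) w + t_j . d_i w]. *)
Fixpoint diff_word (i : 'I_n) (w : seq 'I_n) : seq (seq 'I_n * seq 'I_n) :=
  if w is j :: v then
    (if i == j then [:: ([::], v)] else [::]) ++
    [seq (j :: p.1, p.2) | p <- diff_word i v]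
  else [::].

Lemma diff_word_letter i j :
  diff_word i [:: j] = if i == j then [:: ([::], [::])] else [::].
Proof. by rewrite /= cats0. Qed.

Lemma diff_word_leibniz i u v :
  diff_word i (u ++ v) =
  [seq (p.1, p.2 ++ v) | p <- diff_word i u] ++
  [seq (u ++ p.1, p.2) | p <- diff_word i v].
Proof.
elim: u => [|j u IHu] /=; first by rewrite -[LHS]map_id; apply: eq_map; case.
by rewrite IHu !map_cat -!map_comp catA; case: (i == j).
Qed.

Definition free_diff (i : 'I_n) (P : ncpoly) : ncpoly2 :=
  \sum_(w <- msupp P) \sum_(p <- diff_word i w)
    << P@_w *g (FMonom p.1, FMonom p.2) >>.

Context {M : tracial_wspace R}.

Definition eval_word (Y : 'I_n -> op M) (w : seq 'I_n) : op M :=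
  foldr (fun i T => Y i \o T) idfun w.

Definition eval_poly (Y : 'I_n -> op M) (P : ncpoly) : op M :=
  \sum_(w <- msupp P) P@_w *: eval_word Y w.

(* [(tau (x) tau) (Q (Y))] *)
Definition trtr_eval (Y : 'I_n -> op M) (Q : ncpoly2) : R[i] :=
  \sum_(p <- msupp Q)
    Q@_p * (tw_tr M (eval_word Y p.1) * tw_tr M (eval_word Y p.2)).

End NcPoly.
Arguments ncpoly R n : clear implicits.
Arguments ncpoly2 R n : clear implicits.

Section Free.
Context {R : realType} (M : tracial_wspace R).

Definition norm2 (T : op M) : R :=
  Num.sqrt (complex.Re (tw_tr M (adj T \o T))).

(* The elements of [L^2(A, tau)], the completion of [A] for the 2-norm, are
   represented by Cauchy sequences in [A]. *)
Definition L2 (A : set (op M)) (u : nat -> op M) :=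
  (forall k, A (u k)) /\
  forall e : R, 0 < e ->
    exists N, forall p q, (N <= p)%N -> (N <= q)%N -> norm2 (u p - u q) < e.

Definition L2norm (u : nat -> op M) : R := lim (norm2 (u k) @[k --> \oo]).

Definition conjugate_variable n (Y : 'I_n -> op M) (i : 'I_n)
    (xi : nat -> op M) :=
  L2 (vN_gen (range Y)) xi /\
  forall P : ncpoly R n,
    (tw_tr M (xi k \o eval_poly Y P) : R[i]^o) @[k --> \oo] -->
    (trtr_eval Y (free_diff i P) : R[i]^o).

(* [Phi^*]; the conjugate variables are unique as elements of [L^2], so that
   the value does not depend on the representatives chosen by [xget]. *)
Definition free_fisher n (Y : 'I_n -> op M) : \bar R :=
  if `[< forall i, exists xi, conjugate_variable Y i xi >] then
    (\sum_(i < n)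
      L2norm (xget (fun=> 0) [set xi | conjugate_variable Y i xi]) ^+ 2)%:E
  else +oo%E.

(* A family of subsets is free when the unital *-algebras they generate
   are. *)
Definition free_family (I : Type) (B : I -> set (op M)) :=
  forall (m : nat) (i : nat -> I) (a : nat -> op M),
    (forall j, (j <= m)%N ->
       star_alg_gen (B (i j)) (a j) /\ tw_tr M (a j) = 0) ->
    (forall j, (j < m)%N -> i j <> i j.+1) ->
    tw_tr M (\big[(fun S T => S \o T)/idfun]_(0 <= j < m.+1) a j) = 0.

(* The distribution of [S] is the semicircle law of density
   [sqrt (4 - x^2) / (2 pi)] on [-2, 2]: mean 0, variance 1, [|S| = 2]. *)
Definition semicircular (S : op M) :=
  [/\ tw_alg M S, selfadjoint S
    & forall k : nat, tw_tr M (iter k S) =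
      (\int[@lebesgue_measure R]_(x in `[-2, 2])
        (x ^+ k * (Num.sqrt (4 - x ^+ 2) / (2 * pi))))%R%:C].

Definition free_semicircular_family n (S : 'I_n -> op M) :=
  (forall i, semicircular (S i)) /\ free_family (fun i => [set S i]).

Definition free_from (B C : set (op M)) :=
  free_family (fun b : bool => if b then B else C).

(* [delta^star (X)], computed with the semicircular perturbation [S]. *)
Definition delta_star n (X S : 'I_n -> op M) : \bar R :=
  (n%:R%:E - limf_einf
    (fun t : R =>
       t%:E * free_fisher (fun i => X i + (Num.sqrt t)%:C *: S i)%R) 0^'+)%E.

End Free.

(* Main.v *)
(* Put Y_i = X_i + r S_i with r = sqrt t, and let Z be central and self-adjoint, so
   that [Z, Y_i] = r [Z, S_i].  Free Gaussian integration by parts gives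
   tau(S_i Q) = r (tau (x) tau)(d_i Q) for noncommutative polynomials Q in the Y_j,
   hence |tau(S_i Q)| <= r |xi_i|_2 |Q|_2 with xi_i the conjugate variables.  Together
   with the identity sum_i d_i P # (Y_i (x) 1 - 1 (x) Y_i) = P (x) 1 - 1 (x) P it yields
   sum_i tau([P, Y_i] [S_i, Z]) =
     r (sum_i tau([P, S_i] [S_i, Z]) - 2 Cov(Z, P)).
   For P close to Z the right-hand side is close to 2 (n - 1) r Var(Z), by freeness of
   S_i and Z.  If P is the projection of Z on the polynomials in Y, then [P, Y_i] is the
   projection of r [Z, S_i], whose pairing with polynomials Q is at most
   2 |Z| r^2 |xi_i|_2 |Q|_2 up to o(r); so the left-hand side is at most
   4 |Z|^2 r t Phi^*(Y) up to o(r).  Dividing by r and letting t -> 0 gives the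
   inequality.  Kaplansky's density theorem provides the polynomials approximating Z in
   2-norm with control of the operator norm.

   If p is a central projection of trace 1/2, the inequality for Z = 2 p - 1 gives
   n - delta >= (n - 1) / 2.  If the center is diffuse, such a p exists: a central
   projection maximal among those of trace at most 1/2 has trace 1/2, since its
   complement contains nonzero central projections of arbitrarily small trace. *)

Require Import Defs.
From HB Require Import structures.
From mathcomp Require Import all_boot all_order all_algebra all_field.
From mathcomp Require Import complex finmap.
From mathcomp Require Import monalg.
From mathcomp Require Import all_classical all_reals all_analysis.
From mathcomp Require Import ring lra.
Set Implicit Arguments.
Unset Strict Implicit.
Unset Printing Implicit Defensive.
Import Order.TTheory GRing.Theory Num.Theory.
Import numFieldNormedType.Exports.
Local Open Scope classical_set_scope.
Local Open Scope complex_scope.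
Local Open Scope ring_scope.

(** The algebra acts on an arbitrary Hilbert space, so the trace need not be a vector state, and
    normality is available only as preservation of suprema of directed sets. Hence the detour
    through suprema of chains and Zorn's lemma: they show that the 2-norm is strongly continuous on
    the unit ball, which makes 2-norm closures of subalgebras weakly closed. The only functions of
    operators that occur are built from resolvents (1 + i b)^-1, which are norm limits of
    polynomials.

    A trace embedding is only known to preserve algebra and trace. The operator norm of an
    approximating polynomial is therefore carried into the larger algebra as a bound on left and
    right multiplication in the 2-norm, which traces of powers determine.

    The Fisher information at a given t has no a priori bound, so every error has to be controlled
    relative to 1 + t Phi, uniformly in the conjugate variables.

    The constant 2 is a quotient: each commutator with Z costs 2 |Z|, hence 4 |Z|^2 after squaring,
    against 2 (n - 1) times the variance. *)

Lemma quad_ge0_discr (R : realFieldType) (a b c : R) :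
  0 <= c -> (forall s : R, 0 <= a + 2 * s * b + s ^+ 2 * c) -> b ^+ 2 <= a * c.
Proof.
rewrite le_eqVlt => /orP[/eqP<- h|c0 h].
  have [->|b0] := eqVneq b 0; first by rewrite mulr0 expr0n.
  (* At this [s] the form, affine because [c = 0], takes the value [-1]. *)
  have := h (- (a + 1) / (2 * b)).
  suff -> : a + 2 * (- (a + 1) / (2 * b)) * b + (- (a + 1) / (2 * b)) ^+ 2 * 0
    = - 1 by lra.
  by field.
have := h (- b / c).
have -> : a + 2 * (- b / c) * b + (- b / c) ^+ 2 * c = a - b ^+ 2 / c.
  by field; rewrite gt_eqF.
by rewrite subr_ge0 ler_pdivrMr.
Qed.

(** * Hilbert spaces *)

Section ComplexFacts.
Context {R : realType}.
Implicit Types (x y : R[i]) (r : R).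

Lemma ReZ r x : complex.Re (r%:C * x) = r * complex.Re x.
Proof. by case: x => a b /=; rewrite mul0r subr0. Qed.

Lemma ReD x y : complex.Re (x + y) = complex.Re x + complex.Re y.
Proof. by case: x; case: y. Qed.

Lemma ReN x : complex.Re (- x) = - complex.Re x.
Proof. by case: x. Qed.

Lemma ReB x y : complex.Re (x - y) = complex.Re x - complex.Re y.
Proof. by rewrite ReD ReN. Qed.

Lemma Re_sum (I : Type) (s : seq I) (P : pred I) (F : I -> R[i]) :
  complex.Re (\sum_(i <- s | P i) F i) = \sum_(i <- s | P i) complex.Re (F i).
Proof. by elim/big_rec2: _ => // i a b _ <-; rewrite ReD. Qed.

Lemma Re_conj x : complex.Re (conjc x) = complex.Re x.
Proof. by case: x. Qed.

Lemma ge0_ReK x : 0 <= x -> x = (complex.Re x)%:C.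
Proof. by case: x => a b; rewrite lecE /= => /andP[/eqP-> _]. Qed.

Lemma ge0_Re x : 0 <= x -> 0 <= complex.Re x.
Proof. by case: x => a b; rewrite lecE /= => /andP[]. Qed.

End ComplexFacts.

Section HilbertGeometry.
Context {R : realType} {H : hilbert R}.
Implicit Types (x y : H) (r : R).

(** With the real part all estimates live in the ordered field [R]. Nothing is lost: [inner_rip]
    recovers the imaginary part from ['i *: x]. *)
Definition rip x y : R := complex.Re (inner H x y).
Definition hnorm x : R := complex.Re `|x|.

Lemma hnormE x : `|x| = (hnorm x)%:C.
Proof. by rewrite /hnorm RRe_real// normr_real. Qed.

Lemma hnorm_ge0 x : 0 <= hnorm x.
Proof. by rewrite -ler0c -hnormE. Qed.

Lemma ripDl x y (z : H) : rip (x + y) z = rip x z + rip y z.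
Proof. by rewrite /rip linearDl ReD. Qed.

Lemma ripDr x y (z : H) : rip z (x + y) = rip z x + rip z y.
Proof. by rewrite /rip linearDr ReD. Qed.

Lemma ripNl x y : rip (- x) y = - rip x y.
Proof. by rewrite /rip linearNl ReN. Qed.

Lemma ripNr x y : rip y (- x) = - rip y x.
Proof. by rewrite /rip linearNr ReN. Qed.

Lemma ripBl x y (z : H) : rip (x - y) z = rip x z - rip y z.
Proof. by rewrite ripDl ripNl. Qed.

Lemma ripBr x y (z : H) : rip z (x - y) = rip z x - rip z y.
Proof. by rewrite ripDr ripNr. Qed.

Lemma ripC x y : rip x y = rip y x.
Proof. by rewrite /rip hermC expr0 mul1r; apply: Re_conj. Qed.

Lemma ripZl r x y : rip (r%:C *: x) y = r * rip x y.
Proof. by rewrite /rip linearZl_LR /= ReZ. Qed.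

Lemma ripZr r x y : rip y (r%:C *: x) = r * rip y x.
Proof. by rewrite ripC ripZl ripC. Qed.

Lemma ripi x y : rip ('i *: x) ('i *: y) = rip x y.
Proof.
rewrite /rip linearZl_LR linearZr_LR /= mulrA.
suff -> : 'i * ('i : R[i])^*%R = 1 by rewrite mul1r.
by rewrite -normCK normCi expr1n.
Qed.

Lemma rip0l x : rip 0 x = 0.
Proof. by rewrite -[X in rip X _](subrr 0) ripBl subrr. Qed.

Lemma rip_ext x y : (forall z, rip x z = rip y z) -> x = y.
Proof.
move=> e; apply/eqP; rewrite -subr_eq0 -normr_eq0 -sqrf_eq0 -inner_norm.
rewrite -[X in X == _]/(inner H (x - y) (x - y)) [X in X == _]ge0_ReK ?dnorm_ge0//.
by rewrite -/(rip _ _) ripBl e subrr.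
Qed.

Lemma ripxx x : rip x x = hnorm x ^+ 2.
Proof. by rewrite /rip inner_norm hnormE -rmorphXn. Qed.

Lemma inner_rip x y : inner H x y = (rip x y)%:C - (rip ('i *: x) y)%:C * 'i.
Proof.
have e : inner H ('i *: x) y = 'i%C * inner H x y.
  by rewrite linearZl_LR -complexiE.
rewrite /rip e -complexiE; case: (inner H x y) => a b.
by apply/eqP; rewrite eq_complex /=; apply/andP; split; apply/eqP; ring.
Qed.

Lemma rip_CS x y : `|rip x y| <= hnorm x * hnorm y.
Proof.
rewrite -(ler_sqr (normr_ge0 _)) ?nnegrE ?mulr_ge0 ?hnorm_ge0//.
rewrite real_normK ?num_real// exprMn; apply: quad_ge0_discr; first exact: sqr_ge0.
move=> s; rewrite -!ripxx.
have -> : rip x x + 2 * s * rip x y + s ^+ 2 * rip y y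
   = rip (x + s%:C *: y) (x + s%:C *: y).
  by rewrite !(ripDl, ripDr) !(ripZl, ripZr) [rip y x]ripC; ring.
by rewrite ripxx sqr_ge0.
Qed.

Lemma hnormD x y : hnorm (x + y) <= hnorm x + hnorm y.
Proof. by rewrite -lecR rmorphD /= -!hnormE ler_normD. Qed.

Lemma hnormN x : hnorm (- x) = hnorm x.
Proof. by rewrite /hnorm normrN. Qed.

Lemma hnormBC x y : hnorm (x - y) = hnorm (y - x).
Proof. by rewrite -hnormN opprB. Qed.

Lemma hnormB x y : hnorm (x - y) <= hnorm x + hnorm y.
Proof. by rewrite -(hnormN y) hnormD. Qed.

Lemma hnorm_tri (z : H) x y : hnorm (x - y) <= hnorm (x - z) + hnorm (z - y).
Proof. by rewrite (le_trans _ (hnormD _ _))// addrA subrK. Qed.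

Lemma hnormZ r x : hnorm (r%:C *: x) = `|r| * hnorm x.
Proof.
apply/eqP; rewrite -(eqrXn2 (n := 2))// ?mulr_ge0 ?hnorm_ge0//.
rewrite -ripxx ripZl ripZr ripxx exprMn real_normK ?num_real//.
by rewrite mulrA -expr2.
Qed.

Lemma hnormZc (z : R[i]) x : hnorm (z *: x) = complex.Re `|z| * hnorm x.
Proof.
by apply: complexI; rewrite -hnormE normrZ rmorphM /= -(ge0_ReK (normr_ge0 z)) hnormE.
Qed.

Lemma hnormi x : hnorm ('i *: x) = hnorm x.
Proof.
by apply/eqP; rewrite -(eqrXn2 (n := 2))// ?hnorm_ge0// -!ripxx ripi.
Qed.

Lemma hnorm0 : hnorm 0 = 0.
Proof. by rewrite /hnorm normr0. Qed.

Lemma hnorm_eq0 x : hnorm x = 0 -> x = 0.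
Proof. by move=> e; apply/eqP; rewrite -normr_eq0 hnormE e. Qed.

Lemma hnorm_small x : (forall e : R, 0 < e -> hnorm x <= e) -> x = 0.
Proof.
move=> h; apply: hnorm_eq0; apply/eqP; rewrite eq_le hnorm_ge0 andbT.
by apply/ler_addgt0Pl => e e0; rewrite addr0 h.
Qed.

(** Real and imaginary parts are bounded separately by [rip_CS], whence the factor 2. *)
Lemma inner_le x y : `|inner H x y| <= (2 * (hnorm x * hnorm y))%:C.
Proof.
rewrite inner_rip (le_trans (ler_normB _ _))// normrM -complexiE.
have -> : `|'i%C : R[i]| = 1 by rewrite complexiE normCi.
rewrite mulr1 mulr_natl mulr2n rmorphD /= lerD//.
  rewrite normc_def /= expr0n addr0 sqrtr_sqr lecR; exact: rip_CS.
rewrite normc_def /= expr0n addr0 sqrtr_sqr lecR (le_trans (rip_CS _ _))//.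
by rewrite complexiE hnormi.
Qed.

End HilbertGeometry.

Lemma innerC (R : realType) (H : hilbert R) (x y : H) :
  inner H x y = conjc (inner H y x).
Proof. by rewrite hermC expr0 mul1r. Qed.

Lemma is_adjoint_uniq (R : realType) (H : hilbert R) (T S S' : H -> H) :
  is_adjoint T S -> is_adjoint T S' -> S = S'.
Proof.
move=> h h'; apply/funext => y; apply: rip_ext => z.
by rewrite ripC [RHS]ripC /rip -h -h'.
Qed.

Lemma adj_eq (R : realType) (H : hilbert R) (T S : H -> H) :
  is_adjoint T S -> adj T = S.
Proof.
move=> h; apply: xget_unique => // S' h'; exact: is_adjoint_uniq h' h.
Qed.

Lemma is_adjoint_sym (R : realType) (H : hilbert R) (T S : H -> H) :
  is_adjoint T S -> is_adjoint S T.
Proof. by move=> h x y; rewrite innerC -h -innerC. Qed.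

(** The imaginary part of the adjointness relation is its real part at ['i *: x], which linearity of
    [T] makes available. *)
Lemma linear_ripP (R : realType) (H : hilbert R) (T S : H -> H) :
  linear T -> (forall x y, rip (T x) y = rip x (S y)) -> is_adjoint T S.
Proof.
move=> lT h x y; rewrite inner_rip [RHS]inner_rip -h; congr (_ - _%:C * _).
have T0 : T 0 = 0 by have := lT (-1) 0 0; rewrite scaler0 addr0 scaleN1r addNr.
rewrite -h -['i *: x]addr0 lT T0 !addr0; reflexivity.
Qed.

(** * The algebra of operators and its trace *)

(** Bundling the membership proof gives a type that carries an algebra structure over [R[i]]; by
    proof irrelevance its equality is that of the underlying functions. *)
Record walg (R : realType) (M : tracial_wspace R) :=
  WAlg { wfun :> tw_hilbert M -> tw_hilbert M; wfunP : tw_alg M wfun }.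

Section AlgebraStructure.
Context {R : realType} {M : tracial_wspace R}.
Notation A := (walg M).
Notation H := (tw_hilbert M).
Implicit Types a b c : A.

Lemma walg_ext a b : (forall x, a x = b x) -> a = b.
Proof.
case: a => f fP; case: b => g gP /= /funext e; subst g.
by congr WAlg; apply: Prop_irrelevance.
Qed.

Lemma walg_usa : unital_star_subalgebra (tw_alg M).
Proof. by have [] := tw_vN M. Qed.

Lemma walg_linear a : linear (a : H -> H).
Proof. by have [] := usa_bounded walg_usa (wfunP a). Qed.

Lemma walg_funD a x y : a (x + y) = a x + a y.
Proof. by have := walg_linear a 1 x y; rewrite !scale1r. Qed.

Lemma walg_fun0 a : a 0 = 0.
Proof. by apply: (addrI (a 0)); rewrite -walg_funD !addr0. Qed.

Lemma walg_funZ a (c : R[i]) x : a (c *: x) = c *: a x.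
Proof. by have := walg_linear a c x 0; rewrite walg_fun0 !addr0. Qed.

Lemma tw_lin (c : R[i]) (S T : H -> H) :
  tw_alg M S -> tw_alg M T -> tw_alg M (c *: S + T).
Proof. exact: (usa_lin walg_usa). Qed.

Lemma tw_0 : tw_alg M (0 : H -> H).
Proof.
have := tw_lin (-1) (usa_id walg_usa) (usa_id walg_usa).
by rewrite scaleN1r addNr.
Qed.

Lemma tw_D (S T : H -> H) : tw_alg M S -> tw_alg M T -> tw_alg M (S + T).
Proof. by move=> /tw_lin h /h => /(_ 1); rewrite scale1r. Qed.

Lemma tw_Z (c : R[i]) (S : H -> H) : tw_alg M S -> tw_alg M (c *: S).
Proof. by move=> /tw_lin => /(_ c 0 tw_0); rewrite addr0. Qed.

Lemma tw_N (S : H -> H) : tw_alg M S -> tw_alg M (- S).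
Proof. by move=> /(tw_Z (-1)); rewrite scaleN1r. Qed.

HB.instance Definition _ := gen_eqMixin A.
HB.instance Definition _ := gen_choiceMixin A.

Definition walg0 : A := WAlg tw_0.
Definition walg1 : A := WAlg (usa_id walg_usa).
Definition walg_add a b : A := WAlg (tw_D (wfunP a) (wfunP b)).
Definition walg_opp a : A := WAlg (tw_N (wfunP a)).
Definition walg_scale (c : R[i]) a : A := WAlg (tw_Z c (wfunP a)).
Definition walg_mul a b : A := WAlg (usa_comp walg_usa (wfunP a) (wfunP b)).

Lemma walg_addA : associative walg_add.
Proof. by move=> a b c; apply: walg_ext => x; apply: addrA. Qed.
Lemma walg_addC : commutative walg_add.
Proof. by move=> a b; apply: walg_ext => x; apply: addrC. Qed.
Lemma walg_add0 : left_id walg0 walg_add.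
Proof. by move=> a; apply: walg_ext => x; apply: add0r. Qed.
Lemma walg_addN : left_inverse walg0 walg_opp walg_add.
Proof. by move=> a; apply: walg_ext => x; apply: addNr. Qed.

HB.instance Definition _ :=
  GRing.isZmodule.Build A walg_addA walg_addC walg_add0 walg_addN.

Lemma walg_mulA : associative walg_mul.
Proof. by move=> a b c; apply: walg_ext. Qed.
Lemma walg_mul1l : left_id walg1 walg_mul.
Proof. by move=> a; apply: walg_ext. Qed.
Lemma walg_mul1r : right_id walg1 walg_mul.
Proof. by move=> a; apply: walg_ext. Qed.
Lemma walg_mulDl : left_distributive walg_mul +%R.
Proof. by move=> a b c; apply: walg_ext. Qed.
Lemma walg_mulDr : right_distributive walg_mul +%R.
Proof. by move=> a b c; apply: walg_ext => x; apply: walg_funD. Qed.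

Lemma walg_oner_neq0 : walg1 != 0.
Proof.
apply/eqP => /(congr1 (fun a : A => tw_tr M a)) /= e.
have := state_lin (tw_state M) (-1) (usa_id walg_usa) (usa_id walg_usa).
rewrite scaleN1r addNr (state_id (tw_state M)) mulN1r addNr -[X in tw_tr M X]/(wfun 0).
by rewrite -e (state_id (tw_state M)) => /eqP; rewrite oner_eq0.
Qed.

HB.instance Definition _ := GRing.Zmodule_isNzRing.Build A
  walg_mulA walg_mul1l walg_mul1r walg_mulDl walg_mulDr walg_oner_neq0.

Lemma walg_scaleA (c d : R[i]) a : walg_scale c (walg_scale d a) = walg_scale (c * d) a.
Proof. by apply: walg_ext => x; apply: scalerA. Qed.
Lemma walg_scale1 : left_id 1 walg_scale.
Proof. by move=> a; apply: walg_ext => x; apply: scale1r. Qed.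
Lemma walg_scaleDr : right_distributive walg_scale +%R.
Proof. by move=> c a b; apply: walg_ext => x; apply: scalerDr. Qed.
Lemma walg_scaleDl a : {morph walg_scale^~ a : c d / c + d}.
Proof. by move=> c d; apply: walg_ext => x; apply: scalerDl. Qed.

HB.instance Definition _ := GRing.Zmodule_isLmodule.Build R[i] A
  walg_scaleA walg_scale1 walg_scaleDr walg_scaleDl.

Lemma walg_scaleAl (c : R[i]) a b : c *: (a * b) = c *: a * b.
Proof. by apply: walg_ext. Qed.
HB.instance Definition _ := GRing.Lmodule_isLalgebra.Build R[i] A walg_scaleAl.

Lemma walg_scaleAr (c : R[i]) a b : c *: (a * b) = a * (c *: b).
Proof. by apply: walg_ext => x; rewrite [RHS]walg_funZ. Qed.
HB.instance Definition _ := GRing.Lalgebra_isAlgebra.Build R[i] A walg_scaleAr.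

Lemma waddE a b x : (a + b) x = a x + b x.  Proof. by []. Qed.
Lemma woppE a x : (- a) x = - a x.  Proof. by []. Qed.
Lemma wsubE a b x : (a - b) x = a x - b x.  Proof. by []. Qed.
Lemma wscaleE (c : R[i]) a x : (c *: a) x = c *: a x.  Proof. by []. Qed.
Lemma wmulE a b x : (a * b) x = a (b x).  Proof. by []. Qed.
Lemma woneE x : (1 : A) x = x.  Proof. by []. Qed.
Lemma wzeroE x : (0 : A) x = 0.  Proof. by []. Qed.

Definition wE := (waddE, woppE, wscaleE, wmulE, woneE, wzeroE).

Lemma adj_alg a : tw_alg M (adj a) /\ is_adjoint a (adj a).
Proof. by have [S AS aS] := usa_star walg_usa (wfunP a); rewrite (adj_eq aS). Qed.

Definition star a : A := WAlg (adj_alg a).1.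

Lemma starP a : is_adjoint a (star a).
Proof. exact: (adj_alg a).2. Qed.

Lemma wfun_star a : star a = adj a :> (H -> H).
Proof. by []. Qed.

Lemma star_eq a b : is_adjoint a b -> star a = b.
Proof. by move=> h; apply: walg_ext => x /=; rewrite (adj_eq h). Qed.

Lemma rip_star a x y : rip (a x) y = rip x (star a y).
Proof. by rewrite /rip starP. Qed.

Lemma star_eq_rip a b : (forall x y, rip (a x) y = rip x (b y)) -> star a = b.
Proof. by move=> h; apply: star_eq; apply: linear_ripP => //; apply: walg_linear. Qed.

Lemma starK : involutive star.
Proof. by move=> a; apply: star_eq; apply: is_adjoint_sym; apply: starP. Qed.

Lemma starM a b : star (a * b) = star b * star a.
Proof. by apply: star_eq_rip => x y; rewrite !wmulE !rip_star. Qed.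

Lemma star_is_additive : additive star.
Proof.
move=> a b; apply: star_eq_rip => x y.
by rewrite !wsubE ripBl ripBr !rip_star.
Qed.
HB.instance Definition _ := GRing.isAdditive.Build A A star star_is_additive.

Lemma star1 : star 1 = 1.
Proof. by apply: star_eq_rip. Qed.

Lemma starZr (r : R) a : star (r%:C *: a) = r%:C *: star a.
Proof. by apply: star_eq_rip => x y; rewrite !wscaleE ripZl ripZr rip_star. Qed.

Lemma starZ (c : R[i]) a : star (c *: a) = c^*%C *: star a.
Proof.
apply: star_eq => x y; rewrite !wscaleE linearZl_LR linearZr_LR /= starP.
congr (_ * _); exact: esym (conjcK c).
Qed.

Lemma selfadjointP a : selfadjoint (a : H -> H) <-> star a = a.
Proof. by split=> [/star_eq//|e]; move: (starP a); rewrite e. Qed.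

Lemma rip_sa a x y : star a = a -> rip (a x) y = rip x (a y).
Proof. by move=> e; rewrite rip_star e. Qed.

Definition obnd (K : R) a := 0 <= K /\ forall x, hnorm (a x) <= K * hnorm x.

Lemma obnd_ex a : exists K, obnd K a.
Proof.
have [_ [K hK]] := usa_bounded walg_usa (wfunP a).
exists `|K|; split=> // x; rewrite -lecR rmorphM /= -!hnormE.
apply: (le_trans (hK x)); apply: ler_wpM2r => //.
by rewrite lecR ler_norm.
Qed.

Lemma obnd_le K L a : obnd K a -> K <= L -> obnd L a.
Proof.
move=> [K0 h] KL; split; first exact: le_trans KL.
by move=> x; apply: (le_trans (h x)); rewrite ler_wpM2r ?hnorm_ge0.
Qed.

Lemma obndD K L a b : obnd K a -> obnd L b -> obnd (K + L) (a + b).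
Proof.
move=> [K0 h] [L0 g]; split; first exact: addr_ge0.
by move=> x; rewrite waddE (le_trans (hnormD _ _))// mulrDl lerD.
Qed.

Lemma obndN K a : obnd K a -> obnd K (- a).
Proof. by move=> [K0 h]; split=> // x; rewrite woppE hnormN. Qed.

Lemma obndB K L a b : obnd K a -> obnd L b -> obnd (K + L) (a - b).
Proof. by move=> h /obndN; apply: obndD. Qed.

Lemma obndM K L a b : obnd K a -> obnd L b -> obnd (K * L) (a * b).
Proof.
move=> [K0 h] [L0 g]; split; first exact: mulr_ge0.
by move=> x; rewrite wmulE (le_trans (h _))// -mulrA ler_wpM2l.
Qed.

Lemma obndZ (r : R) K a : obnd K a -> obnd (`|r| * K) (r%:C *: a).
Proof.
move=> [K0 h]; split; first exact: mulr_ge0.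
by move=> x; rewrite wscaleE hnormZ -mulrA ler_wpM2l.
Qed.

Lemma obndi K a : obnd K a -> obnd K ('i *: a).
Proof. by move=> [K0 h]; split=> // x; rewrite wscaleE hnormi. Qed.

Lemma obnd1 : obnd 1 1.
Proof. by split=> // x; rewrite mul1r. Qed.

Lemma obnd0 : obnd 0 0.
Proof. by split=> // x; rewrite hnorm0 mul0r. Qed.

Lemma obnd_star K a : obnd K a -> obnd K (star a).
Proof.
move=> [K0 h]; split=> // x.
have [->|x0] := eqVneq (hnorm (star a x)) 0; first by rewrite mulr_ge0 ?hnorm_ge0.
have p : 0 < hnorm (star a x) by rewrite lt_def x0 hnorm_ge0.
rewrite -(ler_pM2r p) -expr2 -ripxx -rip_star.
apply: (le_trans (ler_norm _)); apply: (le_trans (rip_CS _ _)).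
by rewrite mulrAC ler_wpM2r ?hnorm_ge0.
Qed.

(* [fun x => <(b - a) x, x>] is real, being [op_le], as soon as [a] and [b] are
   self-adjoint. *)
Definition wle a b := forall x, rip (a x) x <= rip (b x) x.

Lemma rip_ii a x : star a = a -> rip ('i *: a x) x = 0.
Proof.
move=> sa.
have e : rip ('i *: a x) x = - rip ('i *: a x) x.
  rewrite -[LHS]ripi scalerA -expr2 sqrCi scaleN1r ripNl rip_sa // walg_funZ.
  by rewrite ripC.
by lra.
Qed.

Lemma op_leP a b : star a = a -> star b = b ->
  op_le (a : H -> H) b <-> wle a b.
Proof.
move=> sa sb; split=> h x.
  by have := ge0_Re (h x); rewrite -/(rip _ _) [X in rip X _]/(b x - a x) ripBl subr_ge0.
rewrite inner_rip -[(_ - _) x]/((b - a) x) rip_ii ?mul0r ?subr0; last first.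
  by rewrite raddfB /= sa sb.
by rewrite ler0c wsubE ripBl subr_ge0.
Qed.

Lemma wle_refl a : wle a a.
Proof. by []. Qed.

Lemma wle_trans a b c : wle a b -> wle b c -> wle a c.
Proof. by move=> h g x; apply: le_trans (h x) (g x). Qed.

Lemma wle_subr a b : wle a b <-> wle 0 (b - a).
Proof. by split=> h x; have := h x; rewrite wsubE wzeroE ripBl rip0l subr_ge0. Qed.

Lemma rip_pos_CS a x y : star a = a -> wle 0 a ->
  rip (a x) y ^+ 2 <= rip (a x) x * rip (a y) y.
Proof.
move=> sa p.
have p' z : 0 <= rip (a z) z by have := p z; rewrite wzeroE rip0l.
apply: quad_ge0_discr => // s.
have := p' (x + s%:C *: y).
rewrite walg_funD walg_funZ !(ripDl, ripDr) !(ripZl, ripZr).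
rewrite [rip (a y) x]rip_sa// [rip y _]ripC.
by move=> h; apply: (le_trans h); rewrite le_eqVlt; apply/orP; left; apply/eqP; ring.
Qed.

(** Cauchy-Schwarz for the positive form <a ., .>, applied to [x] and [a x]. It expresses a^2 <= K a
    and does the work of a square root of [a]. *)
Lemma hnorm_pos a K x : star a = a -> wle 0 a -> wle a (K%:C *: 1) ->
  hnorm (a x) ^+ 2 <= K * rip (a x) x.
Proof.
move=> sa p q.
have [e|ne] := eqVneq (hnorm (a x)) 0.
  rewrite (hnorm_eq0 e) hnorm0 rip0l expr0n mulr0//.
have := rip_pos_CS x (a x) sa p; rewrite ripxx => h.
have := q (a x); rewrite wscaleE woneE ripZl ripxx => h'.
have p' z : 0 <= rip (a z) z by have := p z; rewrite wzeroE rip0l.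
have : hnorm (a x) ^+ 2 * hnorm (a x) ^+ 2 <= (K * rip (a x) x) * hnorm (a x) ^+ 2.
  rewrite -expr2; apply: (le_trans h).
  by rewrite [K * _]mulrC -mulrA ler_wpM2l.
by rewrite ler_pM2r// exprn_gt0// lt_def ne hnorm_ge0.
Qed.

Lemma wle_anti a b : star a = a -> star b = b -> wle a b -> wle b a -> a = b.
Proof.
move=> sa sb h g; apply/eqP; rewrite -subr_eq0; apply/eqP.
apply: walg_ext => x; apply: hnorm_eq0; apply/eqP; rewrite -sqrf_eq0 eq_le sqr_ge0 andbT.
have sd : star (a - b) = a - b by rewrite raddfB /= sa sb.
have p : wle 0 (a - b) by exact: (wle_subr b a).1 g.
have q : wle (a - b) (0%:C *: 1).
  by move=> y; have := g y; rewrite scale0r wzeroE rip0l wsubE ripBl subr_le0.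
by have := hnorm_pos x sd p q; rewrite mul0r.
Qed.

Lemma wle_star_mul a : wle 0 (star a * a).
Proof. by move=> x; rewrite wzeroE rip0l wmulE ripC -rip_star ripxx sqr_ge0. Qed.

Lemma wleD a b c d : wle a b -> wle c d -> wle (a + c) (b + d).
Proof. by move=> h g x; rewrite !waddE !ripDl lerD. Qed.

End AlgebraStructure.

Section Trace.
Context {R : realType} {M : tracial_wspace R}.
Notation A := (walg M).
Notation H := (tw_hilbert M).
Implicit Types a b c d : A.

Definition tau (a : A) : R[i] := tw_tr M a.
Definition rt a : R := complex.Re (tau a).
Definition n2 a : R := norm2 (a : op M).

Lemma tau_is_linear : scalar tau.
Proof. by move=> c a b; apply: (state_lin (tw_state M)); apply: wfunP. Qed.
HB.instance Definition _ := GRing.isLinear.Build R[i] A R[i] *%R tau tau_is_linear.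

Lemma tauZ (c : R[i]) a : tau (c *: a) = c * tau a.
Proof. exact: linearZ. Qed.

Lemma tau1 : tau 1 = 1.
Proof. exact: (state_id (tw_state M)). Qed.

Lemma tauC a b : tau (a * b) = tau (b * a).
Proof. by apply: (state_tracial (tw_state M)); apply: wfunP. Qed.

Lemma tau_pos a : 0 <= tau (star a * a).
Proof. exact: (state_ge0 (tw_state M) (wfunP a)). Qed.

Lemma rtD a b : rt (a + b) = rt a + rt b.
Proof. by rewrite /rt raddfD ReD. Qed.
Lemma rtN a : rt (- a) = - rt a.
Proof. by rewrite /rt raddfN ReN. Qed.
Lemma rtB a b : rt (a - b) = rt a - rt b.
Proof. by rewrite rtD rtN. Qed.
Lemma rtZ (r : R) a : rt (r%:C *: a) = r * rt a.
Proof. by rewrite /rt tauZ ReZ. Qed.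
Lemma rt0 : rt 0 = 0.
Proof. by rewrite /rt raddf0. Qed.
Lemma rt1 : rt 1 = 1.
Proof. by rewrite /rt tau1. Qed.
Lemma rtC a b : rt (a * b) = rt (b * a).
Proof. by rewrite /rt tauC. Qed.
Lemma rt_sum (I : Type) (s : seq I) (P : pred I) (F : I -> A) :
  rt (\sum_(i <- s | P i) F i) = \sum_(i <- s | P i) rt (F i).
Proof. by rewrite /rt raddf_sum Re_sum. Qed.

Lemma rt_pos a : 0 <= rt (star a * a).
Proof. exact: ge0_Re (tau_pos a). Qed.

(** Positivity is given only on elements [star a * a]. That [star (b + c) * (b + c)] has real trace
    for c = 1 and for c = i fixes both parts of [tau (star b)]. *)
Lemma tau_star a : tau (star a) = (tau a)^*%C.
Proof.
have key (b : A) (c : R[i]) : complex.Im (c^*%C * tau b + c * tau (star b)) = 0.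
  have := tau_pos (b + c *: 1).
  rewrite raddfD /= starZ star1 mulrDr !mulrDl -!scalerAl -!scalerAr !mul1r !mulr1.
  rewrite !raddfD /= !tauZ tau1 lecE => /andP[/eqP + _].
  have := tau_pos b; rewrite lecE => /andP[/eqP + _].
  case: c => c1 c2; case: (tau b) => b1 b2; case: (tau (star b)) => d1 d2.
  case: (tau _) => e1 e2 /=; lra.
have := key a 1; have := key a 'i%C.
case: (tau a) => a1 a2; case: (tau (star a)) => b1 b2 /=.
by move=> h1 h2; congr (_ +i* _); lra.
Qed.

Lemma rt_star a : rt (star a) = rt a.
Proof. by rewrite /rt tau_star; case: (tau a). Qed.

Lemma tau_sa a : star a = a -> tau a = (rt a)%:C.
Proof.
move=> sa; have := tau_star a; rewrite sa /rt; case: (tau a) => x y /= [].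
by move=> /eqP; rewrite -subr_eq0 opprK -mulr2n mulrn_eq0 /= => /eqP->.
Qed.

Lemma n2E a : n2 a = Num.sqrt (rt (star a * a)).
Proof. by []. Qed.

Lemma n2_ge0 a : 0 <= n2 a.
Proof. exact: sqrtr_ge0. Qed.

Lemma n2sq a : n2 a ^+ 2 = rt (star a * a).
Proof. by rewrite n2E sqr_sqrtr ?rt_pos. Qed.

Lemma n2_eq0 a : n2 a = 0 -> a = 0.
Proof.
move=> h; apply: walg_ext => x; rewrite wzeroE.
suff -> : (a : H -> H) = 0 by [].
apply: (state_faithful (tw_state M) (wfunP a)).
rewrite -[X in X = _]/(tau (star a * a)) tau_sa; last by rewrite starM starK.
by rewrite -n2sq h expr0n.
Qed.

Lemma n2_star a : n2 (star a) = n2 a.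
Proof. by rewrite !n2E starK rtC. Qed.

Lemma n2N a : n2 (- a) = n2 a.
Proof. by rewrite !n2E raddfN mulrNN. Qed.

Lemma n2Z (r : R) a : n2 (r%:C *: a) = `|r| * n2 a.
Proof.
apply/eqP; rewrite -(eqrXn2 (n := 2))// ?mulr_ge0 ?n2_ge0//.
rewrite exprMn !n2sq starZr -scalerAl -scalerAr !rtZ real_normK ?num_real//.
by rewrite expr2 mulrA.
Qed.

Lemma n2Zc (z : R[i]) a : n2 (z *: a) = complex.Re `|z| * n2 a.
Proof.
apply/eqP; rewrite -(eqrXn2 (n := 2))// ?mulr_ge0 ?n2_ge0 ?ge0_Re//.
rewrite exprMn !n2sq starZ -scalerAl -scalerAr scalerA -rtZ rmorphXn /=.
by rewrite -(ge0_ReK (normr_ge0 z)) sqr_normc mulrC.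
Qed.

Lemma n2i a : n2 ('i *: a) = n2 a.
Proof.
rewrite !n2E -complexiE starZ -scalerAl -scalerAr scalerA.
suff -> : ('i%C : R[i])^*%C * 'i%C = 1 by rewrite scale1r.
by apply/eqP; rewrite eq_complex /=; apply/andP; split; apply/eqP; ring.
Qed.

Lemma n2_0 : n2 0 = 0.
Proof. by rewrite n2E mulr0 rt0 sqrtr0. Qed.

Lemma n2_1 : n2 1 = 1.
Proof. by rewrite n2E star1 mulr1 rt1 sqrtr1. Qed.

Lemma n2sqDZ a b (u : R) :
  n2 (a + u%:C *: b) ^+ 2 = n2 a ^+ 2 + 2 * u * rt (star b * a) + u ^+ 2 * n2 b ^+ 2.
Proof.
have h := n2sq (a + u%:C *: b).
rewrite raddfD /= starZr mulrDr !mulrDl -!scalerAl -!scalerAr !(rtD, rtZ) in h.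
have e : rt (star a * b) = rt (star b * a) by rewrite -rt_star starM starK.
by rewrite h !n2sq e; ring.
Qed.

Lemma rt_CS_star a b : `|rt (star a * b)| <= n2 a * n2 b.
Proof.
rewrite -(ler_sqr (normr_ge0 _)) ?nnegrE ?mulr_ge0 ?n2_ge0//.
rewrite real_normK ?num_real// exprMn; apply: quad_ge0_discr => [|u].
  exact: sqr_ge0.
have -> : rt (star a * b) = rt (star b * a) by rewrite -rt_star starM starK.
by rewrite -n2sqDZ sqr_ge0.
Qed.

Lemma rt_CS a b : `|rt (a * b)| <= n2 a * n2 b.
Proof. by rewrite -{1}[a]starK -(n2_star a) rt_CS_star. Qed.

Lemma n2D a b : n2 (a + b) <= n2 a + n2 b.
Proof.
rewrite -(ler_sqr (n2_ge0 _)) ?nnegrE ?addr_ge0 ?n2_ge0// sqrrD !n2sq.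
rewrite raddfD /= mulrDr !mulrDl !rtD -!addrA lerD2l !addrA lerD2r.
have -> : rt (star b * a) = rt (star a * b) by rewrite -rt_star starM starK.
by rewrite -mulr2n lerMn2r /= (le_trans (ler_norm _))// rt_CS_star.
Qed.

Lemma n2B a b : n2 (a - b) <= n2 a + n2 b.
Proof. by rewrite -(n2N b) n2D. Qed.

Lemma n2BC a b : n2 (a - b) = n2 (b - a).
Proof. by rewrite -n2N opprB. Qed.

Lemma n2_tri c a b : n2 (a - b) <= n2 (a - c) + n2 (c - b).
Proof. by rewrite (le_trans _ (n2D _ _))// addrA subrK. Qed.

(* Normality applied to the directed set [{a, b}]. *)
Lemma rt_mono a b : star a = a -> star b = b -> wle a b -> rt a <= rt b.
Proof.
move=> sa sb ab.
pose D : set (H -> H) := [set T : H -> H | T = a \/ T = b].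
have abop : op_le (a : H -> H) b by apply/op_leP.
have bbop : op_le (b : H -> H) b by apply/op_leP.
have -> : rt b = sup [set complex.Re (tw_tr M T) | T in D].
  apply: (state_normal (tw_state M)).
  - by exists (a : H -> H); left.
  - by move=> T [->|->]; split; first [exact: wfunP | exact/selfadjointP].
  - by move=> S T [->|->] [->|->]; exists (b : H -> H); (try by right); split.
  - split; [exact: wfunP|exact/selfadjointP|by move=> T [->|->]|].
    by move=> s' _ _; apply; right.
apply: ub_le_sup; last by exists (a : H -> H) => //; left.
exists (Num.max (rt a) (rt b)) => _ [T [->|->] <-]; by rewrite le_max lexx ?orbT.
Qed.

Lemma rt_ge0 a : star a = a -> wle 0 a -> 0 <= rt a.
Proof. by move=> sa h; rewrite -rt0 rt_mono// raddf0. Qed.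

(** As operators, [star b * star a * a * b] is at most [K ^+ 2] times [star b * b], and the trace is
    monotone. *)
Lemma n2Ml K a b : obnd K a -> n2 (a * b) <= K * n2 b.
Proof.
move=> [K0 h]; rewrite -(ler_sqr (n2_ge0 _)) ?nnegrE ?mulr_ge0 ?n2_ge0//.
rewrite exprMn !n2sq -rtZ; apply: rt_mono.
- by rewrite !starM !starK.
- by rewrite starZr !starM !starK.
move=> x; rewrite wscaleE ripZl !wmulE ![rip (star _ _) x]ripC -!rip_star !ripxx.
by rewrite -exprMn ler_sqr ?nnegrE ?mulr_ge0 ?hnorm_ge0// wmulE.
Qed.

Lemma n2Mr K a b : obnd K a -> n2 (b * a) <= K * n2 b.
Proof.
by move=> h; rewrite -n2_star starM -(n2_star b); apply: n2Ml; apply: obnd_star.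
Qed.

Lemma n2_obnd K a : obnd K a -> n2 a <= K.
Proof. by move=> h; have := n2Ml 1 h; rewrite mulr1 n2_1 mulr1. Qed.

End Trace.

(** * Suprema of chains and maximal elements *)

Lemma hcauchy (R : realType) (H : hilbert R) (u : nat -> H) :
  (forall e : R, 0 < e -> exists N, forall p, (N <= p)%N -> hnorm (u p - u N) <= e) ->
  exists y, forall e : R, 0 < e ->
    exists N, forall p, (N <= p)%N -> hnorm (u p - y) <= e.
Proof.
move=> h; have : cvg (u @ \oo).
  apply/cauchy_cvgP/cauchyP => e e0.
  have [N hN] := h (complex.Re e / 2) ltac:(by rewrite divr_gt0//; move: e0; rewrite ltcE => /andP[]).
  exists (u N); exists N => // p /= Np.
  rewrite -ball_normE /ball_ /= distrC hnormE (le_lt_trans (y := (complex.Re e / 2)%:C))//.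
    by rewrite lecR hN.
  rewrite [ltRHS]ge0_ReK ?ltW// ltcR; move: e0; rewrite ltcE => /andP[_ /=]; lra.
move=> /cvg_ex[y uy]; exists y => e e0.
have /cvgrPdist_le/(_ e%:C) := uy.
rewrite ltcR => /(_ e0) [N _ hN]; exists N => p /hN /=.
by rewrite distrC hnormE lecR.
Qed.

Section ChainSup.
Context {R : realType} {M : tracial_wspace R}.
Notation A := (walg M).
Notation H := (tw_hilbert M).
Implicit Types a b d s : A.

Definition unit_interval d := [/\ star d = d, wle 0 d & wle d 1].

Lemma unit_interval_obnd d : unit_interval d -> obnd 1 d.
Proof.
move=> [sd p q]; split=> // x; rewrite mul1r -ler_sqr ?nnegrE ?hnorm_ge0//.
have q' : wle d (1%:C *: 1) by rewrite scale1r.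
have := hnorm_pos x sd p q'; rewrite mul1r => h; apply: (le_trans h).
by have := q x; rewrite woneE ripxx.
Qed.

Lemma unit_interval_n2 d : unit_interval d -> n2 d ^+ 2 <= rt d.
Proof.
move=> [sd p q]; rewrite n2sq sd; apply: rt_mono => //; first by rewrite starM sd.
move=> x; rewrite wmulE rip_sa// ripxx -[leRHS]mul1r; apply: hnorm_pos => //.
by rewrite scale1r.
Qed.

Lemma unit_interval_sub d d' : unit_interval d -> unit_interval d' -> wle d d' ->
  unit_interval (d' - d).
Proof.
move=> [sd p q] [sd' p' q'] h; split; first by rewrite raddfB /= sd sd'.
  exact: (wle_subr d d').1.
move=> x; have := q' x; have := p x; rewrite wsubE ripBl wzeroE rip0l; lra.
Qed.

(** Besides the order supremum, the record keeps the two modes of convergence in use: on vectors and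
    in trace. What lies above some [d] of [D] serves as a tail of the chain. *)
Record chain_sup (D : set A) s : Prop := {
  chain_sup_sa : star s = s;
  chain_sup_ub : forall d, D d -> wle d s;
  chain_sup_lub : forall b, (forall d, D d -> wle d b) -> wle s b;
  chain_sup_sot : forall x (e : R), 0 < e -> exists2 d, D d &
    forall d', D d' -> wle d d' -> hnorm (s x - d' x) <= e;
  chain_sup_rt : forall e : R, 0 < e -> exists2 d, D d &
    forall d', D d' -> wle d d' -> rt s - rt d' <= e }.

Definition wchain (D : set A) := total_on D wle.

Section Chain.
Variables (D : set A) (d0 : A).
Hypothesis Dd0 : D d0.
Hypothesis D01 : D `<=` unit_interval.
Hypothesis Dchain : wchain D.

Let chain_lim x y := forall e : R, 0 < e -> exists2 d, D d &
  forall d', D d' -> wle d d' -> hnorm (y - d' x) <= e.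

Let chain_join d d' : D d -> D d' -> exists2 c, D c & wle d c /\ wle d' c.
Proof. by move=> h h'; have [|] := Dchain h h'; [exists d'|exists d]; rewrite //; split. Qed.

(** The increment [d' - d] lies in the unit interval, so [hnorm_pos] bounds its square on [x] by its
    quadratic form. Convergence of the increasing real forms thus becomes strong convergence. *)
Let chain_close d d' x (e : R) : D d -> D d' -> wle d d' ->
  rip (d' x) x - rip (d x) x <= e -> hnorm (d' x - d x) ^+ 2 <= e.
Proof.
move=> hd hd' dd'; apply: le_trans.
have [sa p q] := unit_interval_sub (D01 hd) (D01 hd') dd'.
rewrite -ripBl -wsubE -[leRHS]mul1r; apply: hnorm_pos => //.
by rewrite scale1r.
Qed.

Let chain_lim_ex x : exists y, chain_lim x y.
Proof.
pose E := [set rip (d x) x | d in D].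
have hE : has_sup E.
  split; first by exists (rip (d0 x) x), d0.
  exists (rip x x) => _ [d hd <-]; have [_ _ q] := D01 hd; exact: q.
have step (e : R) : 0 < e -> exists2 d, D d & sup E - e ^+ 2 < rip (d x) x.
  move=> e0; have [_ [d hd <-] h] := sup_adherent (exprn_gt0 2 e0) hE.
  by exists d.
have stepP (e : R) d d' : 0 < e -> D d -> D d' -> sup E - e ^+ 2 < rip (d x) x ->
    wle d d' -> hnorm (d' x - d x) <= e.
  move=> e0 hd hd' h dd'; rewrite -ler_sqr ?nnegrE ?hnorm_ge0 ?(ltW e0)//.
  apply: chain_close => //.
  have : rip (d' x) x <= sup E by apply: ub_le_sup; [exact: hE.2|exists d'].
  lra.
have i0 k : 0 < (k.+1%:R : R)^-1 by rewrite invr_gt0 ltr0n.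
pose f k := projT1 (cid2 (step _ (i0 k))).
have fD k : D (f k) by rewrite /f; case: cid2.
have fh k : sup E - (k.+1%:R^-1) ^+ 2 < rip (f k x) x by rewrite /f; case: cid2.
have small (e : R) : 0 < e -> exists N : nat, N.+1%:R^-1 <= e.
  move=> e0; exists (Num.truncn e^-1); rewrite -[leRHS]invrK lef_pV2 ?posrE ?invr_gt0 ?ltr0n//.
  by apply/ltW/truncnS_gt.
(* [f] need not be increasing; comparability in the chain decides which of the two indices carries
   the bound. *)
have fc k l : (k <= l)%N -> hnorm (f l x - f k x) <= k.+1%:R^-1.
  move=> kl.
  have [h|h] := Dchain (fD k) (fD l); first exact: stepP.
  rewrite hnormBC; apply: (le_trans (y := l.+1%:R^-1)); first exact: stepP.
  by rewrite lef_pV2 ?posrE ?ltr0n// ler_nat.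
have [|y hy] := @hcauchy R H (fun k => f k x).
  by move=> e /small[N hN]; exists N => p /fc h; apply: le_trans h hN.
exists y => e e0; have [N hN] := hy _ (divr_gt0 e0 (ltr0n R 2)).
have [K hK] := small _ (divr_gt0 e0 (ltr0n R 2)).
exists (f (maxn N K)) => // d' hd' h; apply: (le_trans (hnorm_tri (f (maxn N K) x) _ _)).
rewrite [e]splitr lerD//; first by rewrite hnormBC hN// leq_maxl.
rewrite hnormBC; apply: le_trans (stepP _ _ _ _ _ _ (fh _) h) _ => //.
apply: le_trans hK; rewrite lef_pV2 ?posrE ?ltr0n// ler_nat ltnS.
exact: leq_maxr.
Qed.

Let chain_lim_uniq x y y' : chain_lim x y -> chain_lim x y' -> y = y'.
Proof.
move=> h h'; apply/eqP; rewrite -subr_eq0; apply/eqP; apply: hnorm_small => e e0.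
have e2 : 0 < e / 2 by rewrite divr_gt0.
have [d hd hh] := h _ e2; have [d' hd' hh'] := h' _ e2.
have [c hc [dc dc']] := chain_join hd hd'.
apply: (le_trans (hnorm_tri (c x) _ _)); rewrite [e]splitr lerD//; first exact: hh.
by rewrite hnormBC hh'.
Qed.

Let chain_lim_lin (c : R[i]) x x' y y' :
  chain_lim x y -> chain_lim x' y' -> chain_lim (c *: x + x') (c *: y + y').
Proof.
move=> h h' e e0; pose k := complex.Re `|c| + 1.
have k0 : 0 < k by rewrite ltr_wpDl// ge0_Re.
have ek : 0 < e / 2 / k by rewrite !divr_gt0.
have [d hd hh] := h _ ek; have [d' hd' hh'] := h' _ (divr_gt0 e0 (ltr0n R 2)).
have [b hb [db db']] := chain_join hd hd'; exists b => // f hf bf.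
rewrite walg_funD walg_funZ opprD addrACA -scalerBr.
rewrite (le_trans (hnormD _ _))// [e]splitr lerD//; last first.
  by apply: hh' => //; apply: wle_trans bf.
have : hnorm (c *: (y - f x)) <= k * (e / 2 / k).
  rewrite -lecR -hnormE normrZ rmorphM /= hnormE ler_pM//.
    by rewrite ler0c hnorm_ge0.
    by rewrite [leLHS]ge0_ReK// lecR lerDl.
  by rewrite lecR hh//; apply: wle_trans bf.
by rewrite mulrCA mulfV ?mulr1// gt_eqF.
Qed.

Let sfun x := projT1 (cid (chain_lim_ex x)).

Let sfunP x : chain_lim x (sfun x).
Proof. by rewrite /sfun; case: cid. Qed.

Let sfun_linear : linear sfun.
Proof.
by move=> c x x'; apply: chain_lim_uniq (sfunP _) _; apply: chain_lim_lin.
Qed.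

Let sfun_adj : is_adjoint sfun sfun.
Proof.
apply: linear_ripP => // x y; apply/eqP; rewrite -subr_eq0; apply/eqP.
apply/eqP; rewrite -normr_eq0 eq_le normr_ge0 andbT; apply/ler_addgt0Pl => e e0.
rewrite addr0; pose k := hnorm x + hnorm y + 1.
have k0 : 0 < k by rewrite ltr_wpDl// addr_ge0 ?hnorm_ge0.
have ek : 0 < e / k by rewrite divr_gt0.
have [d hd h] := sfunP x ek; have [d' hd' h'] := sfunP y ek.
have [b hb [db db']] := chain_join hd hd'.
have [sb _ _] := D01 hb.
have -> : rip (sfun x) y - rip x (sfun y) = rip (sfun x - b x) y - rip x (sfun y - b y).
  by rewrite ripBl ripBr (rip_sa x y sb); ring.
rewrite (le_trans (ler_normB _ _))// (le_trans (lerD (rip_CS _ _) (rip_CS _ _)))//.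
have := h _ hb db; have := h' _ hb db'.
set u := hnorm (_ - _); set v := hnorm (_ - _) => hu hv.
apply: (le_trans (y := e / k * hnorm y + hnorm x * (e / k))).
  by rewrite lerD// ?ler_wpM2r ?ler_wpM2l ?hnorm_ge0.
rewrite [_ * (e / k)]mulrC -mulrDr; apply: (le_trans (y := e / k * k)).
  by rewrite ler_pM2l// /k; lra.
by rewrite divfK// gt_eqF.
Qed.

Let sfun_bounded : bounded_op sfun.
Proof.
split=> //; exists 1 => x; rewrite mul1r !hnormE lecR.
apply/ler_addgt0Pr => e e0; have [d hd h] := sfunP x e0.
have := h _ hd (wle_refl _) => hh.
rewrite -[sfun x](subrK (d x)) (le_trans (hnormD _ _))// addrC lerD//.
by have [_] := unit_interval_obnd (D01 hd) => /(_ x); rewrite mul1r.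
Qed.

Let chain_common (F : seq H) (e : R) : 0 < e ->
  exists2 d, D d & forall x, x \in F -> hnorm (sfun x - d x) <= e.
Proof.
move=> e0; suff [d hd h] : exists2 d, D d &
    forall d', D d' -> wle d d' -> forall x, x \in F -> hnorm (sfun x - d' x) <= e.
  by exists d => // x xF; apply: h.
elim: F => [|y F [d hd h]]; first by exists d0.
have [d' hd' h'] := sfunP y e0.
have [b hb [db db']] := chain_join hd hd'; exists b => // c hc bc x.
rewrite inE => /orP[/eqP->|xF]; first by apply: h' => //; apply: wle_trans bc.
by apply: h => //; apply: wle_trans bc.
Qed.

Let sfun_alg : tw_alg M sfun.
Proof.
have [_ wc] := tw_vN M; apply: wc => // F e e0.
pose k := \sum_(p <- F) hnorm p.2 + 1.
have k0 : 0 < k by rewrite ltr_wpDl// sumr_ge0// => p _; rewrite hnorm_ge0.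
(* A quarter, since [inner_le] doubles it and the final inequality has to be strict. *)
have ek : 0 < e / 4 / k by rewrite !divr_gt0.
have [d hd h] := chain_common [seq p.1 | p <- F] ek.
exists (d : H -> H); first exact: wfunP.
move=> p pF; apply: (le_lt_trans (inner_le _ _)); rewrite ltcR.
have /h h1 : p.1 \in [seq p.1 | p <- F] by apply: map_f.
have h2 : hnorm p.2 <= k.
  rewrite /k (big_rem p)//= -addrA lerDl addr_ge0// sumr_ge0// => q _.
  exact: hnorm_ge0.
have : hnorm ((sfun - d) p.1) * hnorm p.2 <= e / 4 / k * k.
  by rewrite ler_pM ?hnorm_ge0.
rewrite divfK ?gt_eqF//; lra.
Qed.

(** Vigier's theorem for chains: the strong limit lies in the algebra by weak closedness and is the
    order supremum, so normality applies to it and gives convergence in trace. *)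
Lemma chain_sup_ex : exists s, chain_sup D s /\ unit_interval s.
Proof.
pose s : A := WAlg sfun_alg.
have ss : star s = s by apply: star_eq.
have ub d : D d -> wle d s.
  move=> hd x; apply/ler_addgt0Pr => e e0; pose k := hnorm x + 1.
  have k0 : 0 < k by rewrite ltr_wpDl ?hnorm_ge0.
  have [d' hd' h] := sfunP x (divr_gt0 e0 k0).
  have [b hb [db db']] := chain_join hd hd'; apply: (le_trans (db x)).
  rewrite -lerBlDl -ripBl (le_trans (ler_norm _))// (le_trans (rip_CS _ _))//.
  apply: (le_trans (y := e / k * k)); last by rewrite divfK// gt_eqF.
  by rewrite ler_pM ?hnorm_ge0 ?lerDl// hnormBC h.
have lub b : (forall d, D d -> wle d b) -> wle s b.
  move=> hb x; apply/ler_addgt0Pr => e e0; pose k := hnorm x + 1.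
  have k0 : 0 < k by rewrite ltr_wpDl ?hnorm_ge0.
  have [d hd h] := sfunP x (divr_gt0 e0 k0).
  rewrite -lerBlDl; apply: le_trans (lerB (lexx _) (hb _ hd x)) _.
  rewrite -ripBl (le_trans (ler_norm _))// (le_trans (rip_CS _ _))//.
  apply: (le_trans (y := e / k * k)); last by rewrite divfK// gt_eqF.
  by rewrite ler_pM ?hnorm_ge0 ?lerDl// h.
have s0 : wle 0 s by have [_ p _] := D01 Dd0; exact: wle_trans p (ub _ Dd0).
have s1 : wle s 1 by apply: lub => d /D01[].
exists s; split; last by split.
split=> // e e0.
have hrt : rt s = sup [set complex.Re (tw_tr M T) | T in [set (d : H -> H) | d in D]].
  apply: (state_normal (tw_state M)).
  - by exists (d0 : H -> H), d0.
  - move=> _ [d hd <-]; split; first exact: wfunP.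
    by have [sd _ _] := D01 hd; apply/selfadjointP.
  - move=> _ _ [d hd <-] [d' hd' <-]; have [b hb [db db']] := chain_join hd hd'.
    have [[? _ _] [? _ _] [? _ _]] := And3 (D01 hd) (D01 hd') (D01 hb).
    by exists (b : H -> H); [exists b|split; apply/op_leP].
  - split; [exact: wfunP|exact/selfadjointP| |].
      by move=> _ [d hd <-]; have [? _ _] := D01 hd; apply/op_leP => //; apply: ub.
    move=> T MT /(selfadjointP (WAlg MT)) sT h.
    apply/(@op_leP _ _ s (WAlg MT)) => //; apply: lub => d hd.
    have [sd _ _] := D01 hd; apply/op_leP => //; apply: h; by exists d.
have hE : has_sup [set complex.Re (tw_tr M T) | T in [set (d : H -> H) | d in D]].
  split; first by exists (rt d0), (d0 : H -> H) => //; exists d0.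
  exists (rt s) => _ [_ [d hd <-] <-]; apply: rt_mono => //; last exact: ub.
  by have [] := D01 hd.
have [_ [_ [d hd <-] <-]] := sup_adherent e0 hE; rewrite -hrt => h.
exists d => // d' hd' dd'.
have : rt d <= rt d' by apply: rt_mono => //; [have [] := D01 hd|have [] := D01 hd'].
rewrite /rt /tau in h *; lra.
Qed.

End Chain.

(** Zorn's lemma for properties stable under suprema of chains; [d0] bounds the empty chain. *)
Lemma maximal_ex (P : set A) (d0 : A) : P d0 -> P `<=` unit_interval ->
  (forall D s, D `<=` P -> wchain D ->
     chain_sup D s -> unit_interval s -> P s) ->
  exists2 m, P m & forall b, P b -> wle m b -> b = m.
Proof.
move=> P0 P01 Psup; pose T := {d : A | P d}.
pose le (x y : T) := `[< wle (sval x) (sval y) >].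
have [| | | |[m Pm] hm] := @Zorn T le.
- by move=> x; apply/asboolP.
- by move=> x y z /asboolP h /asboolP g; apply/asboolP; apply: wle_trans h g.
- move=> [x px] [y py] /asboolP h /asboolP g; apply/eq_exist.
  by have [? _ _] := P01 _ px; have [? _ _] := P01 _ py; apply: wle_anti.
- move=> C totC; have [[x Cx]|C0] := pselect (exists x, C x); last first.
    by exists (exist _ d0 P0) => s Cs; case: C0; exists s.
  pose D := [set sval x | x in C].
  have DP : D `<=` P by move=> _ [[y py] _ <-].
  have Dx : D (sval x) by exists x.
  have totD : wchain D.
    by move=> _ _ [y Cy <-] [z Cz <-]; have [/asboolP h|/asboolP h] := totC _ _ Cy Cz; [left|right].
  have [s [hs s1]] := chain_sup_ex Dx (subset_trans DP P01) totD.
  exists (exist _ s (Psup _ _ DP totD hs s1)) => y Cy; apply/asboolP.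
  by apply: (chain_sup_ub hs); exists y.
exists m => // b Pb mb.
have /asboolP h : `[< wle m b >] by apply/asboolP.
by have := hm (exist _ b Pb) (asboolT h) => -[].
Qed.

End ChainSup.

(** * Strong operator continuity of the 2-norm on the unit ball *)

Section StrongContinuity.
Context {R : realType} {M : tracial_wspace R}.
Notation A := (walg M).
Notation H := (tw_hilbert M).
Implicit Types a b d h p x y z : A.

Lemma unit_interval0 : unit_interval (0 : A).
Proof.
split; [exact: raddf0|exact: wle_refl|].
by move=> u; rewrite wzeroE rip0l woneE ripxx sqr_ge0.
Qed.

Lemma unit_interval1 : unit_interval (1 : A).
Proof.
split; [exact: star1|by have [] := unit_interval0|exact: wle_refl].
Qed.

Lemma unit_intervalD p m h : unit_interval p -> unit_interval m ->
  unit_interval h -> wle h (p - m) -> unit_interval (m + h) /\ wle (m + h) p.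
Proof.
move=> [sp p0 p1] [sm m0 m1] [sh h0 h1] hpm.
have le : wle (m + h) p.
  move=> u; have := hpm u; rewrite wsubE waddE ripBl ripDl; lra.
split=> //; split; first by rewrite raddfD /= sm sh.
  by rewrite -[0]addr0; apply: wleD.
exact: wle_trans p1.
Qed.

(* A maximal [m <= p] with [tau m >= <m xi, xi>] leaves room for [h := p - m],
   below which [tau <= <_ xi, xi>]. *)
Lemma trace_le_vector_state p : unit_interval p -> p <> 0 ->
  exists h (xi : H), [/\ unit_interval h, h <> 0, wle h p &
    forall x, n2 (x * h) <= hnorm (x (h xi))].
Proof.
move=> p01 p0; have [sp p_ge0 p_le1] := p01.
have [xi hxi] : exists xi, rt p < rip (p xi) xi.
  have [[u hu]|np] := pselect (exists u, 0 < rip (p u) u); last first.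
    case: p0; apply: wle_anti => //; first exact: raddf0.
    by move=> u; rewrite wzeroE rip0l leNgt; apply/negP => hu; apply: np; exists u.
  (* Scaled so that <p xi, xi> = tau p + 1, which excludes [m = p] later on. *)
  exists ((Num.sqrt ((rt p + 1) / rip (p u) u))%:C *: u).
  rewrite walg_funZ ripZl ripZr mulrA -expr2 sqr_sqrtr ?divfK ?gt_eqF ?ltrDl//.
  by rewrite divr_ge0 ?addr_ge0 ?rt_ge0// ltW.
pose P := [set y | [/\ unit_interval y, wle y p & rip (y xi) xi <= rt y]].
have [| | |m [m01 mp hm] mmax] := @maximal_ex _ _ P 0.
- by split; [exact: unit_interval0|exact: p_ge0|rewrite wzeroE rip0l rt0].
- by move=> y [].
- move=> D s DP _ hs s01; split=> //.
    by apply: (chain_sup_lub hs) => d /DP[].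
  apply/ler_addgt0Pr => e e0; pose k := hnorm xi + 1.
  have k0 : 0 < k by rewrite ltr_wpDl ?hnorm_ge0.
  have [d hd /(_ _ hd (wle_refl _)) h] := chain_sup_sot hs xi (divr_gt0 e0 k0).
  have [[sd _ _] _ hd'] := DP _ hd; have [ss _ _] := s01.
  have h1 : rt d <= rt s by apply: rt_mono => //; apply: chain_sup_ub hd.
  have : rip (s xi - d xi) xi <= e / k * k.
    rewrite (le_trans (ler_norm _))// (le_trans (rip_CS _ _))//.
    by rewrite ler_pM ?hnorm_ge0 ?lerDl.
  rewrite divfK ?gt_eqF// ripBl; lra.
pose h := p - m.
have h01 : unit_interval h by apply: unit_interval_sub.
have below z : unit_interval z -> wle z h -> rt z <= rip (z xi) xi.
  move=> z01 zh; rewrite leNgt; apply/negP => lt.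
  have [mz01 mzp] := unit_intervalD p01 m01 z01 zh.
  have [_ z0 _] := z01.
  have e : m + z = m.
    apply: mmax; first by split=> //; rewrite waddE ripDl rtD lerD// ltW.
    by rewrite -[X in wle X]addr0; apply: wleD.
  have z00 : z = 0 by apply: (addrI m); rewrite addr0.
  by move: lt; rewrite z00 rt0 wzeroE rip0l ltxx.
exists h, xi; split=> //.
- move=> h0; move: hm; have -> : m = p by apply/esym/eqP; rewrite -subr_eq0 -/h h0.
  by rewrite leNgt hxi.
- by have [_ m0 _] := m01; move=> u; have := m0 u; rewrite wzeroE rip0l wsubE ripBl; lra.
move=> x; have [K [K0 hK]] := obnd_ex x; have [sh h0 h1] := h01.
pose L := K + 1; have L0 : 0 < L by rewrite ltr_wpDl.
(* [star c * c] lies below [h], because |c u|^2 <= |h u|^2 <= <h u, u>. For this element [below]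
   compares the 2-norm of [x * h] with the norm of [x (h xi)], up to the common factor [L^-1]. *)
pose c := (L^-1)%:C *: (x * h).
have cn u : hnorm (c u) <= hnorm (h u).
  rewrite wscaleE hnormZ gtr0_norm ?invr_gt0// ler_pdivrMl// (le_trans (hK _))//.
  by rewrite ler_wpM2r ?hnorm_ge0// lerDl.
have h2 u : hnorm (h u) ^+ 2 <= rip (h u) u.
  by rewrite -[leRHS]mul1r; apply: hnorm_pos; rewrite ?scale1r.
have cc u : rip ((star c * c) u) u = hnorm (c u) ^+ 2.
  by rewrite wmulE ripC -rip_star ripxx.
have zh : wle (star c * c) h.
  by move=> u; rewrite cc (le_trans _ (h2 u))// ler_sqr ?nnegrE ?hnorm_ge0.
have z01 : unit_interval (star c * c).
  split; [by rewrite starM starK|exact: wle_star_mul|exact: wle_trans zh h1].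
have := below _ z01 zh; rewrite cc -n2sq ler_sqr ?nnegrE ?hnorm_ge0 ?n2_ge0//.
by rewrite n2Z wscaleE hnormZ ler_pM2l// normr_gt0 invr_eq0 gt_eqF.
Qed.

(** An element [h] is controlled when smallness of [x] on finitely many vectors makes the 2-norm of
    [x * h] small, for [x] in the unit ball. This is stable under suprema of chains, and a maximal
    controlled [m] must be 1: otherwise [trace_le_vector_state] finds below [1 - m] a nonzero [h]
    for which the single vector [h xi] suffices, and [m + h] is controlled again. *)
Lemma n2_strong_continuity (e : R) : 0 < e -> exists (F : seq H) (dl : R), 0 < dl /\
  forall x, obnd 1 x -> (forall u, u \in F -> hnorm (x u) <= dl) -> n2 x <= e.
Proof.
pose controlled h := forall e : R, 0 < e -> exists (F : seq H) (dl : R), 0 < dl /\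
  forall x, obnd 1 x -> (forall u, u \in F -> hnorm (x u) <= dl) -> n2 (x * h) <= e.
suff h1 : controlled 1.
  by move=> /h1[F [dl [dl0 h]]]; exists F, dl; split=> // x x1 hx; rewrite -[x]mulr1 h.
pose P := [set h | unit_interval h /\ controlled h].
have [| | |m [m01 hm] mmax] := @maximal_ex _ _ P 0.
- split; first exact: unit_interval0.
  by move=> f f0; exists [::], 1; split=> // x _ _; rewrite mulr0 n2_0 ltW.
- by move=> y [].
- move=> D s DP _ hs s01; split=> // f f0.
  have f2 : 0 < f / 2 by rewrite divr_gt0.
  have [d hd /(_ _ hd (wle_refl _)) h] := chain_sup_rt hs (exprn_gt0 2 f2).
  have [d01 cd] := DP _ hd; have [F [dl [dl0 hF]]] := cd _ f2.
  exists F, dl; split=> // x x1 hx.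
  have -> : x * s = x * (s - d) + x * d by rewrite -mulrDr subrK.
  rewrite (le_trans (n2D _ _))// [f]splitr lerD//; last exact: hF.
  rewrite (le_trans (n2Ml _ x1))// mul1r -ler_sqr ?nnegrE ?n2_ge0 ?(ltW f2)//.
  apply: le_trans h; rewrite -rtB; apply: unit_interval_n2.
  by apply: unit_interval_sub => //; apply: chain_sup_ub hd.
have [<-//|m1] := pselect (m = 1).
have [| |h [xi [h01 h0 hm1 ctl]]] := @trace_le_vector_state (1 - m).
- by apply: unit_interval_sub => //; [exact: unit_interval1|case: m01].
- by move=> /eqP; rewrite subr_eq0 => /eqP e1; apply: m1.
have [mh01 _] := unit_intervalD unit_interval1 m01 h01 hm1.
case: h0; apply: (addrI m); rewrite addr0; apply: mmax; last first.
  by rewrite -[X in wle X]addr0; apply: wleD => //; case: h01.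
split=> // f f0; have f2 : 0 < f / 2 by rewrite divr_gt0.
have [F [dl [dl0 hF]]] := hm _ f2.
exists (h xi :: F), (Num.min dl (f / 2)); split; first by rewrite lt_min dl0.
move=> x x1 hx; rewrite mulrDr (le_trans (n2D _ _))// [f]splitr lerD//.
  apply: hF => // u uF; apply: (le_trans (hx u _)); last by rewrite ge_min lexx.
  by rewrite inE uF orbT.
apply: (le_trans (ctl x)); apply: (le_trans (hx _ (mem_head _ _))).
by rewrite ge_min lexx orbT.
Qed.

End StrongContinuity.

(** * Operator-norm limits, Neumann series and resolvents *)

Lemma geometric_small (R : realType) (C k e : R) :
  0 <= k -> k < 1 -> 0 < e -> exists n, C * k ^+ n <= e.
Proof.
move=> k0 k1 e0.
have /cvgrPdist_le/(_ e e0)[n _ h] : (C * k ^+ j : R^o) @[j --> \oo] --> (0 : R^o).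
  rewrite -[X in _ --> X](mulr0 C); apply: cvgMr; apply: cvg_expr.
  by rewrite ger0_norm.
exists n; have := h n (leqnn n); rewrite sub0r normrN; apply: le_trans.
exact: ler_norm.
Qed.

Section NormLimits.
Context {R : realType} {M : tracial_wspace R}.
Notation A := (walg M).
Notation H := (tw_hilbert M).
Implicit Types a b c r t : A.

Lemma obnd_small a : (forall e : R, 0 < e -> obnd e a) -> a = 0.
Proof.
move=> h; apply: walg_ext => x; apply: hnorm_small => e e0.
pose k := hnorm x + 1; have k0 : 0 < k by rewrite ltr_wpDl ?hnorm_ge0.
have [_ /(_ x) hx] := h _ (divr_gt0 e0 k0); apply: (le_trans hx).
apply: (le_trans (y := e / k * k)); last by rewrite divfK// gt_eqF.
by rewrite ler_pM2l ?divr_gt0// lerDl.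
Qed.

Lemma tw_alg_norm_limit (T : H -> H) : linear T ->
  (forall e : R, 0 < e -> exists a, forall x, hnorm (T x - a x) <= e * hnorm x) ->
  tw_alg M T.
Proof.
move=> lT h; have [_ wc] := tw_vN M; apply: wc.
  split=> //; have [a ha] := h 1 ltr01; have [K [K0 hK]] := obnd_ex a.
  exists (1 + K) => x; rewrite !hnormE -rmorphM lecR -[T x](subrK (a x)).
  by rewrite (le_trans (hnormD _ _))// mulrDl lerD.
move=> F e e0; pose k := \sum_(p <- F) hnorm p.1 * hnorm p.2 + 1.
have k0 : 0 < k.
  by rewrite ltr_wpDl// sumr_ge0// => p _; rewrite mulr_ge0 ?hnorm_ge0.
have [a ha] := h (e / 4 / k) ltac:(by rewrite !divr_gt0).
exists (a : H -> H); first exact: wfunP.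
move=> p pF; apply: (le_lt_trans (inner_le _ _)); rewrite ltcR.
have h2 : hnorm p.1 * hnorm p.2 <= k.
  rewrite /k (big_rem p)//= -addrA lerDl addr_ge0// sumr_ge0// => q _.
  by rewrite mulr_ge0 ?hnorm_ge0.
have : hnorm ((T - a) p.1) * hnorm p.2 <= e / 4 / k * k.
  apply: (le_trans (y := e / 4 / k * hnorm p.1 * hnorm p.2)).
    by rewrite ler_wpM2r ?hnorm_ge0//; apply: ha.
  by rewrite -mulrA ler_wpM2l// ltW// !divr_gt0.
rewrite divfK ?gt_eqF//; lra.
Qed.

Lemma norm_limit_ex (a : nat -> A) (C k : R) : 0 <= k -> k < 1 ->
  (forall n, obnd (C * k ^+ n) (a n.+1 - a n)) ->
  exists b, forall n, obnd (C * k ^+ n / (1 - k)) (b - a n).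
Proof.
move=> k0 k1 ha; have k1' : 0 < 1 - k by rewrite subr_gt0.
have C0 : 0 <= C by have [] := ha 0; rewrite expr0 mulr1.
have tail n m x : hnorm (a (n + m)%N x - a n x) <= C * k ^+ n / (1 - k) * hnorm x.
  (* The partial geometric sum, unlike its limit, is preserved by the induction on [m]. *)
  suff : hnorm (a (n + m)%N x - a n x) <= C * k ^+ n * (1 - k ^+ m) / (1 - k) * hnorm x.
    move=> h; apply: (le_trans h); rewrite ler_wpM2r ?hnorm_ge0//.
    rewrite ler_wpM2r ?invr_ge0 ?(ltW k1')// -[leRHS]mulr1 ler_wpM2l ?mulr_ge0 ?exprn_ge0//.
    by rewrite gerBl exprn_ge0.
  elim: m => [|m IH]; first by rewrite addn0 subrr hnorm0 expr0 subrr mulr0 !mul0r.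
  rewrite addnS (le_trans (hnorm_tri (a (n + m)%N x) _ _))//.
  have [_ /(_ x)] := ha (n + m)%N; rewrite wsubE => h.
  apply: (le_trans (lerD h IH)); rewrite -mulrDl ler_wpM2r ?hnorm_ge0//.
  rewrite le_eqVlt; apply/orP; left; apply/eqP; rewrite exprD exprS.
  by field; rewrite gt_eqF.
have lim x : exists y, forall n, hnorm (y - a n x) <= C * k ^+ n / (1 - k) * hnorm x.
  have small (e : R) : 0 < e -> exists N, C * k ^+ N / (1 - k) * hnorm x <= e.
    move=> e0; have [N hN] := @geometric_small R (C / (1 - k) * hnorm x) k e k0 k1 e0.
    by exists N; apply: le_trans hN; rewrite le_eqVlt; apply/orP; left; apply/eqP; ring.
  have [|y hy] := @hcauchy R H (fun n => a n x).
    move=> e /small[N hN]; exists N => p Np; apply: le_trans hN.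
    by rewrite -(subnKC Np) tail.
  exists y => n; apply/ler_addgt0Pr => e e0; have [N hN] := hy _ e0.
  have := hN (n + N)%N (leq_addl _ _); rewrite hnormBC => h.
  by rewrite (le_trans (hnorm_tri (a (n + N)%N x) _ _))// addrC lerD.
pose T x := projT1 (cid (lim x)).
have TP x n : hnorm (T x - a n x) <= C * k ^+ n / (1 - k) * hnorm x.
  by rewrite /T; case: cid.
have small (e D : R) : 0 < e -> exists n, C * k ^+ n / (1 - k) * D <= e.
  move=> e0; have [N hN] := @geometric_small R (C / (1 - k) * D) k e k0 k1 e0.
  by exists N; apply: le_trans hN; rewrite le_eqVlt; apply/orP; left; apply/eqP; ring.
have lT : linear T.
  move=> c x y; apply/eqP; rewrite -subr_eq0; apply/eqP; apply: hnorm_small => e e0.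
  pose D := hnorm (c *: x + y) + complex.Re `|c| * hnorm x + hnorm y.
  have [n hn] := small e D e0; apply: le_trans hn; rewrite /D !mulrDr -addrA.
  have -> : T (c *: x + y) - (c *: T x + T y) =
     T (c *: x + y) - a n (c *: x + y) - (c *: (T x - a n x) + (T y - a n y)).
    by rewrite walg_funD walg_funZ scalerBr addrACA -opprD opprB addrA subrK.
  rewrite (le_trans (hnormB _ _))// lerD// (le_trans (hnormD _ _))// lerD//.
  by rewrite mulrCA hnormZc ler_wpM2l// ge0_Re.
have MT : tw_alg M T.
  apply: tw_alg_norm_limit => // e e0; have [n hn] := small e 1 e0.
  by exists (a n) => x; apply: (le_trans (TP x n)); rewrite ler_wpM2r ?hnorm_ge0// -[leLHS]mulr1.
exists (WAlg MT) => n; split; last by move=> x; apply: TP.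
by rewrite !mulr_ge0 ?exprn_ge0 ?invr_ge0 ?(ltW k1').
Qed.

Record wsubalg (B : set A) : Prop := {
  wsub1 : B 1;
  wsubL : forall (z : R[i]) a b, B a -> B b -> B (z *: a + b);
  wsubM : forall a b, B a -> B b -> B (a * b);
  wsub_star : forall a, B a -> B (star a) }.

Section Subalgebra.
Variable B : set A.
Hypothesis hB : wsubalg B.

Lemma wsub0 : B 0.
Proof. by have := wsubL hB (-1) (wsub1 hB) (wsub1 hB); rewrite scaleN1r addNr. Qed.
Lemma wsubD a b : B a -> B b -> B (a + b).
Proof. by move=> /(wsubL hB 1) h /h; rewrite scale1r. Qed.
Lemma wsubZ (z : R[i]) a : B a -> B (z *: a).
Proof. by move=> /(wsubL hB z) /(_ wsub0); rewrite addr0. Qed.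
Lemma wsubN a : B a -> B (- a).
Proof. by move=> /(wsubZ (-1)); rewrite scaleN1r. Qed.
Lemma wsubB a b : B a -> B b -> B (a - b).
Proof. by move=> ? /wsubN; apply: wsubD. Qed.
Lemma wsubX a n : B a -> B (a ^+ n).
Proof.
move=> Ba; elim: n => [|n IH]; first by rewrite expr0; apply: wsub1.
by rewrite exprS; apply: wsubM.
Qed.
Lemma wsub_sum n (F : nat -> A) : (forall i, B (F i)) -> B (\sum_(i < n) F i).
Proof. by move=> h; elim/big_ind: _ => //; [exact: wsub0|exact: wsubD]. Qed.

Definition nclosure : set A :=
  [set a | forall e : R, 0 < e -> exists2 b, B b & obnd e (a - b)].

Lemma nclosureZ (z : R[i]) a : nclosure a -> nclosure (z *: a).
Proof.
move=> ha e e0; pose k := complex.Re `|z| + 1.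
have k0 : 0 < k by rewrite ltr_wpDl// ge0_Re.
have [b Bb h] := ha _ (divr_gt0 e0 k0); exists (z *: b); first exact: wsubZ.
split; [exact: ltW|move=> x]; rewrite -scalerBr wscaleE.
rewrite hnormZc; have [_ /(_ x) hx] := h.
apply: (le_trans (y := k * (e / k * hnorm x))).
  by rewrite ler_pM ?hnorm_ge0 ?ge0_Re ?lerDl.
by rewrite mulrA mulrCA mulfV ?mulr1// gt_eqF.
Qed.

Lemma neumann c (k : R) : B c -> k < 1 -> obnd k c ->
  exists r, [/\ r * (1 - c) = 1, (1 - c) * r = 1 & nclosure r].
Proof.
move=> Bc k1 hc; have [k0 _] := hc; have k1' : 0 < 1 - k by rewrite subr_gt0.
have cX n : obnd (k ^+ n) (c ^+ n).
  elim: n => [|n IH]; first by rewrite !expr0; apply: obnd1.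
  by rewrite !exprS; apply: obndM.
pose a n := \sum_(i < n) c ^+ i.
have aS n : a n.+1 - a n = c ^+ n by rewrite /a big_ord_recr /= addrAC subrr add0r.
have [r hr] := @norm_limit_ex a 1 k k0 k1 (fun n => ltac:(by rewrite aS mul1r)).
have aL n : a n * (1 - c) = 1 - c ^+ n.
  elim: n => [|n IH]; first by rewrite /a big_ord0 mul0r expr0 subrr.
  by rewrite -(subrK (a n) (a n.+1)) aS mulrDl IH mulrBr mulr1 -exprSr addrC addrA subrK.
have aR n : (1 - c) * a n = 1 - c ^+ n.
  elim: n => [|n IH]; first by rewrite /a big_ord0 mulr0 expr0 subrr.
  by rewrite -(subrK (a n) (a n.+1)) aS mulrDr IH mulrBl mul1r -exprS addrC addrA subrK.
have [K hK] := obnd_ex (1 - c); have [K0 _] := hK.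
have small (e : R) : 0 < e -> exists n, 1 * k ^+ n / (1 - k) * K + k ^+ n <= e.
  move=> e0; have [N hN] := @geometric_small R (K / (1 - k) + 1) k e k0 k1 e0.
  by exists N; apply: le_trans hN; rewrite le_eqVlt; apply/orP; left; apply/eqP; ring.
exists r; split.
- apply/eqP; rewrite -subr_eq0; apply/eqP; apply: obnd_small => e /small[n hn].
  have -> : r * (1 - c) - 1 = (r - a n) * (1 - c) - c ^+ n.
    by rewrite mulrBl aL opprB addrA addrAC addrK.
  by apply: obnd_le hn; apply: obndB => //; apply: obndM.
- apply/eqP; rewrite -subr_eq0; apply/eqP; apply: obnd_small => e /small[n hn].
  have -> : (1 - c) * r - 1 = (1 - c) * (r - a n) - c ^+ n.
    by rewrite mulrBr aR opprB addrA addrAC addrK.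
  by apply: obnd_le hn; apply: obndB => //; rewrite mulrC; apply: obndM.
- move=> e e0; have [n hn] := @geometric_small R (1 / (1 - k)) k e k0 k1 e0.
  exists (a n); first by apply: wsub_sum => i; apply: wsubX.
  apply: obnd_le (hr n) _; apply: le_trans hn.
  by rewrite le_eqVlt; apply/orP; left; apply/eqP; ring.
Qed.

Lemma hnorm_skewD b x : star b = b ->
  hnorm (x + 'i *: b x) ^+ 2 = hnorm x ^+ 2 + hnorm (b x) ^+ 2.
Proof.
move=> sb; rewrite -!ripxx !(ripDl, ripDr) ripi (ripC x ('i *: b x)) rip_ii//.
by rewrite !(add0r, addr0).
Qed.

(** [1 + 'i *: b] may be far from 1, but scaled by th = 1 / (1 + K^2) it is within sqrt (1 - th) of
    1: [x] and ['i *: b x] are orthogonal for [rip], so the squared distance is at most (1 - th)^2 +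
    th^2 K^2 = 1 - th. The Neumann series then inverts it by norm limits of elements of [B], and the
    same orthogonality, in [hnorm_skewD], bounds the inverse by 1. *)
Lemma resolvent b : B b -> star b = b ->
  exists r, [/\ r * (1 + 'i *: b) = 1, (1 + 'i *: b) * r = 1, obnd 1 r & nclosure r].
Proof.
move=> Bb sb; have [K [K0 hK]] := obnd_ex b.
pose th := (1 + K ^+ 2)^-1; have D0 : 0 < 1 + K ^+ 2 by rewrite ltr_pwDl// sqr_ge0.
have th0 : 0 < th by rewrite invr_gt0.
have th1 : th <= 1 by rewrite invf_le1// lerDl sqr_ge0.
pose c := 1 - th%:C *: (1 + 'i *: b).
have Bc : B c.
  by apply: wsubB; [exact: wsub1|apply: wsubZ; apply: wsubD; [exact: wsub1|exact: wsubZ]].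
have hc : obnd (Num.sqrt (1 - th)) c.
  split; first exact: sqrtr_ge0.
  move=> x; rewrite -ler_sqr ?nnegrE ?mulr_ge0 ?sqrtr_ge0 ?hnorm_ge0//.
  rewrite exprMn sqr_sqrtr ?subr_ge0//.
  have -> : c x = (1 - th)%:C *: x + (- th)%:C *: ('i *: b x).
    by rewrite /c !wE scalerDr opprD addrA rmorphB scalerBl scale1r rmorphN scaleNr.
  have := hK x; set p := hnorm x; set q := hnorm (b x) => h1.
  rewrite -[leLHS]ripxx !(ripDl, ripDr) !(ripZl, ripZr) ripi.
  rewrite (ripC x ('i *: b x)) rip_ii// !ripxx -/p -/q.
  have e1 : th * (1 + K ^+ 2) = 1 by rewrite mulVf// gt_eqF.
  have : q ^+ 2 <= K ^+ 2 * p ^+ 2.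
    by rewrite -exprMn ler_sqr ?nnegrE ?mulr_ge0 ?hnorm_ge0.
  move=> hq; have : th ^+ 2 * q ^+ 2 <= th ^+ 2 * (K ^+ 2 * p ^+ 2).
    by rewrite ler_wpM2l// sqr_ge0.
  have -> : th ^+ 2 * (K ^+ 2 * p ^+ 2) = th * (1 - th) * p ^+ 2.
    by rewrite -[in RHS]e1; ring.
  by lra.
have k1 : Num.sqrt (1 - th) < 1 by rewrite -[ltRHS]sqrtr1 ltr_sqrt ?ltr01// gtrBl.
have [r [r1 r2 r3]] := neumann Bc k1 hc.
have e : 1 - c = th%:C *: (1 + 'i *: b) by rewrite /c opprB addrC subrK.
exists (th%:C *: r); split; rewrite -?scalerAl -?scalerAr.
- by rewrite scalerAr -e.
- by rewrite scalerAl -e.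
- split=> // x; rewrite mul1r.
  have ex : x = (1 + 'i *: b) ((th%:C *: r) x).
    by rewrite -wmulE -scalerAr scalerAl -e r2.
  rewrite {2}ex -ler_sqr ?nnegrE ?hnorm_ge0// waddE woneE wscaleE hnorm_skewD//.
  by rewrite lerDl sqr_ge0.
- exact: nclosureZ.
Qed.

End Subalgebra.

(** The resolvent identity. With contractive outer factors it carries closeness of [b] and [b'], in
    2-norm or on vectors, over to the resolvents. *)
Lemma resolvent_diff b b' r r' : r * (1 + 'i *: b) = 1 -> (1 + 'i *: b') * r' = 1 ->
  r - r' = 'i *: (r * (b' - b) * r').
Proof.
move=> h h'.
have -> : r - r' = r * ((1 + 'i *: b') - (1 + 'i *: b)) * r'.
  by rewrite mulrBr mulrBl -mulrA h' mulr1 h mul1r.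
by rewrite opprD addrACA subrr add0r -scalerBr -scalerAr -scalerAl.
Qed.

Lemma wsubalgT : wsubalg [set: A].
Proof. by []. Qed.

End NormLimits.

(** * 2-norm closures and Kaplansky density *)

Section L2Closure.
Context {R : realType} {M : tracial_wspace R}.
Notation A := (walg M).
Notation H := (tw_hilbert M).
Implicit Types a b c r t : A.

(** The closure is taken inside the algebra and not in L^2, so that products remain available. *)
Definition l2c (B : set A) : set A :=
  [set a | forall e : R, 0 < e -> exists2 b, B b & n2 (a - b) <= e].

Lemma sub_l2c B : B `<=` l2c B.
Proof. by move=> a Ba e e0; exists a => //; rewrite subrr n2_0 ltW. Qed.

Lemma l2cK B : l2c (l2c B) `<=` l2c B.
Proof.
move=> a h e e0; have e2 : 0 < e / 2 by rewrite divr_gt0.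
have [b /(_ _ e2)[c Bc bc] ab] := h _ e2.
by exists c => //; rewrite (le_trans (n2_tri b _ _))// [e]splitr lerD.
Qed.

Lemma div_succ_mul_le (e p : R) : 0 <= e -> 0 <= p -> p * (e / (p + 1)) <= e.
Proof.
move=> e0 p0; rewrite mulrA ler_pdivrMr ?ltr_wpDl// mulrC ler_wpM2l//.
by rewrite lerDl.
Qed.

Lemma l2c_wsubalg B : wsubalg B -> wsubalg (l2c B).
Proof.
move=> hB; split.
- by apply: sub_l2c; apply: wsub1.
- move=> z a a' ha ha' e e0; have e2 : 0 < e / 2 by rewrite divr_gt0.
  have z0 : 0 <= complex.Re `|z| by rewrite ge0_Re.
  have [b Bb hb] := ha (e / 2 / (complex.Re `|z| + 1)) ltac:(by rewrite divr_gt0// ltr_wpDl).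
  have [b' Bb' hb'] := ha' _ e2; exists (z *: b + b'); first exact: wsubL.
  rewrite opprD addrACA -scalerBr (le_trans (n2D _ _))// [e]splitr lerD//.
  rewrite n2Zc; apply: (le_trans (ler_wpM2l z0 hb)); apply: div_succ_mul_le => //.
  exact: ltW.
- move=> a a' ha ha' e e0; have e2 : 0 < e / 2 by rewrite divr_gt0.
  have [K hK] := obnd_ex a; have [K0 _] := hK.
  (* The order of the choices matters: approximants have no uniform operator bound, so [b] is chosen
     only once a bound [L] of [b'] is known. *)
  have [b' Bb' hb'] := ha' (e / 2 / (K + 1)) ltac:(by rewrite divr_gt0// ltr_wpDl).
  have [L hL] := obnd_ex b'; have [L0 _] := hL.
  have [b Bb hb] := ha (e / 2 / (L + 1)) ltac:(by rewrite divr_gt0// ltr_wpDl).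
  exists (b * b'); first exact: wsubM.
  have -> : a * a' - b * b' = a * (a' - b') + (a - b) * b'.
    by rewrite mulrBr mulrBl addrA subrK.
  rewrite (le_trans (n2D _ _))// [e]splitr lerD//.
    rewrite (le_trans (n2Ml _ hK))// (le_trans (ler_wpM2l K0 hb'))//.
    by apply: div_succ_mul_le => //; apply: ltW.
  rewrite (le_trans (n2Mr _ hL))// (le_trans (ler_wpM2l L0 hb))//.
  by apply: div_succ_mul_le => //; apply: ltW.
- move=> a ha e e0; have [b Bb hb] := ha _ e0; exists (star b); first exact: wsub_star.
  by rewrite -raddfB n2_star.
Qed.

Lemma nclosure_l2c B : nclosure (l2c B) `<=` l2c B.
Proof.
move=> a h; apply: l2cK => e e0; have [b Bb hb] := h _ e0; exists b => //.
exact: n2_obnd.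
Qed.

(* The distance from [(T x)_x] to [{(b x)_x : b in V}] is attained by a limit
   [y], and the weak approximability of [T] makes [(T x - y x)_x] orthogonal to
   itself. *)
Lemma weak_to_strong (V : set A) (T : A) : V 0 ->
  (forall (r : R) a b, V a -> V b -> V (r%:C *: a + b)) ->
  (forall (F : seq (H * H)) (e : R), 0 < e -> exists2 b, V b &
     forall p, p \in F -> `|rip ((T - b) p.1) p.2| <= e) ->
  forall (F : seq H) (e : R), 0 < e -> exists2 b, V b &
     forall x, x \in F -> hnorm ((T - b) x) <= e.
Proof.
move=> V0 VL weak F.
have VN a : V a -> V (- a) by move=> /(VL (-1) a 0) /(_ V0); rewrite addr0 rmorphN scaleN1r.
have VB a b : V a -> V b -> V (a - b).
  by move=> Va /VN /(VL 1 _ _ Va); rewrite scale1r.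
(* The inner product of the families [(a x)] and [(b x)] in a direct sum of copies of [H] indexed by
   [F]. *)
pose bil a b := \sum_(x <- F) rip (a x) (b x).
have bilDl a b c : bil (a + b) c = bil a c + bil b c.
  by rewrite -big_split /=; apply: eq_bigr => x _; rewrite waddE ripDl.
have bilBl a b c : bil (a - b) c = bil a c - bil b c.
  by rewrite -sumrB /=; apply: eq_bigr => x _; rewrite wsubE ripBl.
have bilC a b : bil a b = bil b a by apply: eq_bigr => x _; rewrite ripC.
have bilZ (s : R) a b : bil (s%:C *: a) b = s * bil a b.
  by rewrite mulr_sumr; apply: eq_bigr => x _; rewrite wscaleE ripZl.
have bil0 a : 0 <= bil a a by apply: sumr_ge0 => x _; rewrite ripxx sqr_ge0.
pose E := [set bil (T - b) (T - b) | b in V].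
have hE : has_inf E.
  by split; [exists (bil (T - 0) (T - 0)), 0|exists 0 => _ [b _ <-]; apply: bil0].
have orth (e : R) b c : 0 <= e -> V b -> V c -> bil (T - b) (T - b) < inf E + e ^+ 2 ->
    `|bil (T - b) c| <= e * Num.sqrt (bil c c).
  move=> e0 Vb Vc hb; rewrite -ler_sqr ?nnegrE ?mulr_ge0 ?sqrtr_ge0//.
  rewrite real_normK ?num_real// exprMn sqr_sqrtr//; apply: quad_ge0_discr => // s.
  have : inf E <= bil (T - b + s%:C *: c) (T - b + s%:C *: c).
    apply: ge_inf; first exact: hE.2.
    exists (- s%:C *: c + b); first by rewrite -rmorphN; apply: VL.
    by rewrite scaleNr opprD opprK [s%:C *: c - b]addrC addrA.
  move: (T - b) hb => D hb.
  rewrite bilDl bilZ ![bil _ (_ + s%:C *: c)]bilC !bilDl !bilZ (bilC c).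
  lra.
have [b_ hb_] : {b_ : nat -> A & forall m, V (b_ m) /\
    bil (T - b_ m) (T - b_ m) < inf E + (m.+1%:R^-1) ^+ 2}.
  apply: (@choice nat A (fun m b => V b /\
    bil (T - b) (T - b) < inf E + (m.+1%:R^-1) ^+ 2)) => m.
  have p : 0 < (m.+1%:R^-1 : R) ^+ 2 by rewrite exprn_gt0// invr_gt0.
  by have [_ [b Vb <-] h] := inf_adherent p hE; exists b.
have i0 m : 0 <= (m.+1%:R^-1 : R) by rewrite invr_ge0.
have small (e : R) : 0 < e -> exists N : nat, forall m, (N <= m)%N -> m.+1%:R^-1 <= e.
  move=> e0; exists (Num.truncn e^-1) => m Nm.
  rewrite -[leRHS]invrK lef_pV2 ?posrE ?invr_gt0 ?ltr0n//.
  by rewrite ltW// (lt_le_trans (truncnS_gt _))// ler_nat ltnS.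
have orthb m c : V c -> `|bil (T - b_ m) c| <= m.+1%:R^-1 * Num.sqrt (bil c c).
  by move=> Vc; have [Vb h] := hb_ m; apply: orth.
have close m l : Num.sqrt (bil (b_ m - b_ l) (b_ m - b_ l)) <= l.+1%:R^-1 + m.+1%:R^-1.
  set c := b_ m - b_ l.
  have Vc : V c by apply: VB; [have [] := hb_ m|have [] := hb_ l].
  have [->|g0] := eqVneq (Num.sqrt (bil c c)) 0; first by rewrite addr_ge0.
  have g1 : 0 < Num.sqrt (bil c c) by rewrite lt_def g0 sqrtr_ge0.
  rewrite -(ler_pM2r g1) -expr2 sqr_sqrtr//.
  rewrite [leLHS](_ : _ = bil (T - b_ l) c - bil (T - b_ m) c); last first.
    by rewrite -bilBl; congr (bil _ _); rewrite opprB addrC addrA subrK.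
  rewrite (le_trans (ler_norm _))// (le_trans (ler_normB _ _))// mulrDl.
  by apply: lerD; apply: orthb.
have hclose m l x : x \in F -> hnorm (b_ m x - b_ l x) <= l.+1%:R^-1 + m.+1%:R^-1.
  move=> xF; apply: le_trans (close m l).
  rewrite -ler_sqr ?nnegrE ?hnorm_ge0 ?sqrtr_ge0// sqr_sqrtr//.
  by rewrite /bil (big_rem x)//= ?wsubE ripxx lerDl sumr_ge0// => y _; rewrite ripxx sqr_ge0.
have [y hy] : {y : H -> H & forall x, x \in F -> forall e : R, 0 < e ->
    exists N, forall m, (N <= m)%N -> hnorm (b_ m x - y x) <= e}.
  apply: (@choice H H (fun x z => x \in F -> forall e : R, 0 < e ->
    exists N, forall m, (N <= m)%N -> hnorm (b_ m x - z) <= e)) => x.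
  have [xF|xF] := boolP (x \in F); last by exists 0.
  have [|z hz] := @hcauchy R H (fun m => b_ m x); last by exists z.
  move=> e e0; have [N hN] := small _ (divr_gt0 e0 (ltr0n R 2)).
  exists N => p Np; rewrite (le_trans (hclose _ _ _ xF))// [e]splitr lerD// hN//.
have common (e : R) : 0 < e -> exists N, forall x, x \in F -> forall m, (N <= m)%N ->
    hnorm (b_ m x - y x) <= e.
  move=> e0; elim: (F) hy => [|z G IH] hyG; first by exists 0.
  have [|N hN] := IH; first by move=> x xG; apply: hyG; rewrite inE xG orbT.
  have [N' hN'] := hyG z (mem_head _ _) _ e0.
  exists (maxn N N') => x; rewrite inE => /orP[/eqP->|xG] m; rewrite geq_max => /andP[h h'].
    exact: hN'.
  exact: hN.
have approx (e : R) : 0 < e -> exists2 b, V b &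
    (forall c, V c -> `|bil (T - b) c| <= e * Num.sqrt (bil c c)) /\
    (forall x, x \in F -> hnorm (b x - y x) <= e).
  move=> e0; have [N hN] := small _ e0; have [N' hN'] := common _ e0.
  exists (b_ (maxn N N')); first by have [] := hb_ (maxn N N').
  split=> [c Vc|x xF]; last by apply: hN' => //; apply: leq_maxr.
  by rewrite (le_trans (orthb _ _ Vc))// ler_wpM2r ?sqrtr_ge0// hN// leq_maxl.
pose u x := T x - y x.
have sumle (f g : H -> H) (k : R) : (forall x, x \in F -> hnorm (f x) <= k) ->
    `|\sum_(x <- F) rip (f x) (g x)| <= k * \sum_(x <- F) hnorm (g x).
  move=> h; rewrite (le_trans (ler_norm_sum _ _ _))// mulr_sumr big_seq [leRHS]big_seq.
  apply: ler_sum => x xF; rewrite (le_trans (rip_CS _ _))// ler_wpM2r ?hnorm_ge0//.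
  exact: h.
have uV c : V c -> \sum_(x <- F) rip (u x) (c x) = 0.
  move=> Vc; apply/eqP; rewrite -normr_eq0 eq_le normr_ge0 andbT.
  apply/ler_addgt0Pr => e e0; rewrite add0r.
  pose k := Num.sqrt (bil c c) + \sum_(x <- F) hnorm (c x).
  have k0 : 0 <= k by rewrite addr_ge0 ?sqrtr_ge0// sumr_ge0// => x _; rewrite hnorm_ge0.
  have [b Vb [hb hby]] := approx (e / (k + 1)) ltac:(by rewrite divr_gt0// ltr_wpDl).
  have -> : \sum_(x <- F) rip (u x) (c x) =
      bil (T - b) c + \sum_(x <- F) rip (b x - y x) (c x).
    by rewrite -big_split /=; apply: eq_bigr => x _; rewrite -ripDl ?wsubE addrA subrK.
  rewrite (le_trans (ler_normD _ _))//.
  apply: le_trans (lerD (hb _ Vc) (sumle _ _ _ hby)) _; rewrite -mulrDr mulrC.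
  by apply: div_succ_mul_le => //; apply: ltW.
have uu : \sum_(x <- F) hnorm (u x) ^+ 2 = 0.
  apply/eqP; rewrite eq_le sumr_ge0 ?andbT => [|x _]; last exact: sqr_ge0.
  apply/ler_addgt0Pr => e e0; rewrite add0r.
  pose k := (size F)%:R + \sum_(x <- F) hnorm (u x).
  have k0 : 0 <= k by rewrite addr_ge0// sumr_ge0// => x _; rewrite hnorm_ge0.
  have ek0 : 0 < e / (k + 1) by rewrite divr_gt0// ltr_wpDl.
  have [b Vb [_ hby]] := approx _ ek0.
  have [c Vc hc] := weak [seq (x, u x) | x <- F] _ ek0.
  (* The pairings of [u] with [c] and with [b] vanish by [uV]. What is left is small: one sum by the
     weak approximation [c], the other because [b] is close to [y] on [F]. *)
  have -> : \sum_(x <- F) hnorm (u x) ^+ 2 = \sum_(x <- F) rip ((T - c) x) (u x)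
      + \sum_(x <- F) rip (u x) (c x)
      + (\sum_(x <- F) rip (b x - y x) (u x) - \sum_(x <- F) rip (u x) (b x)).
    rewrite -!sumrB -!big_split /=; apply: eq_bigr => x _.
    have e1 : rip (u x) (u x) = rip (T x) (u x) - rip (y x) (u x) by exact: ripBl.
    have e2 : rip ((T - c) x) (u x) = rip (T x) (u x) - rip (c x) (u x) by exact: ripBl.
    have e3 : rip (b x - y x) (u x) = rip (b x) (u x) - rip (y x) (u x) by exact: ripBl.
    by rewrite -ripxx e1 e2 e3 (ripC (u x) (c x)) (ripC (u x) (b x)); ring.
  rewrite !uV// addr0 subr0 (le_trans (ler_norm _))// (le_trans (ler_normD _ _))//.
  apply: (le_trans (y := k * (e / (k + 1)))); last by apply: div_succ_mul_le => //; apply: ltW.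
  rewrite mulrDl lerD//; last by rewrite mulrC; apply: sumle.
  rewrite (le_trans (ler_norm_sum _ _ _))// mulr_natl -[size F]/(size F) big_seq.
  apply: (le_trans (y := \sum_(x <- F) (e / (k + 1)))); last first.
    by rewrite big_const_seq count_predT iter_addr_0.
  rewrite [leRHS]big_seq; apply: ler_sum => x xF; apply: (hc (x, u x)).
  exact: map_f.
have u0 x : x \in F -> y x = T x.
  move=> xF; apply/esym/eqP; rewrite -subr_eq0 -/(u x); apply/eqP/hnorm_eq0/eqP.
  rewrite -sqrf_eq0; move/eqP: uu; rewrite psumr_eq0 => [/allP/(_ _ xF)//|z _].
  exact: sqr_ge0.
move=> e e0; have [b Vb [_ h]] := approx _ e0; exists b => // x xF.
by rewrite ?wsubE hnormBC -u0// h.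
Qed.

End L2Closure.

Section Density.
Context {R : realType} {M : tracial_wspace R}.
Notation A := (walg M).
Notation H := (tw_hilbert M).
Implicit Types a b c r t : A.
Variable B : set A.
Hypothesis hB : wsubalg B.

Let hL := l2c_wsubalg hB.

Let weakly_approx t := forall (F : seq (H * H)) (e : R), 0 < e -> exists2 b, l2c B b &
  forall p, p \in F -> `|rip ((t - b) p.1) p.2| <= e.

Let half : R[i] := (2^-1 : R)%:C.

Let half_add t : half *: (t + t) = t.
Proof.
have h : 2^-1 + 2^-1 = 1 :> R by lra.
by rewrite scalerDr -scalerDl /half -rmorphD /= h scale1r.
Qed.

Let sa_part t : star (half *: (t + star t)) = half *: (t + star t).
Proof. by rewrite starZr raddfD /= starK addrC. Qed.

Let weakly_approx_sa t : weakly_approx t ->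
  forall (F : seq (H * H)) (e : R), 0 < e -> exists2 b, l2c B b /\ star b = b &
    forall p, p \in F -> `|rip ((half *: (t + star t) - b) p.1) p.2| <= e.
Proof.
move=> h F e e0; have [b Lb hb] := h (F ++ [seq (p.2, p.1) | p <- F]) e e0.
exists (half *: (b + star b)).
  by split=> //; apply: (wsubZ hL) => //; apply: (wsubD hL) => //; apply: (wsub_star hL).
move=> p pF; rewrite -scalerBr opprD addrACA -(raddfB star) wscaleE waddE ripZl ripDl.
rewrite (rip_star (star _)) starK ripC.
have h1 : `|rip ((t - b) p.1) p.2| <= e by apply: hb; rewrite mem_cat pF.
have h2 : `|rip ((t - b) p.2) p.1| <= e.
  by apply: (hb (p.2, p.1)); rewrite mem_cat (map_f (fun p => (p.2, p.1))) ?orbT.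
rewrite normrM gtr0_norm ?invr_gt0// ler_pdivrMl// (le_trans (ler_normD _ _))//.
by rewrite mulr_natl mulr2n lerD// ripC.
Qed.

Let weakly_approx_i t : weakly_approx t -> weakly_approx ('i *: t).
Proof.
move=> h F e e0; have [b Lb hb] := h [seq (p.1, - ('i *: p.2)) | p <- F] e e0.
exists ('i *: b); first exact: (wsubZ hL).
move=> p pF; rewrite -scalerBr wscaleE.
have := hb (p.1, - ('i *: p.2)) (map_f (fun p => (p.1, - ('i *: p.2))) pF).
by rewrite /= -ripi scalerN scalerA -expr2 sqrCi scaleN1r opprK.
Qed.

(* Bounded functions of a self-adjoint strong limit are 2-norm limits; [T] is
   recovered from its resolvents [r = (1 + i s T)^-1] as the norm limit of
   [(1 - r) / (i s)]. *)
Let l2c_sa_limit t : star t = t ->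
  (forall (F : seq H) (e : R), 0 < e -> exists2 b, l2c B b /\ star b = b &
     forall x, x \in F -> hnorm ((t - b) x) <= e) ->
  l2c B t.
Proof.
move=> st strong; apply: nclosure_l2c => e e0.
have [K hK] := obnd_ex t; have [K0 _] := hK.
(* As [r] is a contraction, the error [t * ('i *: (s%:C *: (t * r)))] is bounded by
   [K * s * K <= e]. *)
pose s := e / (K * K + 1).
have s0 : 0 < s by rewrite divr_gt0// ltr_wpDl// mulr_ge0.
have sst (a : A) : star a = a -> star (s%:C *: a) = s%:C *: a by move=> sa; rewrite starZr sa.
have [r [r1 r2 r3 _]] := resolvent (@wsubalgT R M) (I : [set: A] (s%:C *: t)) (sst _ st).
have Lr : l2c B r.
  apply: l2cK => f f0; have f2 : 0 < f / 2 by rewrite divr_gt0.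
  have [F [dl [dl0 hF]]] := n2_strong_continuity (M := M) f2.
  have [b [Lb sb] hb] := strong [seq r u | u <- F] (2 * dl / s)
    ltac:(by apply: divr_gt0 => //; apply: mulr_gt0).
  have Lsb : l2c B (s%:C *: b) by apply: (wsubZ hL).
  have [q [q1 q2 q3 q4]] := resolvent hL Lsb (sst _ sb).
  exists q; first exact: nclosure_l2c.
  have e1 : q - r = 'i *: (q * (s%:C *: (t - b)) * r).
    by rewrite (resolvent_diff q1 r2) scalerBr.
  (* Halving puts [q - r] in the unit ball, where smallness on vectors controls the 2-norm. *)
  have -> : r - q = - (2%:C *: (half *: (q - r))).
    by rewrite /half scalerA -rmorphM /= divff// scale1r opprB.
  rewrite n2N n2Z ger0_norm// -ler_pdivlMl// mulrC; apply: hF.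
    apply: (obnd_le (obndZ _ (obndB q3 r3))).
    by rewrite ger0_norm ?invr_ge0// mulrC divff.
  move=> u uF; rewrite wscaleE hnormZ ger0_norm ?invr_ge0// ler_pdivrMl//.
  rewrite e1 wscaleE hnormi !wmulE; have [_ /(_ _)] := q3 => hq.
  rewrite (le_trans (hq _))// mul1r wscaleE hnormZ gtr0_norm//.
  rewrite -ler_pdivlMl// mulrC; apply: hb; exact: map_f.
exists (s^-1%:C *: (- 'i *: (1 - r))).
  by apply: (wsubZ hL) => //; apply: (wsubZ hL) => //; apply: (wsubB hL) => //; exact: (wsub1 hL).
have e1 : 1 - r = 'i *: (s%:C *: (t * r)).
  by rewrite -{1}r2 mulrDl mul1r addrC addKr -scalerAl -scalerAl.
have e2 : s^-1%:C *: (- 'i *: (1 - r)) = t * r.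
  rewrite e1 !scalerA -[_ * - 'i * 'i]mulrA mulNr -expr2 sqrCi opprK mulr1.
  by rewrite -rmorphM /= mulVf ?gt_eqF// scale1r.
have -> : t - s^-1%:C *: (- 'i *: (1 - r)) = t * ('i *: (s%:C *: (t * r))).
  by rewrite e2 -e1 mulrBr mulr1.
apply: (obnd_le (obndM hK (obndi (obndZ s (obndM hK r3))))).
rewrite gtr0_norm// mulr1 mulrCA mulrC; apply: div_succ_mul_le; first exact: ltW.
exact: mulr_ge0.
Qed.

(** The self-adjoint parts of [T] are weakly approximated from the real subspace of self-adjoint
    elements of [l2c B]. By [weak_to_strong] the approximation may be taken strong, with
    self-adjoint approximants, so that resolvents are at hand and [l2c_sa_limit] applies. *)
Lemma l2c_wot_closed (T : H -> H) : bounded_op T ->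
  (forall (F : seq (H * H)) (e : R), 0 < e -> exists2 b, l2c B b &
     forall p, p \in F -> `|inner H ((T - (b : H -> H)) p.1) p.2| < e%:C) ->
  exists2 t, l2c B t & T = t.
Proof.
move=> bT h.
have MT : tw_alg M T.
  have [_ wc] := tw_vN M; apply: wc => // F e e0; have [b _ hb] := h F e e0.
  by exists (b : H -> H); first exact: wfunP.
pose t := WAlg MT; exists t => //.
have wt : weakly_approx t.
  move=> F e e0; have [b Lb hb] := h F e e0; exists b => // p pF.
  rewrite -lecR; apply: le_trans (ltW (hb _ pF)).
  rewrite /rip normc_def lecR.
  by rewrite -sqrtr_sqr ler_sqrt ?addr_ge0 ?sqr_ge0// lerDl sqr_ge0.
have sa_l2c a : weakly_approx a -> l2c B (half *: (a + star a)).
  move=> wa; apply: l2c_sa_limit => //.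
  apply: (weak_to_strong (V := [set b | l2c B b /\ star b = b])).
  - by split; [exact: (wsub0 hL)|exact: raddf0].
  - move=> s b c [Lb sb] [Lc sc]; split; first exact: (wsubL hL).
    by rewrite raddfD /= starZr sb sc.
  - exact: weakly_approx_sa.
have e : t = half *: (t + star t) - 'i *: (half *: ('i *: t + star ('i *: t))).
  have e1 : star ('i *: t) = - ('i *: star t).
    rewrite -complexiE starZ -scaleNr; congr (_ *: _).
    by apply/eqP; rewrite eq_complex /= oppr0 !eqxx.
  rewrite e1 -scalerBr !scalerA mulrAC -expr2 sqrCi mulN1r scaleNr opprK.
  by rewrite -scalerDr addrACA subrr addr0 half_add.
rewrite e; apply: (wsubB hL) => //; first exact: sa_l2c.
by apply: (wsubZ hL) => //; apply: sa_l2c; apply: weakly_approx_i.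
Qed.

(** The operators coming from [l2c B] form a von Neumann algebra, so the one generated by [P] is
    contained in it. *)
Lemma vN_gen_l2c (P : set (H -> H)) : (forall T, P T -> exists2 a, B a & T = a) ->
  forall T, vN_gen P T -> exists2 t, l2c B t & T = t.
Proof.
move=> hP T /(_ [set wfun a | a in l2c B]) [||a La <-]; last by exists a.
- split; first split.
  + by move=> _ [a _ <-]; apply: (usa_bounded walg_usa); apply: wfunP.
  + by exists 1 => //; apply: (wsub1 hL).
  + by move=> z _ _ [a La <-] [b Lb <-]; exists (z *: a + b) => //; apply: (wsubL hL).
  + by move=> _ _ [a La <-] [b Lb <-]; exists (a * b) => //; apply: (wsubM hL).
  + move=> _ [a La <-]; exists (star a : H -> H); last exact: starP.
    by exists (star a) => //; apply: (wsub_star hL).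
  + move=> S bS h; have [|t Lt ->] := l2c_wot_closed bS; last by exists t.
    by move=> F e e0; have [_ [b Lb <-] hb] := h F e e0; exists b.
- by move=> S /hP[a Ba ->]; exists a => //; apply: sub_l2c.
Qed.

(** [w = 2 r - 1] is the Cayley transform (1 - i b) (1 + i b)^-1, a contraction because |(1 - i b)
    y| = |(1 + i b) y|. The bounded element, which is 2 b / (1 + b^2), is half of
    ['i *: (w - star w)]. *)
Lemma cayley_obnd b r : star b = b -> r * (1 + 'i *: b) = 1 -> (1 + 'i *: b) * r = 1 ->
  obnd 1 ('i *: (r - star r)).
Proof.
move=> sb r1 r2; pose w := 2%:C *: r - 1.
have ew : w * (1 + 'i *: b) = 1 - 'i *: b.
  rewrite /w mulrBl -scalerAl r1 mul1r opprD addrA; congr (_ + _).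
  have h : 2 - 1 = 1 :> R by lra.
  have h' : 2%:C - 1 = 1 :> R[i] by rewrite -(rmorph1 (real_complex R)) -rmorphB /= h.
  by rewrite -[X in _ - X]scale1r -scalerBl h' scale1r.
have hw : obnd 1 w.
  split=> // y; rewrite mul1r.
  have ey : y = (1 + 'i *: b) (r y) by rewrite -wmulE r2.
  rewrite {1}ey -wmulE ew {2}ey -ler_sqr ?nnegrE ?hnorm_ge0//.
  have -> : (1 - 'i *: b) (r y) = r y + 'i *: (- b) (r y).
    by rewrite waddE woneE !woppE wscaleE -scalerN.
  rewrite -[(1 + 'i *: b) (r y)]/(r y + 'i *: b (r y)).
  by rewrite !hnorm_skewD ?raddfN /= ?sb// ?woppE hnormN.
have -> : 'i *: (r - star r) = (2^-1)%:C *: ('i *: (w - star w)).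
  have -> : w - star w = 2%:C *: (r - star r).
    by rewrite /w raddfB /= starZr star1 opprB addrA subrK scalerBr.
  by rewrite !scalerA mulrAC -rmorphM /= mulVf// mul1r.
apply: (obnd_le (obndZ _ (obndi (obndB hw (obnd_star hw))))).
by rewrite ger0_norm ?invr_ge0// mulVf.
Qed.

(* The contractive solution of [t = 2 c / (1 + c^2)], by iterating [c -> t (1 + c^2) / 2]. *)
Lemma kaplansky_preimage t (k : R) : star t = t -> k < 1 -> obnd k t -> l2c B t ->
  exists c, [/\ star c = c, t * c = c * t, l2c B c &
    t * (1 + c * c) = 2%:C *: c].
Proof.
move=> st k1 ht Lt; have [k0 _] := ht.
pose b := fix b n := if n is m.+1 then half *: (t * (1 + b m * b m)) else 0.
have bS n : b n.+1 = half *: (t * (1 + b n * b n)) by [].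
have bP n : [/\ star (b n) = b n, t * b n = b n * t, l2c B (b n) & obnd k (b n)].
  elim: n => [|n [sb cb Lb hb]].
    split; [exact: raddf0|by rewrite mul0r mulr0|exact: (wsub0 hL)|exact: obnd_le obnd0 k0].
  have cb2 : t * (1 + b n * b n) = (1 + b n * b n) * t.
    by rewrite mulrDl mulrDr mul1r mulr1 mulrA cb -mulrA cb mulrA.
  split.
  - by rewrite bS starZr starM raddfD /= star1 starM sb st cb2.
  - by rewrite bS -scalerAl -scalerAr cb2 mulrA cb2.
  - rewrite bS; apply: (wsubZ hL) => //; apply: (wsubM hL) => //; apply: (wsubD hL) => //; first exact: (wsub1 hL).
    exact: (wsubM hL).
  - rewrite bS; apply: (obnd_le (obndZ _ (obndM ht (obndD obnd1 (obndM hb hb))))).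
    rewrite ger0_norm ?invr_ge0// ler_pdivrMl// mulrC ler_wpM2r// mulr2n lerD2l.
    by rewrite -expr2 expr_le1// ltW.
have sqB (x y : A) : x * x - y * y = x * (x - y) + (x - y) * y.
  by rewrite mulrBr mulrBl addrA subrK.
have kk0 : 0 <= k ^+ 2 by apply: sqr_ge0.
have kk1 : k ^+ 2 < 1 by rewrite expr_lt1.
(* On the ball of radius [k] the iteration contracts by k (k + k) / 2 = k^2. *)
have step (x y : A) (d : R) : obnd k x -> obnd k y -> obnd d (x - y) ->
    obnd (k ^+ 2 * d) (half *: (t * (x * x - y * y))).
  move=> hx hy hd; rewrite sqB.
  apply: (obnd_le (obndZ _ (obndM ht (obndD (obndM hx hd) (obndM hd hy))))).
  by rewrite ger0_norm ?invr_ge0// le_eqVlt; apply/orP; left; apply/eqP; field.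
have bD n : obnd (1 * (k ^+ 2) ^+ n) (b n.+1 - b n).
  elim: n => [|n IH].
    rewrite bS /= mul0r addr0 mulr1 subr0 expr0 mulr1.
    apply: (obnd_le (obndZ _ ht)); rewrite ger0_norm ?invr_ge0//; lra.
  rewrite (bS n.+1) [in X in _ - X](bS n) -scalerBr -mulrBr opprD addrACA subrr add0r.
  have [_ _ _ h1] := bP n.+1; have [_ _ _ h2] := bP n.
  by apply: obnd_le (step _ _ _ h1 h2 IH) _; rewrite !mul1r -exprS.
have [c hc] := norm_limit_ex kk0 kk1 bD.
have small (e D : R) : 0 < e -> exists n, 1 * (k ^+ 2) ^+ n / (1 - k ^+ 2) * D <= e.
  move=> e0; have [N hN] := geometric_small (D / (1 - k ^+ 2)) kk0 kk1 e0.
  by exists N; apply: le_trans hN; rewrite le_eqVlt; apply/orP; left; apply/eqP; ring.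
exists c; split.
- apply/eqP; rewrite -subr_eq0; apply/eqP; apply: obnd_small => e e0.
  have [n hn] := small e 2 e0; have [sb _ _ _] := bP n.
  have -> : star c - c = star (c - b n) - (c - b n) by rewrite raddfB /= sb opprB addrA subrK.
  apply: (obnd_le (obndB (obnd_star (hc n)) (hc n))); apply: le_trans hn; lra.
- apply/eqP; rewrite -subr_eq0; apply/eqP; apply: obnd_small => e e0.
  have [n hn] := small e (k + k) e0; have [_ cb _ _] := bP n.
  have -> : t * c - c * t = t * (c - b n) - (c - b n) * t.
    by rewrite mulrBr mulrBl cb opprB addrA subrK.
  apply: (obnd_le (obndB (obndM ht (hc n)) (obndM (hc n) ht))); apply: le_trans hn; lra.
- apply: nclosure_l2c => e e0; have [n hn] := small e 1 e0; have [_ _ Lb _] := bP n.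
  by exists (b n) => //; apply: obnd_le (hc n) _; rewrite -[leLHS]mulr1.
- have [L hLc] := obnd_ex c; have [L0 _] := hLc.
  suff : c = half *: (t * (1 + c * c)).
    by move=> e; rewrite [in RHS]e scalerA /half -rmorphM /= divff// scale1r.
  apply/eqP; rewrite -subr_eq0; apply/eqP; apply: obnd_small => e e0.
  have [n hn] := small e (1 + 2^-1 * (k * (L + k))) e0.
  have [_ _ _ hb] := bP n; have [_ _ _ hb'] := bP n.+1.
  have -> : c - half *: (t * (1 + c * c)) =
     (c - b n.+1) - half *: (t * (c * (c - b n) + (c - b n) * b n)).
    have -> : c * (c - b n) + (c - b n) * b n = (1 + c * c) - (1 + b n * b n).
      by rewrite -sqB opprD addrACA subrr add0r.
    by rewrite mulrBr scalerBr -bS opprB addrA subrK.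
  apply: (obnd_le (obndB (hc n.+1)
    (obndZ _ (obndM ht (obndD (obndM hLc (hc n)) (obndM (hc n) hb)))))).
  apply: le_trans hn; rewrite ger0_norm ?invr_ge0// [leRHS]mulrDr mulr1.
  apply: lerD; last by rewrite le_eqVlt; apply/orP; left; apply/eqP; ring.
  rewrite ler_wpM2r ?invr_ge0 ?subr_ge0 ?(ltW kk1)// !mul1r exprS ler_piMl//.
    exact: exprn_ge0.
  exact: ltW.
Qed.

(** Dividing by [L > K] makes [t] a strict contraction, so it has the form 2 c / (1 + c^2) = i (r -
    [star r]) with [r] the resolvent of some [c] in [l2c B]. Replacing [c] by a 2-norm approximation
    in [B] moves the resolvent little in 2-norm, while the value stays a contraction by
    [cayley_obnd] however large the approximation is. The new resolvent is in turn a norm limit of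
    elements of [B]. *)
Lemma kaplansky t (K e : R) : star t = t -> obnd K t -> l2c B t -> 0 < e ->
  exists a, [/\ B a, obnd (K + e) a & n2 (t - a) <= e].
Proof.
move=> st hK Lt e0; have [K0 _] := hK; pose L := K + e / 2.
have L0 : 0 < L by rewrite ltr_wpDl// divr_gt0.
pose t' := (L^-1)%:C *: t.
have st' : star t' = t' by rewrite starZr st.
have ht' : obnd (L^-1 * K) t'.
  by apply: obnd_le (obndZ _ hK) _; rewrite ger0_norm ?invr_ge0// ltW.
have k1 : L^-1 * K < 1 by rewrite ltr_pdivrMl// mulr1 ltrDl divr_gt0.
have Lt' : l2c B t' by apply: (wsubZ hL).
have tL : t = L%:C *: t' by rewrite /t' scalerA -rmorphM /= divff ?gt_eqF// scale1r.
clearbody t'.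
have [c [sc tc Lc hc]] := kaplansky_preimage st' k1 ht' Lt'.
have [r [r1 r2 r3 _]] := resolvent hL Lc sc.
have et : t' = 'i *: (r - star r).
  have e1 : star r * (1 - 'i *: c) = 1.
    have -> : 1 - 'i *: c = star (1 + 'i *: c).
      rewrite raddfD /= star1 -complexiE starZ sc; congr (_ + _).
      rewrite -scaleNr; congr (_ *: _); apply/eqP.
      by rewrite eq_complex /= oppr0 !eqxx.
    by rewrite -starM r2 star1.
  have e2 : (1 - 'i *: c) * star r = 1.
    have -> : 1 - 'i *: c = star (1 + 'i *: c).
      rewrite raddfD /= star1 -complexiE starZ sc; congr (_ + _).
      rewrite -scaleNr; congr (_ *: _); apply/eqP.
      by rewrite eq_complex /= oppr0 !eqxx.
    by rewrite -starM r1 star1.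
  have e3 : 1 + c * c = (1 + 'i *: c) * (1 - 'i *: c).
    rewrite mulrDl mul1r mulrBr mulr1 addrA subrK; congr (_ + _).
    by rewrite -scalerAl -scalerAr scalerA -['i * 'i]expr2 sqrCi scaleN1r opprK.
  have e4 : t' * (1 + 'i *: c) = (1 + 'i *: c) * t'.
    by rewrite mulrDr mulrDl mulr1 mul1r -scalerAr -scalerAl tc.
  have -> : r - star r = r * (- 'i *: (2%:C *: c)) * star r.
    have -> : - 'i *: (2%:C *: c) = (1 - 'i *: c) - (1 + 'i *: c).
      have h2 : 2%:C = 1 + 1 :> R[i] by rewrite -(rmorph1 (real_complex R)) -rmorphD.
      by rewrite opprD addrACA subrr add0r h2 scalerDl scale1r scalerDr !scaleNr.
    by rewrite mulrBr mulrBl r1 mul1r -mulrA e2 mulr1.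
  rewrite -scalerAr -scalerAl scalerA mulrN -expr2 sqrCi opprK scale1r -hc e3 [t' * _]mulrA e4.
  by rewrite !mulrA r1 mul1r -mulrA e2 mulr1.
(* Chosen so that [L * d <= e / 2]: then the 2-norm error [L * d] is at most [e], and the norm bound
   [L * (1 + d / 2)] at most [K + e]. *)
pose d := e / (2 * (L + 1)).
have d0 : 0 < d by rewrite divr_gt0// mulr_gt0// addr_gt0.
have d4 : 0 < d / 4 by rewrite divr_gt0.
have [c0 Bc0 hc0] := Lc _ d4.
pose c1 := half *: (c0 + star c0).
have Bc1 : B c1 by apply: (wsubZ hB) => //; apply: (wsubD hB) => //; apply: (wsub_star hB).
have hc1 : n2 (c - c1) <= d / 4.
  have -> : c - c1 = half *: ((c - c0) + star (c - c0)).
    by rewrite raddfB /= sc addrACA -opprD scalerBr half_add.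
  rewrite n2Z ger0_norm ?invr_ge0// ler_pdivrMl// (le_trans (n2D _ _))//.
  by rewrite n2_star mulr_natl mulr2n lerD.
have [q [q1 q2 q3 q4]] := resolvent hB Bc1 (sa_part c0).
have qr : n2 (q - r) <= d / 4.
  rewrite (resolvent_diff q1 r2) n2i (le_trans (n2Mr _ r3))// mul1r.
  by rewrite (le_trans (n2Ml _ q3))// mul1r.
pose g := 'i *: (q - star q).
have hg : obnd 1 g by apply: cayley_obnd q1 q2; apply: sa_part.
have gt : n2 (t' - g) <= d / 2.
  rewrite et /g -scalerBr n2i.
  have -> : (r - star r) - (q - star q) = (r - q) - star (r - q).
    by rewrite (raddfB star) !opprB addrACA [RHS]addrACA [- star r - q]addrC.
  rewrite (le_trans (n2B _ _))// n2_star n2BC; apply: le_trans (lerD qr qr) _; lra.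
have [qa Bqa hqa] := q4 _ d4.
pose g' := 'i *: (qa - star qa).
have Bg' : B g' by apply: (wsubZ hB) => //; apply: (wsubB hB) => //; apply: (wsub_star hB).
have hgg : obnd (d / 2) (g - g').
  rewrite /g /g' -scalerBr opprD addrACA -opprD -raddfB /=.
  by apply: obnd_le (obndi (obndB hqa (obnd_star hqa))) _; lra.
have Ld : L * d <= e / 2.
  have -> : L * d = L * (e / 2 / (L + 1)) by rewrite /d; field; rewrite gt_eqF// addr_gt0.
  by apply: div_succ_mul_le; rewrite ltW// divr_gt0.
exists (L%:C *: g'); split; first exact: (wsubZ hB).
  have -> : g' = g - (g - g') by rewrite opprB addrC subrK.
  apply: (obnd_le (obndZ _ (obndB hg hgg))); rewrite gtr0_norm// mulrDr mulr1 /L.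
  move: Ld; rewrite /L; nra.
rewrite tL -scalerBr n2Z gtr0_norm//.
have : n2 (t' - g') <= d.
  rewrite (le_trans (n2_tri g _ _))// [d]splitr lerD//; exact: n2_obnd.
move=> /(ler_wpM2l (ltW L0)) h; apply: le_trans h _; lra.
Qed.

End Density.

(** * Free Gaussian integration by parts *)

Section FormalDerivation.
Context {R : realType} {N : tracial_wspace R}.
Notation A := (walg N).
Implicit Types a b c : A.

(* A pair [(T, rho)] stands for an element [T] together with the form
   [rho a c = (tau (x) tau) ((a (x) 1) (D T) (1 (x) c))], [D] a derivation into the
   tensor square; products follow the Leibniz rule. *)
Definition dpair := (A * (A -> A -> R[i]))%type.
Implicit Types t u v : dpair.

Definition dmul t u : dpair :=
  (t.1 * u.1, fun a c => t.2 a (u.1 * c) + u.2 (a * t.1) c).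
Definition dunit : dpair := (1, fun _ _ => 0).
Definition dlin (z : R[i]) t u : dpair :=
  (z *: t.1 + u.1, fun a c => z * t.2 a c + u.2 a c).
Definition dcen t := dlin (- tau t.1) dunit t.

Definition bilin t :=
  (forall (z : R[i]) a a' c, t.2 (z *: a + a') c = z * t.2 a c + t.2 a' c) /\
  (forall (z : R[i]) a c c', t.2 a (z *: c + c') = z * t.2 a c + t.2 a c').

(** At [a = c = 1] the form is (tau (x) tau) (D T), so this is the equation of a conjugate variable,
    for a single [T]. *)
Definition schwinger_dyson (s : A) t := tau (s * t.1) = t.2 1 1.

Lemma dmulA : associative dmul.
Proof.
move=> t u v; rewrite /dmul /= mulrA; congr pair.
by apply/funext => a; apply/funext => c; rewrite !mulrA addrA.
Qed.

Lemma dmul1l : left_id dunit dmul.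
Proof.
case=> t r; rewrite /dmul /= mul1r; congr pair.
by apply/funext => a; apply/funext => c; rewrite mulr1 add0r.
Qed.

Lemma dmul1r : right_id dunit dmul.
Proof.
case=> t r; rewrite /dmul /= mulr1; congr pair.
by apply/funext => a; apply/funext => c; rewrite mul1r addr0.
Qed.

Definition dprod (l : seq dpair) := foldr dmul dunit l.

Lemma dprod_cat l l' : dprod (l ++ l') = dmul (dprod l) (dprod l').
Proof. by elim: l => [|t l IH] /=; rewrite ?dmul1l// IH dmulA. Qed.

Lemma bilin1 : bilin dunit.
Proof. by split=> *; rewrite /= mulr0 addr0. Qed.

Lemma bilin_mul t u : bilin t -> bilin u -> bilin (dmul t u).
Proof.
move=> [t1 t2] [u1 u2]; split=> z a b c /=.
  by rewrite mulrDl -scalerAl t1 u1 mulrDr; ring.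
by rewrite mulrDr -scalerAr t2 u2 mulrDr; ring.
Qed.

Lemma bilin_lin z t u : bilin t -> bilin u -> bilin (dlin z t u).
Proof. by move=> [t1 t2] [u1 u2]; split=> w a b c /=; rewrite ?t1 ?u1 ?t2 ?u2; ring. Qed.

Lemma schwinger_dyson_lin s z t u w v : bilin t -> bilin v ->
  schwinger_dyson s (dmul (dmul t u) v) -> schwinger_dyson s (dmul (dmul t w) v) ->
  schwinger_dyson s (dmul (dmul t (dlin z u w)) v).
Proof.
rewrite /schwinger_dyson /= => [[_ t2] [v1 _]] hu hw.
rewrite mulrDr -scalerAr mulrDl -scalerAl mulrDr -scalerAr raddfD /= tauZ hu hw.
rewrite !mul1r mulrDl -scalerAl t2 v1; ring.
Qed.

(** The unital algebra generated by [G], formed on pairs and not on operators: relations between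
    operators could make a derivation ill-defined on them. *)
Inductive pgen (G : set dpair) : dpair -> Prop :=
| pgen_gen t : G t -> pgen G t
| pgen_one : pgen G dunit
| pgen_mul t u : pgen G t -> pgen G u -> pgen G (dmul t u)
| pgen_lin z t u : pgen G t -> pgen G u -> pgen G (dlin z t u).

Lemma pgen_cen G t : pgen G t -> pgen G (dcen t).
Proof. by move=> h; apply: pgen_lin => //; apply: pgen_one. Qed.

Lemma pgen_bilin G t : (forall u, G u -> bilin u) -> pgen G t -> bilin t.
Proof.
move=> hG; elim=> {t} [t /hG//||t u _ ? _ ?|z t u _ ? _ ?].
- exact: bilin1.
- exact: bilin_mul.
- exact: bilin_lin.
Qed.

Fixpoint allP (T : Type) (P : T -> Prop) (l : seq T) :=
  if l is x :: l' then P x /\ allP P l' else True.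

Lemma allP_cat T (P : T -> Prop) l l' : allP P (l ++ l') <-> allP P l /\ allP P l'.
Proof. by elim: l => [|x l IH] /=; [split=> [|[]]|rewrite IH; split=> [[? []]|[[]]]]. Qed.

Lemma allP_map T U (f : T -> U) (P : U -> Prop) l : allP P (map f l) <-> allP (P \o f) l.
Proof. by elim: l => [|x l IH] //=; rewrite IH. Qed.

Lemma allP_impl T (P Q : T -> Prop) l : (forall x, P x -> Q x) -> allP P l -> allP Q l.
Proof. by move=> h; elim: l => [|x l IH] //= [/h ? /IH]. Qed.

Lemma dprod_bilin l : allP bilin l -> bilin (dprod l).
Proof.
elim: l => [_|t l IH [ht /IH]]; [exact: bilin1|exact: bilin_mul].
Qed.

(** The equation is linear but not multiplicative, so the induction proves it in context: a word of
    generators stands on the left, and on the right any [u] that satisfies the equation behind every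
    such word. *)
Lemma pgen_schwinger_dyson s G : (forall u, G u -> bilin u) ->
  (forall w, allP G w -> schwinger_dyson s (dprod w)) ->
  forall t, pgen G t -> schwinger_dyson s t.
Proof.
move=> hG hw t ht.
suff key : forall u, bilin u ->
    (forall w, allP G w -> schwinger_dyson s (dmul (dprod w) u)) ->
    forall w, allP G w -> schwinger_dyson s (dmul (dprod w) (dmul t u)).
  rewrite -[t]dmul1r -[X in schwinger_dyson s X]dmul1l; apply: (key _ bilin1 _ [::]) => //.
  by move=> w /hw; rewrite dmul1r.
elim: ht => {t} [t ht|| t t' ht IH ht' IH'|z t t' ht IH ht' IH'] u bu hu w Gw.
- have := hu (w ++ [:: t]); rewrite dprod_cat /= dmul1r dmulA; apply.
  by rewrite allP_cat.
- by rewrite dmul1l; apply: hu.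
- rewrite -[dmul (dmul t t') u]dmulA; apply: IH => //.
    by apply: bilin_mul => //; apply: pgen_bilin ht'.
  by move=> w' Gw'; apply: IH'.
- rewrite dmulA; apply: schwinger_dyson_lin => //.
  + by apply: dprod_bilin; apply: allP_impl Gw.
  + by rewrite -dmulA; apply: IH.
  + by rewrite -dmulA; apply: IH'.
Qed.

Section Freeness.
Variables (I : eqType) (G : I -> set A) (F : I -> set dpair) (i0 : I) (s : A).
Hypothesis Glin : forall i (z : R[i]) a b, G i a -> G i b -> G i (z *: a + b).
Hypothesis GM : forall i a b, G i a -> G i b -> G i (a * b).
Hypothesis G1 : forall i, G i 1.

Definition alternating (T : Type) (l : seq (I * T)) := sorted (fun p q => p.1 != q.1) l.
Definition centered (p : I * A) := G p.1 p.2 /\ tau p.2 = 0.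

Hypothesis free : forall l : seq (I * A), l != [::] -> alternating l ->
  allP centered l -> tau (\prod_(p <- l) p.2) = 0.

Hypothesis FG : forall i t, F i t -> G i t.1.
Hypothesis FM : forall i t u, F i t -> F i u -> F i (dmul t u).
Hypothesis Fcen : forall i t, F i t -> F i (dcen t).
Hypothesis F0 : forall i t, i != i0 -> F i t -> t.2 = fun _ _ => 0.
Hypothesis FL : forall t, F i0 t -> exists L : seq (A * A),
  allP (fun p => G i0 p.1 /\ G i0 p.2) L /\
  forall a c, t.2 a c = \sum_(p <- L) tau (a * p.1) * tau (p.2 * c).
Hypothesis FE : forall t, F i0 t -> schwinger_dyson s t.
Hypothesis Gs : G i0 s.
Hypothesis s0 : tau s = 0.

Let ok (l : seq (I * dpair)) := allP (fun p => F p.1 p.2) l.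
Let P (l : seq (I * dpair)) := dprod [seq p.2 | p <- l].
Let cen (p : I * dpair) := (p.1, dcen p.2).
Let okc (l : seq (I * dpair)) := allP (fun p => F p.1 p.2 /\ tau p.2.1 = 0) l.

Let Gcen i a : G i a -> centered (i, a - tau a *: 1).
Proof.
split=> /=; first by rewrite addrC -scaleNr; apply: Glin => //; apply: G1.
by rewrite raddfB /= tauZ tau1 mulr1 subrr.
Qed.

Let P1E l : (P l).1 = \prod_(p <- [seq (p.1, p.2.1) | p <- l]) p.2.
Proof. by elim: l => [|p l IH] /=; rewrite ?big_nil// big_cons -IH. Qed.

Let alt_map l : alternating l -> alternating [seq (p.1, p.2.1) | p <- l : seq (I * dpair)].
Proof. by case: l => // p l; elim: l p => [|q l IH] p //= /andP[-> /IH]. Qed.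

Let okc_map l : okc l -> allP centered [seq (p.1, p.2.1) | p <- l].
Proof. by rewrite allP_map; apply: allP_impl => p [/FG]. Qed.

Let F_bilin i t : F i t -> bilin t.
Proof.
have [->|ni] := eqVneq i i0; last by move=> /(F0 ni) e; split=> z a b c; rewrite e mulr0 addr0.
move=> /FL[L [_ h]]; split=> z a b c; rewrite !h mulr_sumr -big_split; apply: eq_bigr => p _ /=.
  by rewrite mulrDl -scalerAl raddfD /= tauZ; ring.
by rewrite mulrDr -scalerAr raddfD /= tauZ; ring.
Qed.

(* tau (u p) = 0 and tau (q v) = 0 for [p], [q] of colour [i0], as soon as [u]
   (resp. [v]) is a nonempty alternating centered product not ending (resp.
   beginning) with that colour. *)
Let free_right (u : seq (I * A)) (p : A) : u != [::] -> alternating (rcons u (i0, p)) ->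
  allP centered u -> G i0 p -> tau (\prod_(x <- u) x.2 * p) = 0.
Proof.
move=> u0 alt cu Gp; rewrite -[p](subrK (tau p *: 1)) mulrDr raddfD /=.
have alt' : alternating (rcons u (i0, p - tau p *: 1)).
  by move: alt; rewrite /alternating; case: (u) => // x w; rewrite !rcons_cons /= !rcons_path.
have := free (l := rcons u (i0, p - tau p *: 1)).
rewrite -cats1 big_cat big_seq1 /= => -> //; last 3 first.
- by case: (u).
- by rewrite cats1.
- by rewrite allP_cat; split=> //; split=> //; apply: Gcen.
rewrite -scalerAr mulr1 tauZ free ?mulr0 ?addr0//.
by move: alt; rewrite /alternating; case: (u) => // x w; rewrite rcons_cons /= rcons_path => /andP[].
Qed.

Let free_left (u : seq (I * A)) (q : A) : u != [::] -> alternating ((i0, q) :: u) ->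
  allP centered u -> G i0 q -> tau (q * \prod_(x <- u) x.2) = 0.
Proof.
move=> u0 alt cu Gp; rewrite -[q](subrK (tau q *: 1)) mulrDl raddfD /=.
have := free (l := (i0, q - tau q *: 1) :: u).
rewrite big_cons /= => -> //; last 2 first.
- by move: alt; rewrite /alternating /=; case: (u).
- by split=> //; apply: Gcen.
rewrite -scalerAl mul1r tauZ free ?mulr0 ?addr0//.
by move: alt; rewrite /alternating /=; case: (u) => // x w /andP[].
Qed.

Let alt_cat (T : Type) (u v : seq (I * T)) : alternating (u ++ v) -> alternating u /\ alternating v.
Proof.
rewrite /alternating; case: u => [|x u] //=; rewrite cat_path => /andP[-> ]; split=> //.
by case: v b => // y v /= /andP[].
Qed.

Let rho_tail (u l : seq (I * dpair)) : u != [::] -> alternating (u ++ l) -> okc u -> okc l ->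
  (P l).2 (P u).1 1 = 0.
Proof.
elim: l u => [|[i x] l IH] u u0 alt hu; first by [].
move=> [[Fx x0] hl]; rewrite /P /= -/(P l).
have -> : (P u).1 * x.1 = (P (rcons u (i, x))).1.
  by rewrite /P map_rcons -cats1 dprod_cat /= mulr1.
rewrite IH ?addr0; last 4 first.
- by case: (u).
- by rewrite cat_rcons.
- by rewrite /okc -cats1 allP_cat.
- by [].
rewrite mulr1; have [ei|ni] := eqVneq i i0; last by rewrite (F0 ni Fx).
move: Fx alt; rewrite ei => Fx alt; have [L [hL ->]] := FL Fx.
have alt1 p : alternating (rcons [seq (p.1, p.2.1) | p <- u] (i0, p)).
  have := alt; rewrite -cat_rcons => /alt_cat[+ _] => /alt_map.
  rewrite map_rcons /= /alternating; case: [seq _ | _ <- u] => // y w.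
  by rewrite !rcons_cons /= !rcons_path.
elim: L hL => [|[p q] L IHL] /=; first by rewrite big_nil.
move=> [[Gp Gq] /IHL]; rewrite big_cons => ->.
rewrite (P1E u) free_right ?mul0r ?addr0//; first by case: (u) u0.
exact: okc_map.
Qed.

(** Only a cut in the first letter can contribute. If that letter has another colour, [s] is itself
    a centered letter in front and both sides vanish. If it has colour [i0], then [s] merges with
    it: both sides vanish when more letters follow, and a single letter is the hypothesis [FE]. *)
Let sd_centered l : alternating l -> okc l -> schwinger_dyson s (P l).
Proof.
case: l => [_ _|[i x] l alt [[Fx x0] hl]]; first by rewrite /schwinger_dyson /= mulr1 s0.
rewrite /schwinger_dyson /P /= -/(P l).
have -> : (P l).2 (1 * x.1) 1 = 0.
  have -> : 1 * x.1 = (P [:: (i, x)]).1 by rewrite /P /= mul1r mulr1.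
  by rewrite (rho_tail (u := [:: (i, x)])).
rewrite addr0 mulr1.
have alt' : alternating ((i, x.1) :: [seq (p.1, p.2.1) | p <- l]) by exact: (alt_map alt).
have [ei|ni] := eqVneq i i0; last first.
  rewrite (F0 ni Fx) P1E /=.
  have := free (l := [:: (i0, s), (i, x.1) & [seq (p.1, p.2.1) | p <- l]]).
  rewrite !big_cons /=; apply=> //.
    by rewrite /alternating /= eq_sym ni; exact: alt'.
  by split=> //; split; [split=> //; exact: FG Fx|exact: okc_map].
move: Fx alt alt'; rewrite ei => Fx alt alt'.
case: l hl alt alt' => [|y l] hl alt alt'.
  by have := FE Fx; rewrite /schwinger_dyson /P /= !mulr1.
have altG q : alternating ((i0, q) :: [seq (p.1, p.2.1) | p <- y :: l]).
  by move: alt'; rewrite /alternating.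
rewrite mulrA P1E free_left//; last 2 first.
- exact: okc_map.
- by apply: GM => //; apply: FG.
have [L [hL ->]] := FL Fx.
elim: L hL => [|[p q] L IHL]; first by rewrite big_nil.
move=> [[Gp Gq] /IHL e]; rewrite big_cons -e addr0.
rewrite free_left ?mulr0//; exact: okc_map.
Qed.

Let unsorted_split (T : Type) (e : rel T) (l : seq T) : ~~ sorted e l ->
  exists l1 x y l2, l = l1 ++ [:: x, y & l2] /\ ~~ e x y.
Proof.
case: l => // x l; elim: l x => // y l IH x /=; rewrite negb_and => /orP[h|/IH].
  by exists [::], x, y, l.
by move=> [l1 [a [b [l2 [-> h]]]]]; exists (x :: l1), a, b, l2.
Qed.

Let ok_bilin l : ok l -> bilin (P l).
Proof. by move=> h; apply: dprod_bilin; rewrite allP_map; apply: allP_impl h => p; apply: F_bilin. Qed.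

(** Freeness propagates the equation from the algebra of colour [i0] to words in all colours, the
    derivation being zero on the other colours. By induction on the length, neighbours of equal
    colour are merged and letters are replaced by their centered parts, which leaves the alternating
    centered words of [sd_centered]. *)
Theorem free_schwinger_dyson (l : seq (I * dpair)) :
  allP (fun p => F p.1 p.2) l -> schwinger_dyson s (dprod [seq p.2 | p <- l]).
Proof.
have [m] := ubnP (size l); elim: m l => // m IH l lm okl; rewrite -/(P l).
have [alt|] := boolP (sorted (fun p q : I * dpair => p.1 != q.1) l); last first.
  move=> /unsorted_split[l1 [[i x] [[j y] [l2 [el]]]]] /=; rewrite negbK => /eqP ij.
  move: lm okl; rewrite el -ij size_cat /= => lm /allP_cat[ok1 [Fx [Fy ok2]]].
  have -> : P (l1 ++ [:: (i, x), (i, y) & l2]) = P (l1 ++ (i, dmul x y) :: l2).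
    by rewrite /P !map_cat !dprod_cat /= !dmulA.
  apply: IH; first by rewrite size_cat /= -ltnS -addnS.
  by rewrite allP_cat; split=> //; split=> //; apply: FM.
have okcen k : ok k -> okc (map cen k).
  rewrite /okc allP_map; apply: allP_impl => -[i x] /= Fx; split; first exact: Fcen.
  by rewrite raddfD /= tauZ tau1 mulr1 addNr.
have okok k : okc k -> ok k by apply: allP_impl => p [].
(* Letters are centered one at a time: writing a letter as its trace plus its centered part adds a
   word with that letter deleted, covered by the induction on the length. *)
suff key : forall l2 l1, (size (l1 ++ l2) <= m)%N -> ok l1 -> ok l2 ->
    schwinger_dyson s (P (map cen (l1 ++ l2))) -> schwinger_dyson s (P (map cen l1 ++ l2)).
  apply: (key l [::]) => //; apply: sd_centered; last exact: okcen.
  by move: alt; case: (l) => // p k; rewrite /alternating /=; elim: k p => // q k IHk p /= /andP[-> /IHk].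
elim=> [|[i x] l2 IH2] l1 sl ok1; first by rewrite !cats0.
move=> [Fx ok2] h.
have b1 : bilin (P (map cen l1)) by apply: ok_bilin; apply: okok; apply: okcen.
have b2 : bilin (P l2) by apply: ok_bilin.
have e t : P (map cen l1 ++ (i, t) :: l2) = dmul (dmul (P (map cen l1)) t) (P l2).
  by rewrite /P map_cat dprod_cat /= dmulA.
have ex : x = dlin (tau x.1) dunit (dcen x).
  case: (x) => a r; rewrite /dcen /dlin /=; congr pair.
    by rewrite addrA scaleNr subrr add0r.
  by apply/funext => b; apply/funext => c; rewrite !mulr0 !add0r.
rewrite e {1}ex; apply: schwinger_dyson_lin => //.
  rewrite dmul1r; have := IH (map cen l1 ++ l2); rewrite map_cat dprod_cat; apply.
    by move: sl; rewrite !size_cat size_map /= addnS.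
  by rewrite allP_cat; split=> //; apply: okok; apply: okcen.
rewrite -e; have := IH2 (rcons l1 (i, x)).
rewrite map_rcons !cat_rcons; apply => //.
by rewrite /ok -cats1 allP_cat.
Qed.

End Freeness.
End FormalDerivation.

(** * Moments of the semicircle law *)

Section SemicircleMoments.
Context {R : realType}.
Notation mu := (@lebesgue_measure R).

Definition semicircle_density (x : R) : R := Num.sqrt (4 - x ^+ 2) / (2 * pi).
Definition semicircle_moment (k : nat) : R :=
  (\int[mu]_(x in `[-2, 2]) (x ^+ k * (Num.sqrt (4 - x ^+ 2) / (2 * pi))))%R.

(** An antiderivative chosen for the recursion: it vanishes at -2 and 2, and the factor [4 - x ^+ 2]
    cancels the singularity of the derivative of the density, so that [f] involves two moments only.
    At [j = 0] the coefficient [j%:R] cancels the term with [j.-1]. *)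
Let F (j : nat) (x : R) : R := x ^+ j * ((4 - x ^+ 2) * semicircle_density x).
Let f (j : nat) (x : R) : R :=
  4 * j%:R * (x ^+ j.-1 * semicircle_density x)
  - (j%:R + 3) * (x ^+ j.+1 * semicircle_density x).

Let density_continuous : continuous semicircle_density.
Proof.
move=> x; apply: cvgMl; apply: (@continuous_comp _ _ _ (fun x : R => 4 - x ^+ 2)).
  by apply: cvgB; [exact: cvg_cst|exact: exprn_continuous].
exact: sqrt_continuous.
Qed.

Let moment_continuous j : continuous (fun x : R => x ^+ j * semicircle_density x).
Proof. by move=> x; apply: cvgM; [exact: exprn_continuous|exact: density_continuous]. Qed.

Let f_continuous j : continuous (f j).
Proof. by move=> x; apply: cvgB; apply: cvgMr; apply: moment_continuous. Qed.

Let F_continuous j : continuous (F j).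
Proof.
move=> x; apply: cvgM; first exact: exprn_continuous.
apply: cvgM; last exact: density_continuous.
by apply: cvgB; [exact: cvg_cst|exact: exprn_continuous].
Qed.

Let density_derive (x : R) : -2 < x < 2 ->
  is_derive x 1 semicircle_density (- x / (Num.sqrt (4 - x ^+ 2) * (2 * pi))).
Proof.
move=> /andP[x2 x2']; have h : 0 < 4 - x ^+ 2 by nra.
have s0 : Num.sqrt (4 - x ^+ 2) != 0 by rewrite gt_eqF// sqrtr_gt0.
have p0 : (pi : R) != 0 by rewrite gt_eqF// pi_gt0.
have h1 : is_derive x 1 (fun y : R => 4 - y ^+ 2) (- (2 * x)).
  by apply: is_derive_eq; rewrite /GRing.scale /=; ring.
have h3 := @is_derive1_comp R Num.sqrt (fun y : R => 4 - y ^+ 2) x _ _ (is_derive1_sqrt h) h1.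
have -> : semicircle_density =
  (2 * pi)^-1 \*: (Num.sqrt \o (fun y : R => 4 - y ^+ 2)).
  by apply/funext => y; rewrite /semicircle_density /= mulrC.
apply: is_derive_eq; rewrite /= /GRing.scale /=.
move: (Num.sqrt _) (pi : R) s0 p0 => s p s0 p0; field.
by rewrite s0 p0.
Qed.

Let F_derive j (x : R) : -2 < x < 2 -> is_derive x 1 (F j) (f j x).
Proof.
move=> hx; have hd := density_derive hx; case/andP: hx => x2 x2'.
have h : 0 < 4 - x ^+ 2 by nra.
have s0 : Num.sqrt (4 - x ^+ 2) != 0 by rewrite gt_eqF// sqrtr_gt0.
have p0 : (pi : R) != 0 by rewrite gt_eqF// pi_gt0.
have h1 : is_derive x 1 (fun y : R => 4 - y ^+ 2) (- (2 * x)).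
  by apply: is_derive_eq; rewrite /GRing.scale /=; ring.
have h2 : is_derive x 1 (fun y : R => y ^+ j) (j%:R * x ^+ j.-1).
  rewrite (_ : (fun y : R => y ^+ j) = (@id R) ^+ j); last by apply/funext => y; rewrite exprfctE.
  by apply: is_derive_eq; rewrite /GRing.scale /= mulr1.
have h3 := is_deriveM h1 hd; have h4 := is_deriveM h2 h3.
apply: (is_derive_eq h4).
rewrite /f /semicircle_density /GRing.scale /= !fctE.
have ss : Num.sqrt (4 - x ^+ 2) ^+ 2 = 4 - x ^+ 2 by rewrite sqr_sqrtr ?(ltW h).
move: (Num.sqrt _) (pi : R) s0 p0 ss => s p s0 p0 ss.
have -> : (4 - x ^+ 2) * (- x / (s * (2 * p))) = - x * (s / (2 * p)).
  by rewrite -ss; field; rewrite s0 p0.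
by case: (j) => [|k]; rewrite /= ?exprS ?expr0; field; rewrite p0.
Qed.

Let integrable_cts (g : R -> R) : continuous g -> mu.-integrable `[-2, 2] (EFin \o g).
Proof.
move=> cg; apply: continuous_compact_integrable; first exact: segment_compact.
exact: continuous_subspaceT.
Qed.

Lemma semicircle_moment_rec j :
  (j%:R + 3) * semicircle_moment j.+1 = 4 * j%:R * semicircle_moment j.-1.
Proof.
have hF : (\int[mu]_(x in `[(-2)%R, 2%R]) (f j x)%:E = (F j 2)%:E - (F j (-2))%:E)%E.
  apply: continuous_FTC2.
  - by lra.
  - exact: continuous_subspaceT.
  - split.
    + by move=> x; rewrite in_itv /= => hx; have [] := F_derive j hx.
    + by apply: cvg_at_right_filter; apply: F_continuous.
    + by apply: cvg_at_left_filter; apply: F_continuous.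
  - move=> x; rewrite in_itv /= => hx; have h := F_derive j hx.
    by rewrite derive1E; apply: derive_val.
have z : F j 2 = 0 /\ F j (-2) = 0.
  have e2 : 4 - 2 ^+ 2 = 0 :> R by ring.
  by rewrite /F sqrrN e2 !mul0r !mulr0.
have : (\int[mu]_(x in `[-2, 2]) (f j x) = 0)%R.
  by rewrite /Rintegral hF z.1 z.2 sube0.
have mitv := measurable_itv (R := R) `[-2, 2].
have cM i (c : R) : continuous (fun x : R => c * (x ^+ i * semicircle_density x)).
  by move=> x; apply: cvgMr; apply: moment_continuous.
rewrite /f RintegralB//; [|exact: (integrable_cts (cM _ _))..].
rewrite !RintegralZl//; [|by apply: integrable_cts; apply: moment_continuous..].
rewrite -/(semicircle_moment j.-1) -/(semicircle_moment j.+1).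
by move=> /eqP; rewrite subr_eq0 => /eqP.
Qed.

(** The convolution formula of the Catalan numbers, obtained from the two-term recursion without
    generating functions. The total mass enters as a hypothesis: it will be read off from
    [tau 1 = 1]. *)
Lemma semicircle_moment_conv : semicircle_moment 0 = 1 -> forall n,
  semicircle_moment n.+1 = \sum_(j < n) semicircle_moment j * semicircle_moment (n.-1 - j).
Proof.
move=> m0; pose m := semicircle_moment; rewrite -[semicircle_moment 0]/(m 0) in m0.
have m1 : m 1 = 0 by have := semicircle_moment_rec 0; rewrite -/m => h; lra.
have rec k : (k%:R + 4) * m k.+2 = 4 * (k%:R + 1) * m k.
  have := semicircle_moment_rec k.+1; rewrite -/m /= -!natr1 -/(m k.+2) -/(m k) => <-.
  by ring.
pose a n := \sum_(j < n.+1) m j * m (n - j)%N.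
suff ha n : a n = m n.+2.
  by case=> [|n]; [rewrite big_ord0 -/m m1|rewrite -/m -ha].
have [k] := ubnP n; elim: k n => // k IH n nk.
(* Both sides of [sum_j (j + 2) m_j m_(n - j)], symmetrised and via the recursion. *)
have sym : 2 * (\sum_(j < n.+1) (j%:R + 2) * (m j * m (n - j)%N)) = (n%:R + 4) * a n.
  have rev : \sum_(j < n.+1) (j%:R + 2) * (m j * m (n - j)%N) =
      \sum_(j < n.+1) ((n - j)%:R + 2) * (m j * m (n - j)%N).
    rewrite (reindex_inj rev_ord_inj) /=; apply: eq_bigr => j _.
    by rewrite subSS subKn ?(mulrC (m (n - j)%N))// -ltnS.
  rewrite mulr_natl mulr2n {2}rev -big_split mulr_sumr; apply: eq_bigr => j _ /=.
  by rewrite natrB ?(leq_ord j)//; ring.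
have n4 : n%:R + 4 != 0 :> R by rewrite gt_eqF// ltr_wpDl.
apply: (mulfI n4); rewrite rec -sym.
case: n IH nk sym n4 => [|n] IH nk _ _.
  by rewrite big_ord_recl big_ord0 /= subnn !m0; ring.
rewrite !big_ord_recl /= /bump /= !add1n !m1 !subn0 m0.
case: n IH nk => [|n] IH nk.
  by rewrite big_ord0 m1; ring.
(* The terms of index 0 and 1 have been split off. In the others the recursion trades (i + 4) m_(i +
   2) for 4 (i + 1) m_i, and the convolution of order [n], known by induction, appears. *)
have -> : \sum_(i < n.+1) ((1 + (1 + i))%:R + 2) * (m (1 + (1 + i))%N * m (n.+2 - (1 + (1 + i)))%N)
   = 4 * \sum_(i < n.+1) (i%:R + 1) * (m i * m (n - i)%N).
  rewrite mulr_sumr; apply: eq_bigr => i _; rewrite !add1n !subSS.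
  have h := rec i.
  have -> : i.+2%:R + 2 = i%:R + 4 :> R by rewrite -!natr1; ring.
  by rewrite !mulrA h.
have ht : (n.+2)%:R * a n = 2 * \sum_(i < n.+1) (i%:R + 1) * (m i * m (n - i)%N).
  have rev : \sum_(j < n.+1) (j%:R + 1) * (m j * m (n - j)%N) =
      \sum_(j < n.+1) ((n - j)%:R + 1) * (m j * m (n - j)%N).
    rewrite (reindex_inj rev_ord_inj) /=; apply: eq_bigr => j _.
    by rewrite subSS subKn ?(mulrC (m (n - j)%N))// -ltnS.
  rewrite [RHS]mulr_natl mulr2n {2}rev -big_split mulr_sumr; apply: eq_bigr => j _ /=.
  by rewrite natrB ?(leq_ord j)// -!natr1; ring.
have := IH n ltac:(by rewrite -ltnS (leq_trans _ nk)) => han.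
rewrite han in ht; move: ht; set T := \sum_(i < n.+1) _ => ht.
transitivity (4 * m n.+2 + 4 * (2 * T)); first by ring.
by rewrite -ht -!natr1; ring.
Qed.

End SemicircleMoments.

(** * Schwinger-Dyson equations of a free semicircular family *)

Section GaussianIntegrationByParts.
Context {R : realType} {N : tracial_wspace R}.
Notation A := (walg N).
Implicit Types a b c : A.

Definition gen_alg (B : set (op N)) : set A := [set a | star_alg_gen B (a : op N)].

Lemma gen_algL B (z : R[i]) a b : gen_alg B a -> gen_alg B b -> gen_alg B (z *: a + b).
Proof. by move=> ha hb C hC BC; apply: (usa_lin hC); [apply: ha|apply: hb]. Qed.

Lemma gen_algM B a b : gen_alg B a -> gen_alg B b -> gen_alg B (a * b).
Proof. by move=> ha hb C hC BC; apply: (usa_comp hC); [apply: ha|apply: hb]. Qed.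

Lemma gen_alg1 B : gen_alg B 1.
Proof. by move=> C hC _; apply: (usa_id hC). Qed.

Lemma gen_alg_sub B a : B (a : op N) -> gen_alg B a.
Proof. by move=> Ba C hC BC; apply: BC. Qed.

Lemma wfun_prod (J : Type) (r : seq J) (F : J -> A) :
  (\prod_(j <- r) F j : A) =
  \big[(fun S T => S \o T)/idfun]_(j <- r) (F j : op N) :> op N.
Proof. by elim/big_rec2: _ => // j y a _ <-. Qed.

Lemma allP_nth T (P : T -> Prop) x0 l j : allP P l -> (j < size l)%N -> P (nth x0 l j).
Proof. by elim: l j => [|x l IH] [|j] //= [Px /IH h] lj; [exact: Px|exact: h]. Qed.

Lemma free_family_prod (I : eqType) (B : I -> set (op N)) : free_family B ->
  forall l : seq (I * A), l != [::] -> alternating l ->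
  allP (centered (fun i => gen_alg (B i))) l -> tau (\prod_(p <- l) p.2) = 0.
Proof.
move=> hB [//|x0 l] _ alt hl.
have := hB (size l) (fun j => (nth x0 (x0 :: l) j).1)
  (fun j => (nth x0 (x0 :: l) j).2 : op N).
rewrite /tau wfun_prod (big_nth x0); apply.
  by move=> j jl; have [] := allP_nth x0 hl (ltac:(by []) : (j < size (x0 :: l))%N).
move=> j jl; apply/eqP.
by move: alt; rewrite /alternating /= => /(pathP x0)/(_ _ jl).
Qed.

(** The derivative of a polynomial is a finite tensor with both legs in the same algebra, the form
    in which [free_schwinger_dyson] can apply freeness to each leg. *)
Lemma pgen_form (Gs : set A) (Gam : set (dpair (N := N))) :
  (forall (z : R[i]) a b, Gs a -> Gs b -> Gs (z *: a + b)) ->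
  (forall a b, Gs a -> Gs b -> Gs (a * b)) -> Gs 1 ->
  (forall u, Gam u -> Gs u.1 /\ exists k : R[i], u.2 = fun a c => k * (tau a * tau c)) ->
  forall t, pgen Gam t -> Gs t.1 /\ exists L : seq (A * A),
    allP (fun p => Gs p.1 /\ Gs p.2) L /\
    forall a c, t.2 a c = \sum_(p <- L) tau (a * p.1) * tau (p.2 * c).
Proof.
move=> GL GM G1 hG.
have G0 : Gs 0 by have := GL (-1) _ _ G1 G1; rewrite scaleN1r addNr.
have GZ z a : Gs a -> Gs (z *: a) by move=> /(GL z) /(_ G0); rewrite addr0.
move=> t; elim=> {t} [t /hG[G1t [k ek]]||t u _ [Gt [L [hL eL]]] _ [Gu [K [hK eK]]]
  |z t u _ [Gt [L [hL eL]]] _ [Gu [K [hK eK]]]].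
- split=> //; exists [:: (k *: 1, 1)]; split; first by split=> //; split=> //; apply: GZ.
  by move=> a c; rewrite big_seq1 ek /= -scalerAr tauZ mulr1 mul1r mulrA.
- by split=> //; exists [::]; split=> // a c; rewrite big_nil.
- split; first exact: GM.
  exists ([seq (p.1, p.2 * u.1) | p <- L] ++ [seq (t.1 * p.1, p.2) | p <- K]); split.
    rewrite allP_cat !allP_map; split; [apply: allP_impl hL|apply: allP_impl hK] => p [];
    by split=> //=; apply: GM.
  move=> a c; rewrite big_cat !big_map /= eL eK.
  by congr (_ + _); apply: eq_bigr => p _; rewrite !mulrA.
- split; first exact: GL.
  exists ([seq (z *: p.1, p.2) | p <- L] ++ K); split.
    rewrite allP_cat !allP_map; split=> //; apply: allP_impl hL => p [].
    by split=> //=; apply: GZ.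
  move=> a c; rewrite big_cat !big_map /= eL eK mulr_sumr.
  by congr (_ + _); apply: eq_bigr => p _; rewrite -scalerAr tauZ mulrA.
Qed.

Section Family.
Variables (n : nat) (x s : 'I_n -> A).
Hypothesis s_moment : forall i k, tau (s i ^+ k) = (semicircle_moment k : R)%:C.
Hypothesis s_free : free_family (fun i => [set (s i : op N)]).
Hypothesis sx_free : free_from (range (fun i => s i : op N)) (range (fun i => x i : op N)).
Variable i : 'I_n.

(** [dS] and [dX] encode the derivation with respect to [s i]: it sends [s j] to delta_ij 1 (x) 1
    and kills the elements under [dX]. *)
Definition dS j : dpair := (s j, fun a c => (i == j)%:R * (tau a * tau c)).
Definition dX (a : A) : dpair := (a, fun _ _ => 0).

Let m0 : semicircle_moment 0 = 1 :> R.
Proof. by apply: (@complexI R); rewrite -(s_moment i) expr0 tau1. Qed.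

Let s0 : tau (s i) = 0.
Proof.
rewrite -[s i]expr1 s_moment; have := semicircle_moment_rec (R := R) 0.
by rewrite mulr0 mul0r add0r => h; congr (_%:C); lra.
Qed.

Let dS_bilin j : bilin (dS j).
Proof.
split=> z a b c /=; first by rewrite raddfD /= tauZ; ring.
by rewrite raddfD /= tauZ; ring.
Qed.

Let dX_bilin a : bilin (dX a).
Proof. by split=> *; rewrite /= mulr0 addr0. Qed.

Let dS_pow k : (dprod (nseq k (dS i))).1 = s i ^+ k /\
  forall a c, (dprod (nseq k (dS i))).2 a c =
    \sum_(j < k) tau (a * s i ^+ j) * tau (s i ^+ (k.-1 - j) * c).
Proof.
elim: k => [|k [IH1 IH2]]; first by split=> //= a c; rewrite big_ord0.
split=> /=; first by rewrite IH1 exprS.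
move=> a c; rewrite IH1 eqxx mul1r IH2 big_ord_recl /= mulr1 subn0; congr (_ + _).
apply: eq_bigr => j _; rewrite /bump /= add1n exprS mulrA.
by case: (k) j => [[]//|k'] j; rewrite subSS.
Qed.

(** On powers of [s i] the equation is the convolution formula for the semicircle moments. *)
Let sd_single t : pgen [set dS i] t -> schwinger_dyson (s i) t.
Proof.
apply: pgen_schwinger_dyson => [u ->//|w hw].
have -> : w = nseq (size w) (dS i).
  by elim: w hw => //= u w IH [-> /IH <-].
have [e1 e2] := dS_pow (size w); rewrite /schwinger_dyson e1 e2 -exprS s_moment.
rewrite (semicircle_moment_conv m0) rmorph_sum; apply: eq_bigr => j _.
by rewrite mul1r mulr1 !s_moment rmorphM.
Qed.

Let sd_S : forall t, pgen (range dS) t -> schwinger_dyson (s i) t.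
Proof.
apply: pgen_schwinger_dyson => [_ [j _ <-]//|w hw].
pose G (j : 'I_n) := gen_alg [set (s j : op N)].
pose F (j : 'I_n) : set dpair := if j == i then pgen [set dS i]
  else [set t | G j t.1 /\ t.2 = fun _ _ => 0].
have form := @pgen_form (G i) [set dS i] (@gen_algL _) (@gen_algM _) (@gen_alg1 _).
have form' : forall t, pgen [set dS i] t -> G i t.1 /\ exists L : seq (A * A),
    allP (fun p => G i p.1 /\ G i p.2) L /\
    forall a c, t.2 a c = \sum_(p <- L) tau (a * p.1) * tau (p.2 * c).
  apply: form => u ->; split; first exact: gen_alg_sub.
  by exists (i == i)%:R.
have FF := @free_schwinger_dyson R N _ G F i (s i)
  (fun j => @gen_algL _) (fun j => @gen_algM _) (fun j => @gen_alg1 _)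
  (free_family_prod s_free).
have [l [el hl]] : exists l : seq ('I_n * dpair),
    [seq p.2 | p <- l] = w /\ allP (fun p => F p.1 p.2) l.
  elim: w hw => [_|_ w IH [[j _ <-] /IH[l [<- hl]]]]; first by exists [::].
  exists ((j, dS j) :: l); split=> //; split=> //; rewrite /F /=.
  have [->|ji] := eqVneq j i; first exact: pgen_gen.
  split; first exact: gen_alg_sub.
  by apply/funext => a; apply/funext => c; rewrite /= eq_sym (negPf ji) mul0r.
rewrite -el; apply: FF => //.
- move=> j t; rewrite /F; have [->|ji] := eqVneq j i; last by case.
  by move=> ht; have [] := form' t ht.
- move=> j t u; rewrite /F; have [_|ji] := eqVneq j i; first exact: pgen_mul.
  move=> [Gt t2] [Gu u2]; split; first exact: gen_algM.
  by apply/funext => a; apply/funext => c; rewrite /= t2 u2 addr0.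
- move=> j t; rewrite /F; have [_|ji] := eqVneq j i; first exact: pgen_cen.
  move=> [Gt t2]; split; first by apply: gen_algL => //; apply: gen_alg1.
  by apply/funext => a; apply/funext => c; rewrite /= t2 mulr0 addr0.
- by move=> j t ji; rewrite /F (negPf ji) => -[].
- by move=> t; rewrite /F eqxx => ht; have [] := form' t ht.
- by move=> t; rewrite /F eqxx; apply: sd_single.
- exact: gen_alg_sub.
Qed.

Definition dgens : set dpair := [set t | (exists j, t = dS j) \/ (exists j, t = dX (x j))].

(** [free_schwinger_dyson] is used on two levels: among the algebras of the single [s j] it gives
    [sd_S], and here, with booleans as colours, it is applied to the algebra of all [s j] against
    that of the [x j]. *)
Lemma gaussian_schwinger_dyson : forall t, pgen dgens t -> schwinger_dyson (s i) t.
Proof.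
apply: pgen_schwinger_dyson => [_ [[j ->]|[j ->]]//|w hw].
pose B (b : bool) := if b then range (fun i => s i : op N) else range (fun i => x i : op N).
pose G (b : bool) := gen_alg (B b).
pose F (b : bool) : set dpair := if b then pgen (range dS)
  else [set t | G false t.1 /\ t.2 = fun _ _ => 0].
have form := @pgen_form (G true) (range dS) (@gen_algL _) (@gen_algM _) (@gen_alg1 _).
have form' : forall t, pgen (range dS) t -> G true t.1 /\ exists L : seq (A * A),
    allP (fun p => G true p.1 /\ G true p.2) L /\
    forall a c, t.2 a c = \sum_(p <- L) tau (a * p.1) * tau (p.2 * c).
  apply: form => _ [j _ <-]; split; first by apply: gen_alg_sub; exists j.
  by exists (i == j)%:R.
have [l [el hl]] : exists l : seq (bool * dpair),
    [seq p.2 | p <- l] = w /\ allP (fun p => F p.1 p.2) l.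
  elim: w hw => [_|t w IH [ht /IH[l [<- hl]]]]; first by exists [::].
  case: ht => [[j ->]|[j ->]].
    by exists ((true, dS j) :: l); split=> //; split=> //; apply: pgen_gen; exists j.
  exists ((false, dX (x j)) :: l); split=> //; split=> //; split=> //.
  by apply: gen_alg_sub; exists j.
rewrite -el; apply: (@free_schwinger_dyson R N _ G F true (s i)
  (fun j => @gen_algL _) (fun j => @gen_algM _) (fun j => @gen_alg1 _)
  (free_family_prod sx_free)) => //.
- by move=> [] t; rewrite /F; [move=> ht; have [] := form' t ht|case].
- move=> [] t u; rewrite /F; first exact: pgen_mul.
  move=> [Gt t2] [Gu u2]; split; first exact: gen_algM.
  by apply/funext => a; apply/funext => c; rewrite /= t2 u2 addr0.
- move=> [] t; rewrite /F; first exact: pgen_cen.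
  move=> [Gt t2]; split; first by apply: gen_algL => //; apply: gen_alg1.
  by apply/funext => a; apply/funext => c; rewrite /= t2 mulr0 addr0.
- by move=> [] t //= _ [].
- by move=> t ht; have [] := form' t ht.
- by apply: gen_alg_sub; exists i.
Qed.

End Family.
End GaussianIntegrationByParts.

(** * The variance of an element commuting with the unperturbed variables *)

Section WordPolynomials.
Context {R : realType} {N : tracial_wspace R} (n : nat).
Notation A := (walg N).
Implicit Types (a b c : A) (z : 'I_n -> A) (w : seq 'I_n).

Definition wword z w : A := \prod_(j <- w) z j.

Lemma wword_nil z : wword z [::] = 1.
Proof. by rewrite /wword big_nil. Qed.

Lemma wword_cons z j w : wword z (j :: w) = z j * wword z w.
Proof. by rewrite /wword big_cons. Qed.

Definition wpol z : set A :=
  [set a | exists L : seq (R[i] * seq 'I_n), a = \sum_(p <- L) p.1 *: wword z p.2].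

Lemma wpol_word z w : wpol z (wword z w).
Proof. by exists [:: (1, w)]; rewrite big_seq1 scale1r. Qed.

Lemma wpol_gen z j : wpol z (z j).
Proof. by have := wpol_word z [:: j]; rewrite /wword big_seq1. Qed.

Lemma wpol_wsubalg z : (forall j, star (z j) = z j) -> wsubalg (wpol z).
Proof.
move=> sz.
have wL (c : R[i]) a b : wpol z a -> wpol z b -> wpol z (c *: a + b).
  move=> [L ->] [K ->]; exists ([seq (c * p.1, p.2) | p <- L] ++ K).
  rewrite big_cat big_map scaler_sumr /=; congr (_ + _).
  by apply: eq_bigr => p _; rewrite scalerA.
have w0 : wpol z 0 by exists [::]; rewrite big_nil.
split=> //.
- by have := wpol_word z [::]; rewrite /wword big_nil.
- move=> a b [L ->] [K ->]; rewrite mulr_suml.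
  elim/big_ind: _ => [//|u v hu hv|p _]; first by rewrite -[u]scale1r; apply: wL.
  rewrite mulr_sumr; elim/big_ind: _ => [//|u v hu hv|q _].
    by rewrite -[u]scale1r; apply: wL.
  exists [:: (p.1 * q.1, p.2 ++ q.2)]; rewrite big_seq1 /wword big_cat /=.
  by rewrite -scalerAl -scalerAr scalerA.
- move=> a [L ->]; rewrite raddf_sum /=.
  elim/big_ind: _ => [//|u v hu hv|p _]; first by rewrite -[u]scale1r; apply: wL.
  exists [:: ((p.1)^*%C, rev p.2)]; rewrite big_seq1 starZ; congr (_ *: _) => /=.
  rewrite /wword; elim: (p.2) => [|j w IH]; first by rewrite !big_nil star1.
  by rewrite rev_cons -cats1 big_cat big_seq1 big_cons starM IH sz.
Qed.

Lemma linear_on_wpol z (f : A -> A) :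
  (forall (c : R[i]) a b, f (c *: a + b) = c *: f a + f b) ->
  (forall w, tau (f (wword z w)) = 0) -> forall a, wpol z a -> tau (f a) = 0.
Proof.
move=> fL fw a [L ->].
have f0 : f 0 = 0 by have := fL (-1) 0 0; rewrite scaler0 addr0 scaleN1r addNr.
elim: L => [|p L IH]; first by rewrite big_nil f0 raddf0.
by rewrite big_cons fL raddfD /= tauZ fw mulr0 add0r.
Qed.

(* [sum_i d_i w (y_i (x) 1 - 1 (x) y_i) = w (x) 1 - 1 (x) w], paired with
   [tau (a .) (x) tau (. c)]. *)
Lemma diff_word_telescope z w a c :
  \sum_(i < n) \sum_(p <- diff_word i w)
     (tau (a * wword z p.1 * z i) * tau (wword z p.2 * c)
      - tau (a * wword z p.1) * tau (z i * wword z p.2 * c))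
  = tau (a * wword z w) * tau c - tau a * tau (wword z w * c).
Proof.
elim: w a => [|j w IH] a.
  rewrite big1 => [|i _]; last by rewrite big_nil.
  by rewrite wword_nil mulr1 mul1r subrr.
rewrite (wword_cons z j w).
have -> : tau (a * (z j * wword z w)) * tau c - tau a * tau (z j * wword z w * c) =
    (tau (a * z j) * tau (wword z w * c) - tau a * tau (z j * wword z w * c)) +
    (tau (a * z j * wword z w) * tau c - tau (a * z j) * tau (wword z w * c)).
  by rewrite mulrA; ring.
rewrite -IH.
have h i : \sum_(p <- diff_word i (j :: w))
     (tau (a * wword z p.1 * z i) * tau (wword z p.2 * c)
      - tau (a * wword z p.1) * tau (z i * wword z p.2 * c)) =
  (if i == j then tau (a * z j) * tau (wword z w * c) - tau a * tau (z j * wword z w * c) else 0)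
  + \sum_(p <- diff_word i w)
     (tau (a * z j * wword z p.1 * z i) * tau (wword z p.2 * c)
      - tau (a * z j * wword z p.1) * tau (z i * wword z p.2 * c)).
  rewrite /= big_cat big_map /=; congr (_ + _).
    case: eqP => [->|_]; last by rewrite big_nil.
    by rewrite big_seq1 /= wword_nil mulr1.
  by apply: eq_bigr => p _; rewrite wword_cons !mulrA.
rewrite (eq_bigr _ (fun i _ => h i)) big_split /= -big_mkcond /=; congr (_ + _).
by rewrite big_pred1_eq.
Qed.

End WordPolynomials.

Section CovarianceIdentity.
Context {R : realType} {N : tracial_wspace R} (n : nat).
Notation A := (walg N).
Implicit Types (a b c : A) (w : seq 'I_n).
Variables (x s : 'I_n -> A) (r : R).
Hypothesis s_moment : forall i k, tau (s i ^+ k) = (semicircle_moment k : R)%:C.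
Hypothesis s_free : free_family (fun i => [set (s i : op N)]).
Hypothesis sx_free : free_from (range (fun i => s i : op N)) (range (fun i => x i : op N)).

Definition perturbed i : A := x i + r%:C *: s i.
Notation y := perturbed.

Let dY i j : dpair := dlin r%:C (dS s i j) (dX (x j)).
Let dYw i w := dprod [seq dY i j | j <- w].
Let dXw w := dprod [seq dX (x j) | j <- w].

(** The derivation with respect to [s i] sends [y j] to r delta_ij 1 (x) 1, so on words in [y] it is
    [r] times the free difference quotient. *)
Let dYwE i w : (dYw i w).1 = wword y w /\ forall a c, (dYw i w).2 a c =
  r%:C * \sum_(p <- diff_word i w) tau (a * wword y p.1) * tau (wword y p.2 * c).
Proof.
elim: w => [|j w [IH1 IH2]].
  by split=> [|a c]; rewrite /= ?big_nil ?mulr0// wword_nil.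
split=> /=; first by rewrite -/(dYw i w) IH1 wword_cons [_ *: _ + _]addrC.
move=> a c; rewrite -/(dYw i w) IH1 IH2 addr0 big_cat big_map [RHS]mulrDr /=; congr (_ + _).
  case: eqP => [ij|_]; last by rewrite big_nil !mul0r !mulr0.
  by rewrite big_seq1 /= wword_nil mulr1 mul1r.
congr (_ * _); apply: eq_bigr => p _; rewrite wword_cons mulrA.
by rewrite [_ *: _ + _]addrC.
Qed.

Let dXwE w : dXw w = dX (wword x w).
Proof.
elim: w => [|j w IH]; first by rewrite /dXw /= wword_nil.
rewrite /dXw /= -/(dXw w) IH /dmul /= wword_cons; congr pair.
by apply/funext => a; apply/funext => c; rewrite addr0.
Qed.

Let dYw_pgen i w : pgen (dgens x s i) (dYw i w).
Proof.
elim: w => [|j w IH]; first exact: pgen_one.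
apply: pgen_mul => //; apply: pgen_lin; apply: pgen_gen; first by left; exists j.
by right; exists j.
Qed.

Let dXw_pgen i w : pgen (dgens x s i) (dX (wword x w)).
Proof.
rewrite -dXwE; elim: w => [|j w IH]; first exact: pgen_one.
by apply: pgen_mul => //; apply: pgen_gen; right; exists j.
Qed.

Let sd i := @gaussian_schwinger_dyson R N n x s s_moment s_free sx_free i.

(** This says that [s i / r], projected on the polynomials in [y], is the conjugate variable. *)
Lemma tau_semicircular_word i w : tau (s i * wword y w) =
  r%:C * \sum_(p <- diff_word i w) tau (wword y p.1) * tau (wword y p.2).
Proof.
have [e1 e2] := dYwE i w; have := sd (dYw_pgen i w); rewrite /schwinger_dyson e1 e2 => ->.
by congr (_ * _); apply: eq_bigr => p _; rewrite mul1r mulr1.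
Qed.

Definition comm_sum : A := \sum_(i < n) (y i * s i - s i * y i).
Definition comm_form a : A := a * comm_sum - comm_sum * a.

Let sd3 i t u v : pgen (dgens x s i) t -> pgen (dgens x s i) u -> pgen (dgens x s i) v ->
  tau (s i * (t.1 * (u.1 * v.1))) =
  t.2 1 (u.1 * v.1) + (u.2 t.1 v.1 + v.2 (t.1 * u.1) 1).
Proof.
move=> ht hu hv; have := sd (pgen_mul ht (pgen_mul hu hv)).
by rewrite /schwinger_dyson /= !mulr1 !mul1r.
Qed.

(** Each of the four products in the commutators is brought into the form tau (s_i ...) and
    integrated by parts. The derivatives of [y i] cancel; those of [P] combine into two telescoping
    sums, one with [Z] on the right leg and one with [Z] on the left leg. Each contributes one copy
    of -r Cov(Z, P), whence the factor [2 * r]. *)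
Let covar_word v w : tau (wword x v * (comm_form (wword y w) +
   (2 * r)%:C *: (wword y w - tau (wword y w) *: 1))) = 0.
Proof.
set Z := wword x v; set P := wword y w.
have key i : tau (Z * (P * (y i * s i - s i * y i) - (y i * s i - s i * y i) * P)) =
   r%:C * ((\sum_(p <- diff_word i w) (tau (1 * wword y p.1 * y i) * tau (wword y p.2 * Z)
      - tau (1 * wword y p.1) * tau (y i * wword y p.2 * Z)))
    - \sum_(p <- diff_word i w) (tau (Z * wword y p.1 * y i) * tau (wword y p.2 * 1)
      - tau (Z * wword y p.1) * tau (y i * wword y p.2 * 1))).
  have hX := @dXw_pgen i v; have hY := dYw_pgen i w.
  have hy : pgen (dgens x s i) (dY i i).
    by apply: pgen_lin; apply: pgen_gen; [left|right]; exists i.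
  have [e1 e2] := dYwE i w.
  have ey : (dY i i).1 = y i by rewrite /= addrC.
  have ey2 a c : (dY i i).2 a c = r%:C * (tau a * tau c) by rewrite /= eqxx mul1r addr0.
  have := sd3 hX hY hy; have := sd3 hY hX hy; have := sd3 hy hX hY; have := sd3 hy hY hX.
  rewrite !e1 !ey !e2 !ey2 -/P -/Z [(dX Z).1]/= /= tau1 => hD hC hB hA.
  have -> : tau (Z * (P * (y i * s i - s i * y i) - (y i * s i - s i * y i) * P)) =
     tau (Z * P * y i * s i) - tau (Z * (y i * s i * P)) - tau (Z * P * s i * y i)
     + tau (Z * (s i * y i * P)).
    by rewrite !(mulrBr, mulrBl) !raddfB /= !mulrA; ring.
  have -> : tau (Z * P * y i * s i) = tau (s i * (Z * (P * y i))) by rewrite tauC !mulrA.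
  have -> : tau (Z * (y i * s i * P)) = tau (s i * (P * (Z * y i))).
    by rewrite -mulrA mulrA tauC mulrA.
  have -> : tau (Z * P * s i * y i) = tau (s i * (y i * (Z * P))).
    by rewrite -mulrA tauC !mulrA.
  have -> : tau (Z * (s i * y i * P)) = tau (s i * (y i * (P * Z))).
    by rewrite tauC !mulrA.
  rewrite hA hB hC hD.
  have -> : \sum_(p <- diff_word i w) (tau (1 * wword y p.1 * y i) * tau (wword y p.2 * Z)
      - tau (1 * wword y p.1) * tau (y i * wword y p.2 * Z)) =
     \sum_(p <- diff_word i w) tau (y i * wword y p.1) * tau (wword y p.2 * Z)
     - \sum_(p <- diff_word i w) tau (1 * wword y p.1) * tau (wword y p.2 * (Z * y i)).
    rewrite -sumrB; apply: eq_bigr => p _; rewrite !mul1r tauC.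
    by rewrite -(mulrA (y i)) (tauC (y i) (_ * Z)) mulrA.
  have -> : \sum_(p <- diff_word i w) (tau (Z * wword y p.1 * y i) * tau (wword y p.2 * 1)
      - tau (Z * wword y p.1) * tau (y i * wword y p.2 * 1)) =
     \sum_(p <- diff_word i w) tau (y i * Z * wword y p.1) * tau (wword y p.2 * 1)
     - \sum_(p <- diff_word i w) tau (Z * wword y p.1) * tau (wword y p.2 * y i).
    rewrite -sumrB; apply: eq_bigr => p _; rewrite !mulr1 (tauC _ (y i)) !mulrA.
    by rewrite (tauC (y i)).
  by rewrite (tauC P Z); ring.
have -> : comm_form P = \sum_(i < n) (P * (y i * s i - s i * y i) - (y i * s i - s i * y i) * P).
  by rewrite sumrB -mulr_sumr -mulr_suml.
rewrite mulrDr raddfD /= mulr_sumr raddf_sum /= (eq_bigr _ (fun i _ => key i)).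
rewrite -mulr_sumr sumrB !diff_word_telescope -scalerAr tauZ.
have -> : tau (Z * (P - tau P *: 1)) = tau (Z * P) - tau P * tau Z.
  by rewrite mulrBr raddfB /= -scalerAr tauZ mulr1.
rewrite !mulr1 !mul1r tau1 -/P (tauC P Z) rmorphM /=.
have -> : (2%:C : R[i]) = 2 by rewrite -(rmorph_nat (real_complex R)).
by ring.
Qed.

Hypothesis s_sa : forall i, star (s i) = s i.
Hypothesis x_sa : forall i, star (x i) = x i.

Lemma perturbed_sa i : star (y i) = y i.
Proof. by rewrite raddfD /= starZr s_sa x_sa. Qed.

Lemma l2c_linear_form (B : set A) q : (forall b, B b -> rt (b * q) = 0) ->
  forall a, l2c B a -> rt (a * q) = 0.
Proof.
move=> h a La; apply/eqP; rewrite -normr_eq0 eq_le normr_ge0 andbT.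
apply/ler_addgt0Pr => e e0; rewrite add0r.
have [b Bb hb] := La (e / (n2 q + 1)) ltac:(by rewrite divr_gt0// ltr_wpDl// n2_ge0).
rewrite -[a](subrK b) mulrDl rtD (h _ Bb) addr0 (le_trans (rt_CS _ _))//.
rewrite mulrC (le_trans (ler_wpM2l (n2_ge0 q) hb))//.
by apply: div_succ_mul_le; [exact: ltW|exact: n2_ge0].
Qed.

Lemma comm_form_lin (c : R[i]) a b :
  comm_form (c *: a + b) = c *: comm_form a + comm_form b.
Proof.
rewrite /comm_form mulrDl mulrDr -scalerAl -scalerAr opprD addrACA.
by rewrite -scalerN -scalerDr.
Qed.

Lemma covariance_identity Z P : l2c (wpol x) Z -> wpol y P ->
  rt (Z * (comm_form P + (2 * r)%:C *: (P - tau P *: 1))) = 0.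
Proof.
move=> LZ hP; apply: l2c_linear_form LZ => {}Z hZ.
suff e : tau (Z * (comm_form P + (2 * r)%:C *: (P - tau P *: 1))) = 0 by rewrite /rt e.
pose D a := (2 * r)%:C *: (a - tau a *: 1).
have DL (c : R[i]) a b : D (c *: a + b) = c *: D a + D b.
  rewrite /D [tau (_ + _)]raddfD /= tauZ scalerDl opprD addrACA -scalerA -scalerN -scalerDr (scalerDr (2 * r)%:C).
  by rewrite !scalerA [c * _]mulrC.
apply: (linear_on_wpol (z := y)
  (f := fun P => Z * (comm_form P + (2 * r)%:C *: (P - tau P *: 1)))) hP => [c a b|w].
  by rewrite -!/(D _) comm_form_lin DL addrACA -scalerDr mulrDr scalerAr.
apply: (linear_on_wpol (z := x) (f := fun Z => Z * _)) hZ => [c a b|v].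
  by rewrite mulrDl scalerAl.
exact: covar_word.
Qed.

(** The conditional expectation of s_i b s_i is tau b: in tau (s_i b s_i a) only the second s_i can
    be differentiated. The symmetry of the expression in [a] and [b] lets both be extended from
    words to 2-norm limits one at a time. *)
Lemma semicircle_sandwich i a b : l2c (wpol x) a -> l2c (wpol x) b ->
  rt (a * (s i * b * s i - tau b *: 1)) = 0.
Proof.
have word v w : tau (wword x v * (s i * wword x w * s i - tau (wword x w) *: 1)) = 0.
  have hS : pgen (dgens x s i) (dS s i i) by apply: pgen_gen; left; exists i.
  have := sd3 (dXw_pgen i w) hS (dXw_pgen i v) => /=.
  rewrite eqxx mul1r addr0 add0r => h.
  rewrite mulrBr raddfB /= -scalerAr tauZ mulr1 -!mulrA tauC -!mulrA h.
  by rewrite subrr.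
have sym (u v : A) : tau (u * (s i * v * s i - tau v *: 1)) = tau (v * (s i * u * s i - tau u *: 1)).
  rewrite !mulrBr !raddfB /= -!scalerAr !tauZ !mulr1 [tau v * _]mulrC; congr (_ - _).
  by rewrite tauC -!mulrA tauC -!mulrA tauC -!mulrA.
have lin (v : A) (c : R[i]) (u u' : A) : (c *: u + u') * (s i * v * s i - tau v *: 1) =
    c *: (u * (s i * v * s i - tau v *: 1)) + u' * (s i * v * s i - tau v *: 1).
  by rewrite mulrDl scalerAl.
move=> La Lb; rewrite /rt sym -/(rt _); apply: l2c_linear_form Lb => {}b hb.
rewrite /rt sym -/(rt _); apply: l2c_linear_form La => {}a ha.
suff e : tau (a * (s i * b * s i - tau b *: 1)) = 0 by rewrite /rt e.
apply: (linear_on_wpol (f := fun a => a * (s i * b * s i - tau b *: 1)) (lin b) _ ha) => v.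
rewrite sym.
by apply: (linear_on_wpol (f := fun b => b * (s i * wword x v * s i - tau (wword x v) *: 1))
   (lin _) _ hb) => w.
Qed.

End CovarianceIdentity.

(** * The variance bound at a fixed perturbation *)

Section VarianceBound.
Context {R : realType} {N : tracial_wspace R} (n : nat).
Notation A := (walg N).
Implicit Types (a b c : A) (w : seq 'I_n).
Variables (x s : 'I_n -> A) (r : R).
Hypothesis s_moment : forall i k, tau (s i ^+ k) = (semicircle_moment k : R)%:C.
Hypothesis s_free : free_family (fun i => [set (s i : op N)]).
Hypothesis sx_free : free_from (range (fun i => s i : op N)) (range (fun i => x i : op N)).
Hypothesis s_sa : forall i, star (s i) = s i.
Hypothesis x_sa : forall i, star (x i) = x i.
Hypothesis r_gt0 : 0 < r.
Notation y := (perturbed x s r).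
Variable Z : A.
Hypothesis Z_sa : star Z = Z.
Hypothesis Z_comm : forall i, Z * x i = x i * Z.
Hypothesis Z_l2 : l2c (wpol x) Z.
Variables (K k d : R) (lam : 'I_n -> R) (P0 : A).
Hypothesis s_obnd : forall i, obnd K (s i).
Hypothesis P0_pol : wpol y P0.
Hypothesis P0_near : n2 (Z - P0) <= d.
Hypothesis P0_left : forall G, n2 (P0 * G) <= k * n2 G.
Hypothesis P0_right : forall G, n2 (G * P0) <= k * n2 G.
Hypothesis lam_ge0 : forall i, 0 <= lam i.
Hypothesis s_conj : forall i Q, wpol y Q -> `|rt (s i * Q)| <= lam i * n2 Q.

Let wy := wpol_wsubalg (perturbed_sa r s_sa x_sa).
Let beta i := 2 * k * lam i + 2 * K * d.
Definition variance a := rt (a * a) - rt a ^+ 2.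

Let d_ge0 : 0 <= d.
Proof. exact: le_trans (n2_ge0 _) P0_near. Qed.

Let K_ge0 (i : 'I_n) : 0 <= K.
Proof. by have [] := s_obnd i. Qed.

Let k_ge0 : 0 <= k.
Proof. by have := P0_left 1; rewrite n2_1 !mulr1 => h; exact: le_trans (n2_ge0 _) h. Qed.

Let beta_ge0 i : 0 <= beta i.
Proof. by rewrite addr_ge0// !mulr_ge0// (K_ge0 i). Qed.

(** For the approximant, tau (Q [P0, s_i]) = tau (s_i [Q, P0]) by traciality, and [s_conj] bounds
    its two terms by [k * lam i] each; the remainder [Z - P0] costs [2 * K * d]. Their sum is
    [beta i]. *)
Let commutator_pairing i Q : wpol y Q -> `|rt (Q * (Z * s i - s i * Z))| <= beta i * n2 Q.
Proof.
move=> hQ; pose D := Z - P0.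
have -> : rt (Q * (Z * s i - s i * Z)) =
   rt (s i * (Q * P0)) - rt (s i * (P0 * Q)) + (rt (D * s i * Q) - rt (s i * D * Q)).
  have -> : rt (s i * (Q * P0)) = rt (Q * (P0 * s i)) by rewrite rtC mulrA.
  have -> : rt (s i * (P0 * Q)) = rt (Q * (s i * P0)) by rewrite mulrA rtC.
  rewrite [rt (D * s i * Q)]rtC [rt (s i * D * Q)]rtC -!rtB -rtD; congr rt.
  have eZ : Z = P0 + D by rewrite addrC subrK.
  by rewrite -!mulrBr -mulrDr [in LHS]eZ mulrDl [s i * _]mulrDr opprD addrACA.
rewrite (le_trans (ler_normD _ _))// /beta [leRHS]mulrDl lerD//.
  rewrite (le_trans (ler_normB _ _))//.
  have h1 := s_conj i (wsubM wy hQ P0_pol); have h2 := s_conj i (wsubM wy P0_pol hQ).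
  apply: (le_trans (lerD h1 h2)).
  have := ler_wpM2l (lam_ge0 i) (P0_left Q); have := ler_wpM2l (lam_ge0 i) (P0_right Q).
  lra.
rewrite (le_trans (ler_normB _ _))//.
apply: (le_trans (lerD (rt_CS _ _) (rt_CS _ _))).
have h1 : n2 (D * s i) <= K * d.
  by rewrite (le_trans (n2Mr _ (s_obnd i)))// ler_wpM2l ?(K_ge0 i).
have h2 : n2 (s i * D) <= K * d.
  by rewrite (le_trans (n2Ml _ (s_obnd i)))// ler_wpM2l ?(K_ge0 i).
have := ler_wpM2r (n2_ge0 Q) h1; have := ler_wpM2r (n2_ge0 Q) h2; lra.
Qed.

(** [covariance_identity] as a pairing of commutators. Writing y_i = x_i + r s_i on the left, the
    part with x_i becomes the trace of [Z * comm_form P], since [Z] commutes with x_i; the part with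
    s_i is the sum on the right. *)
Let commutator_identity P : wpol y P ->
  \sum_(i < n) rt ((P * y i - y i * P) * (s i * Z - Z * s i)) =
  r * (\sum_(i < n) rt ((P * s i - s i * P) * (s i * Z - Z * s i))
       - 2 * rt (Z * (P - tau P *: 1))).
Proof.
move=> hP.
have := covariance_identity s_moment s_free sx_free Z_l2 hP.
rewrite mulrDr rtD -scalerAr rtZ => h.
have {h} e : rt (Z * comm_form x s r P) = - (2 * r * rt (Z * (P - tau P *: 1))) by lra.
rewrite mulrBr mulr_sumr [r * (2 * _)]mulrA [r * 2]mulrC -e.
have -> : rt (Z * comm_form x s r P) = \sum_(i < n)
    rt (Z * (P * (x i * s i - s i * x i) - (x i * s i - s i * x i) * P)).
  (* [s i] commutes with itself, so [y_i, s_i] = [x_i, s_i]. *)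
  have e1 : comm_sum x s r = \sum_(i < n) (x i * s i - s i * x i).
    apply: eq_bigr => i _; rewrite /perturbed mulrDl mulrDr -scalerAl -scalerAr.
    by rewrite opprD addrACA subrr addr0.
  by rewrite /comm_form e1 mulr_sumr mulr_suml -sumrB mulr_sumr rt_sum.
rewrite -big_split; apply: eq_bigr => i _ /=.
have -> : P * y i - y i * P = (P * x i - x i * P) + r%:C *: (P * s i - s i * P).
  by rewrite /perturbed mulrDl mulrDr -scalerAl -scalerAr opprD addrACA scalerBr.
rewrite mulrDl rtD -scalerAl rtZ addrC; congr (_ + _).
have e1 : rt (P * x i * (s i * Z)) = rt (Z * (P * (x i * s i))).
  by rewrite mulrA rtC !mulrA.
have e2 : rt (P * x i * (Z * s i)) = rt (Z * (x i * s i * P)).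
  by rewrite -mulrA rtC (mulrA (x i)) -Z_comm !mulrA.
have e3 : rt (x i * P * (s i * Z)) = rt (Z * (P * (s i * x i))).
  by rewrite -mulrA rtC -!mulrA Z_comm [in RHS]rtC !mulrA.
have e4 : rt (x i * P * (Z * s i)) = rt (Z * (s i * x i * P)).
  by rewrite -mulrA rtC -!mulrA rtC !mulrA.
by rewrite !(mulrBl, mulrBr) !rtB e1 e2 e3 e4; ring.
Qed.

(** The squared 2-norm of [Z, s_i]: by freeness tau (Z^2 s_i^2) = tau (Z^2), while tau (Z s_i Z s_i)
    = (tau Z)^2. *)
Let commutator_variance i :
  rt ((Z * s i - s i * Z) * (s i * Z - Z * s i)) = 2 * variance Z.
Proof.
have sw := semicircle_sandwich s_moment s_free sx_free i.
have wx := l2c_wsubalg (wpol_wsubalg x_sa).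
have h1 := sw _ _ (wsubM wx Z_l2 Z_l2) (wsub1 wx).
have h2 := sw _ _ Z_l2 Z_l2.
move: h1 h2; rewrite !mulrBr !rtB tau1 scale1r mulr1 -scalerAr mulr1 tau_sa// rtZ => h1 h2.
have e1 : rt (Z * s i * (s i * Z)) = rt (Z * Z * (s i * 1 * s i)).
  by rewrite mulr1 !mulrA rtC !mulrA.
have e2 : rt (Z * s i * (Z * s i)) = rt (Z * (s i * Z * s i)) by rewrite !mulrA.
have e3 : rt (s i * Z * (s i * Z)) = rt (Z * (s i * Z * s i)) by rewrite rtC !mulrA rtC !mulrA.
have e4 : rt (s i * Z * (Z * s i)) = rt (Z * Z * (s i * 1 * s i)).
  by rewrite mulr1 rtC !mulrA rtC !mulrA.
rewrite !(mulrBl, mulrBr) !rtB e1 e2 e3 e4 /variance expr2; lra.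
Qed.

(** A substitute for the orthogonal projection of [Z], which would lie in L^2 only. Near minimality
    of the distance gives orthogonality up to [e], and comparison with [P0] bounds the distance. *)
Let near_minimizer (e : R) : 0 < e -> exists2 P, wpol y P &
  n2 (Z - P) <= d + e /\ forall Q, wpol y Q -> `|rt (Q * (Z - P))| <= e * n2 Q.
Proof.
move=> e0; pose E := [set n2 (Z - P) ^+ 2 | P in wpol y].
have hE : has_inf E.
  by split; [exists (n2 (Z - P0) ^+ 2), P0|exists 0 => _ [P _ <-]; apply: sqr_ge0].
have [_ [P hP <-] lt] := inf_adherent (exprn_gt0 2 e0) hE; exists P => //.
have infP Q : wpol y Q -> inf E <= n2 (Z - Q) ^+ 2.
  by move=> hQ; apply: ge_inf; [exact: hE.2|exists Q].
split.
  rewrite -ler_sqr ?nnegrE ?n2_ge0// ?addr_ge0 ?(ltW e0)//.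
  have h1 : n2 (Z - P0) ^+ 2 <= d ^+ 2 by rewrite ler_sqr ?nnegrE ?n2_ge0.
  have := infP _ P0_pol; have := mulr_ge0 d_ge0 (ltW e0).
  rewrite sqrrD mulr2n; move: lt h1; lra.
move=> Q hQ.
have hQ' := wsub_star wy hQ.
rewrite -ler_sqr ?nnegrE ?mulr_ge0 ?n2_ge0 ?(ltW e0)// real_normK ?num_real// exprMn.
apply: quad_ge0_discr => [|u]; first exact: sqr_ge0.
have h := infP (P - u%:C *: star Q) (wsubB wy hP (wsubZ wy _ hQ')).
have e1 : n2 (Z - (P - u%:C *: star Q)) ^+ 2 =
   n2 (Z - P) ^+ 2 + 2 * u * rt (Q * (Z - P)) + u ^+ 2 * n2 Q ^+ 2.
  by rewrite -(n2_star Q) opprB addrCA addrC n2sqDZ starK.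
rewrite e1 in h; lra.
Qed.

(* [P] nearly projects [Z] on the polynomials in [y]; as [Z] commutes with [x],
   [P * y i - y i * P] is nearly the projection of [r (Z * s i - s i * Z)]. *)
Theorem variance_bound : 2 * (n%:R - 1) * variance Z <=
  \sum_(i < n) (2 * k * lam i + 2 * K * d) ^+ 2 + (4 * n%:R * K ^+ 2 + 4) * n2 Z * d.
Proof.
have [L L0 hL] : exists2 L : R, 0 <= L & forall i, obnd L (y i).
  have p i : 0 <= projT1 (cid (obnd_ex (y i))) by case: cid => l [].
  exists (\sum_(i < n) projT1 (cid (obnd_ex (y i)))); first by apply: sumr_ge0 => i _; apply: p.
  move=> i; apply: (obnd_le (projT2 (cid (obnd_ex (y i))))).
  by rewrite (bigD1 i)//= lerDl; apply: sumr_ge0 => j _; apply: p.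
(* The part with [n] collects the errors of [low] over all indices, the summand 4 twice that of
   [mid]. *)
pose C := 4 * n%:R * K ^+ 2 + 4.
(* The total coefficient of [e] in the final estimate; it may depend on [r], since [e] is chosen
   afterwards. *)
pose Mc := \sum_(i < n) beta i * (2 * L) / r + C * n2 Z.
have Zn : 0 <= n2 Z by apply: n2_ge0.
have C0 : 0 <= C by rewrite addr_ge0// mulr_ge0 ?sqr_ge0// mulr_ge0.
have Mc0 : 0 <= Mc.
  rewrite addr_ge0 ?mulr_ge0// sumr_ge0// => i _.
  by rewrite divr_ge0 ?(ltW r_gt0)// mulr_ge0// mulr_ge0.
apply/ler_addgt0Pr => e0 e00; pose e := e0 / (Mc + 1).
have ep : 0 < e by rewrite divr_gt0// ltr_wpDl.
have [P hP [Pd Po]] := near_minimizer ep.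
pose D := Z - P; pose G i := P * y i - y i * P.
have yG i : wpol y (G i) by apply: (wsubB wy); apply: (wsubM wy) => //; apply: wpol_gen.
(* By traciality the squared norm of [G i] is tau (Q P) with Q = [y_i, [star (G i)]]. Here tau (Q Z)
   equals r tau ([star (G i)] [Z, s_i]), because [Z] commutes with x_i, and tau (Q (Z - P)) is small
   by near orthogonality. Dividing by the norm of [G i] gives the bound. *)
have Gn i : n2 (G i) <= r * beta i + 2 * L * e.
  have [->|G0] := eqVneq (n2 (G i)) 0.
    by apply: addr_ge0; [exact: mulr_ge0 (ltW r_gt0) (beta_ge0 i)|exact: mulr_ge0 (mulr_ge0 (ler0n _ 2) L0) (ltW ep)].
  have Gp : 0 < n2 (G i) by rewrite lt_def G0 n2_ge0.
  rewrite -(ler_pM2r Gp) -expr2 n2sq.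
  have hs := wsub_star wy (yG i).
  pose Q := y i * star (G i) - star (G i) * y i.
  have hQ : wpol y Q by apply: (wsubB wy); apply: (wsubM wy) => //; apply: wpol_gen.
  have -> : rt (star (G i) * G i) = rt (Q * Z) - rt (Q * (Z - P)).
    rewrite -rtB -mulrBr opprB [Z + _]addrC subrK /Q; move: (star (G i)) => b.
    by rewrite /G mulrBr mulrBl !rtB mulrA rtC !mulrA.
  have -> : rt (Q * Z) = r * rt (star (G i) * (Z * s i - s i * Z)).
    rewrite -rtZ scalerAr scalerBr.
    have -> : r%:C *: (Z * s i) - r%:C *: (s i * Z) = Z * y i - y i * Z.
      rewrite /perturbed mulrDr mulrDl -scalerAl -scalerAr Z_comm opprD addrACA.
      by rewrite subrr add0r.
    by rewrite /Q mulrBl mulrBr !rtB [in RHS]mulrA [in RHS]rtC !mulrA.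
  have h1 := commutator_pairing i hs; rewrite n2_star in h1.
  have h2 := Po _ hQ.
  have h3 : n2 Q <= 2 * L * n2 (G i).
    rewrite (le_trans (n2B _ _))//.
    apply: (le_trans (lerD (n2Ml _ (hL i)) (n2Mr _ (hL i)))).
    by rewrite n2_star; lra.
  have h4 := le_trans h2 (ler_wpM2l (ltW ep) h3).
  have h5 := ler_wpM2l (ltW r_gt0) (le_trans (ler_norm _) h1).
  have h6 : - rt (Q * (Z - P)) <= `|rt (Q * (Z - P))| by rewrite -normrN ler_norm.
  lra.
have up : \sum_(i < n) rt (G i * (s i * Z - Z * s i)) <=
    \sum_(i < n) beta i * (r * beta i + 2 * L * e).
  apply: ler_sum => i _; rewrite -opprB mulrN rtN.
  apply: (le_trans (ler_norm _)); rewrite normrN.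
  by rewrite (le_trans (commutator_pairing i (yG i)))// ler_wpM2l.
have Dn : n2 D <= d + e by [].
have de0 : 0 <= d + e by rewrite addr_ge0// ltW.
(* Replacing [P] by [Z] in [P, s_i] costs at most 2 K (d + e), paired with a commutator of 2-norm at
   most 2 K |Z|_2. *)
have low i : 2 * variance Z - 4 * K ^+ 2 * n2 Z * (d + e) <=
    rt ((P * s i - s i * P) * (s i * Z - Z * s i)).
  have -> : P * s i - s i * P = (Z * s i - s i * Z) - (D * s i - s i * D).
    have eP : P = Z - D by rewrite /D opprB addrC subrK.
    by rewrite [in LHS]eP mulrBl [s i * (_ - _)]mulrBr opprD addrACA -opprD.
  rewrite mulrBl rtB commutator_variance lerD2l lerN2 (le_trans (ler_norm _))//.
  rewrite (le_trans (rt_CS _ _))//.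
  have K0 := K_ge0 i.
  have b1 : n2 (D * s i - s i * D) <= 2 * K * (d + e).
    rewrite (le_trans (n2B _ _))//.
    apply: (le_trans (lerD (n2Mr _ (s_obnd i)) (n2Ml _ (s_obnd i)))).
    by have := ler_wpM2l K0 Dn; lra.
  have b2 : n2 (s i * Z - Z * s i) <= 2 * K * n2 Z.
    rewrite (le_trans (n2B _ _))//.
    by apply: (le_trans (lerD (n2Ml _ (s_obnd i)) (n2Mr _ (s_obnd i)))); lra.
  apply: (le_trans (ler_pM (n2_ge0 _) (n2_ge0 _) b1 b2)).
  by rewrite le_eqVlt; apply/orP; left; apply/eqP; ring.
have mid : rt (Z * (P - tau P *: 1)) <= variance Z + 2 * n2 Z * (d + e).
  have sc a : rt (Z * (tau a *: 1)) = rt Z * rt a.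
    by rewrite -scalerAr mulr1 /rt tauZ (tau_sa Z_sa) mulrC ReZ.
  have eP : P = Z - D by rewrite /D opprB addrC subrK.
  have -> : rt (Z * (P - tau P *: 1)) = variance Z - (rt (Z * D) - rt Z * rt D).
    by rewrite mulrBr rtB sc [in LHS]eP mulrBr !rtB /variance; ring.
  rewrite lerD2l (le_trans (ler_norm _))// normrN (le_trans (ler_normB _ _))//.
  have b1 : `|rt (Z * D)| <= n2 Z * (d + e).
    by rewrite (le_trans (rt_CS _ _))// ler_wpM2l.
  have n1 a : `|rt a| <= n2 a by have := rt_CS a 1; rewrite mulr1 n2_1 mulr1.
  have b2 : `|rt Z * rt D| <= n2 Z * (d + e).
    by rewrite normrM ler_pM// (le_trans (n1 D)).
  lra.
have lowsum : n%:R * (2 * variance Z - 4 * K ^+ 2 * n2 Z * (d + e)) <=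
    \sum_(i < n) rt ((P * s i - s i * P) * (s i * Z - Z * s i)).
  rewrite mulr_natl -[X in _ *+ X](card_ord n) -sumr_const.
  by apply: ler_sum => i _; apply: low.
have {}up : r * (2 * (n%:R - 1) * variance Z - C * n2 Z * (d + e)) <=
    r * (\sum_(i < n) beta i ^+ 2 + e * (\sum_(i < n) beta i * (2 * L) / r)).
  have e1 : \sum_(i < n) beta i * (r * beta i + 2 * L * e) =
      r * (\sum_(i < n) beta i ^+ 2 + e * (\sum_(i < n) beta i * (2 * L) / r)).
    rewrite mulrDr !mulr_sumr -big_split; apply: eq_bigr => i _ /=; field.
    by rewrite gt_eqF.
  rewrite -e1; apply: le_trans up; rewrite (commutator_identity hP) ler_pM2l// /C.
  lra.
rewrite (ler_pM2l r_gt0) in up.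
have fin : e * Mc <= e0 by rewrite mulrC div_succ_mul_le// ltW.
rewrite -/C; move: up fin; rewrite /Mc.
set B2 := \sum_(i < n) beta i ^+ 2.
lra.
Qed.

End VarianceBound.

(** * Conjugate variables *)

Section ConjugateVariables.
Context {R : realType} {N : tracial_wspace R} (n : nat).
Notation A := (walg N).
Variables (y : 'I_n -> A) (Y : 'I_n -> op N).
Hypothesis Yy : forall i, Y i = (y i : op N).

Lemma eval_wordE (w : seq 'I_n) : eval_word Y w = (wword y w : op N).
Proof. by elim: w => [|j w IH] /=; rewrite ?wword_nil// wword_cons Yy IH. Qed.

Lemma eval_polyE (P : ncpoly R n) :
  eval_poly Y P = (mmap (GRing.in_alg A) (fun w : {fmonom 'I_n} => wword y w) P : op N).
Proof.
rewrite /eval_poly /mmap; elim/big_rec2: _ => // w a b _ ->.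
by rewrite eval_wordE mulr_algl.
Qed.

Definition diff_value (i : 'I_n) (w : seq 'I_n) : R[i] :=
  \sum_(p <- diff_word i w) tau (wword y p.1) * tau (wword y p.2).

Lemma trtr_evalE i (P : ncpoly R n) : trtr_eval Y (free_diff i P) =
  mmap idfun (fun w : {fmonom 'I_n} => diff_value i w) P.
Proof.
pose h (p : ({fmonom 'I_n} * {fmonom 'I_n})%type) : R[i] :=
  tw_tr N (eval_word Y p.1) * tw_tr N (eval_word Y p.2).
rewrite -[LHS]/(mmap idfun h (free_diff i P)) /free_diff raddf_sum /=.
apply: eq_bigr => w _; rewrite raddf_sum /diff_value mulr_sumr.
by apply: eq_bigr => p _; rewrite /= mmapU /h /= !eval_wordE.
Qed.

Lemma wpol_eval (Q : A) : wpol y Q -> exists P : ncpoly R n,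
  eval_poly Y P = (Q : op N) /\
  forall i (s : A) (r : R), (forall w, tau (s * wword y w) = r%:C * diff_value i w) ->
    tau (s * Q) = r%:C * trtr_eval Y (free_diff i P).
Proof.
move=> [L ->]; exists (\sum_(p <- L) << p.1 *g FMonom p.2 >>); split.
  rewrite eval_polyE raddf_sum /=; congr wfun; apply: eq_bigr => p _.
  by rewrite mmapU /= mulr_algl.
move=> i s r hs; rewrite trtr_evalE raddf_sum /= mulr_sumr raddf_sum mulr_sumr /=.
by apply: eq_bigr => p _; rewrite mmapU -scalerAr tauZ hs /=; ring.
Qed.

Lemma cvg_norm2 (u : nat -> op N) : L2 (tw_alg N) u -> cvg (norm2 (u k) @[k --> \oo]).
Proof.
move=> [Au cu]; apply/cauchy_cvgP/cauchyP => e e0.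
have [m hm] := cu _ e0; exists (norm2 (u m)); exists m => // k /= mk.
rewrite -ball_normE /ball_ /=; apply: le_lt_trans (hm k m mk (leqnn m)).
pose a := WAlg (Au k); pose b := WAlg (Au m).
rewrite -[norm2 (u m)]/(n2 b) -[norm2 (u k)]/(n2 a) -[norm2 _]/(n2 (a - b)).
rewrite ler_norml; apply/andP; split.
  by have := n2D (a - b) b; rewrite subrK; lra.
by have := n2D (b - a) a; rewrite subrK n2BC; lra.
Qed.

(** tau (s Q) is [r] times the limit of tau (xi_k Q), to which Cauchy-Schwarz applies term by term.
    This inequality is all that is retained of a conjugate variable. *)
Lemma conjugate_variable_bound i (xi : nat -> op N) (s : A) (r : R) : 0 <= r ->
  conjugate_variable Y i xi ->
  (forall w, tau (s * wword y w) = r%:C * diff_value i w) ->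
  forall Q, wpol y Q -> `|rt (s * Q)| <= r * L2norm xi * n2 Q.
Proof.
move=> r0 [[Vxi cxi] hxi] hs Q /wpol_eval[P [eQ hP]].
have Axi k : tw_alg N (xi k).
  apply: (Vxi k); first exact: tw_vN.
  by move=> _ [j _ <-]; rewrite Yy; apply: wfunP.
have cv : cvg (norm2 (xi k) @[k --> \oo]) by apply: cvg_norm2.
rewrite /rt (hP _ _ _ hs) ReZ normrM ger0_norm// -mulrA ler_wpM2l//.
apply/ler_addgt0Pr => e e0.
(* The two limits contribute the errors [d] and [d * n2 Q]. *)
pose d := e / (n2 Q + 1 + 1); have q0 := n2_ge0 Q.
have d0 : 0 < d by rewrite divr_gt0// ltr_wpDl// addr_ge0.
have := hxi P; move: (trtr_eval _ _) => T /cvgrPdist_le/(_ d%:C).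
rewrite ltcR => /(_ d0)[m1 _ h1].
have /cvgrPdist_le/(_ _ d0)[m2 _ h2] := cv.
pose m := maxn m1 m2; pose a := WAlg (Axi m).
have {h1} h1 : `|complex.Re T - rt (a * Q)| <= d.
  have := h1 m (leq_maxl _ _); rewrite /= eQ.
  rewrite -[tw_tr N _]/(tau (a * Q)) -lecR; apply: le_trans.
  rewrite /rt -ReB normc_def lecR -sqrtr_sqr ler_sqrt ?addr_ge0 ?sqr_ge0//.
  by rewrite lerDl sqr_ge0.
have {h2} h2 : n2 a <= L2norm xi + d.
  have := h2 m (leq_maxr _ _); rewrite /= ler_norml => /andP[h _].
  by move: h; rewrite -[norm2 (xi m)]/(n2 a) -/(L2norm xi); lra.
have h3 : `|complex.Re T| <= d + n2 a * n2 Q.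
  rewrite -(subrK (rt (a * Q)) (complex.Re T)) (le_trans (ler_normD _ _))//.
  by rewrite lerD// rt_CS.
apply: (le_trans h3).
have h4 := ler_wpM2r q0 h2.
have h5 : (n2 Q + 1) * d <= e by apply: div_succ_mul_le; rewrite ?addr_ge0// ltW.
lra.
Qed.

End ConjugateVariables.

Lemma L2norm_ge0 (R : realType) (N : tracial_wspace R) (u : nat -> op N) :
  L2 (tw_alg N) u -> 0 <= L2norm u.
Proof.
move=> hu; apply: limr_ge; first exact: cvg_norm2.
by apply: nearW => k; apply: sqrtr_ge0.
Qed.

(** * Free Fisher information of small perturbations *)

Section OperatorPowers.
Context {R : realType} {N : tracial_wspace R}.
Implicit Types a b c G : walg N.

Lemma obndX K a k : obnd K a -> obnd (K ^+ k) (a ^+ k).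
Proof.
move=> h; elim: k => [|k IH]; first by rewrite !expr0; apply: obnd1.
by rewrite !exprS; apply: obndM.
Qed.

Lemma star_expr_sa c k : star c = c -> star (c ^+ k) = c ^+ k.
Proof.
by move=> sc; elim: k => [|k IH]; rewrite ?expr0 ?star1// exprSr starM IH sc -exprS -exprSr.
Qed.

(* Log-convexity of [k |-> n2 (c ^+ k * G)] makes a growth rate above [K]
   persist, against [n2 (c ^+ k * G) <= L * K ^+ k]. *)
Lemma n2_power_contraction c G K : star c = c -> 0 <= K ->
  (forall k, n2 (c ^+ k) <= K ^+ k) -> n2 (c * G) <= K * n2 G.
Proof.
move=> sc K0 hc; pose h k := n2 (c ^+ k * G).
have h0 k : 0 <= h k by apply: n2_ge0.
rewrite -[c]expr1 -[X in K * n2 X]mul1r -[1 as X in K * n2 (X * _)](expr0 c).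
rewrite -/(h 1%N) -/(h 0%N) leNgt; apply/negP => lt.
have conv k : h k.+1 ^+ 2 <= h k * h k.+2.
  rewrite n2sq.
  have -> : star (c ^+ k.+1 * G) * (c ^+ k.+1 * G) = star (c ^+ k * G) * (c ^+ k.+2 * G).
    by rewrite !starM !star_expr_sa// [c ^+ k.+2]exprS {1}exprSr !mulrA.
  by apply: (le_trans (ler_norm _)); apply: rt_CS_star.
have [L [L0 hL]] := obnd_ex G.
have up k : h k <= L * K ^+ k.
  by apply: (le_trans (n2Mr _ (conj L0 hL))); rewrite ler_wpM2l.
have p0 : 0 < h 0%N.
  rewrite lt_def h0 andbT; apply/eqP => e; move: lt; rewrite e mulr0 /h.
  by move: e; rewrite /h expr0 mul1r => /n2_eq0->; rewrite mulr0 n2_0 ltxx.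
pose q := h 1%N / h 0%N.
have qK : K < q by rewrite ltr_pdivlMr.
have q0 : 0 < q by apply: le_lt_trans qK.
have low k : 0 < h k /\ q * h k <= h k.+1.
  elim: k => [|k [IH1 IH2]]; first by split=> //; rewrite divfK// gt_eqF.
  have p : 0 < h k.+1 by apply: lt_le_trans IH2; apply: mulr_gt0.
  split=> //; rewrite -(ler_pM2l IH1); apply: le_trans (conv k).
  by rewrite expr2 mulrCA mulrA ler_wpM2r.
have grow k : q ^+ k * h 0%N <= h k.
  elim: k => [|k IH]; first by rewrite expr0 mul1r.
  rewrite exprS -mulrA; apply: le_trans (low k).2.
  by rewrite ler_wpM2l// ltW.
have [k] := geometric_small L (divr_ge0 K0 (ltW q0)) (e := h 0%N / 2)
  ltac:(by rewrite ltr_pdivrMr ?mul1r) ltac:(by rewrite divr_gt0).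
rewrite expr_div_n mulrA ler_pdivrMr ?exprn_gt0// => g.
have := le_trans (grow k) (le_trans (up k) g); rewrite mulrC ler_pM2r ?exprn_gt0//.
by lra.
Qed.

End OperatorPowers.

Section Embedding.
Context {R : realType} {M N : tracial_wspace R} {emb : op M -> op N}.
Hypothesis hemb : trace_embedding emb.
Implicit Types a b : walg M.

Definition wemb a : walg N := WAlg (emb_alg hemb (wfunP a)).

Lemma wemb_lin (c : R[i]) a b : wemb (c *: a + b) = c *: wemb a + wemb b.
Proof. by apply: walg_ext => x; rewrite /= (emb_lin hemb _ (wfunP a) (wfunP b)). Qed.

Lemma wemb_is_additive : additive wemb.
Proof.
move=> a b; have := wemb_lin (-1) b a.
by rewrite !scaleN1r addrC => ->; rewrite addrC.
Qed.
HB.instance Definition _ := GRing.isAdditive.Build (walg M) (walg N) wemb wemb_is_additive.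

Lemma wembZ (c : R[i]) a : wemb (c *: a) = c *: wemb a.
Proof. by rewrite -[c *: a]addr0 wemb_lin raddf0 addr0. Qed.

Lemma wemb1 : wemb 1 = 1.
Proof. by apply: walg_ext => x; rewrite /= (emb_id hemb). Qed.

Lemma wembM a b : wemb (a * b) = wemb a * wemb b.
Proof. by apply: walg_ext => x; rewrite /= (emb_comp hemb (wfunP a) (wfunP b)). Qed.

Lemma wembX a k : wemb (a ^+ k) = wemb a ^+ k.
Proof. by elim: k => [|k IH]; rewrite ?expr0 ?wemb1// !exprS wembM IH. Qed.

Lemma wemb_star a : wemb (star a) = star (wemb a).
Proof. by apply: walg_ext => x; rewrite /= (emb_adj hemb (wfunP a)). Qed.

Lemma tau_wemb a : tau (wemb a) = tau a.
Proof. exact: (emb_tr hemb (wfunP a)). Qed.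

Lemma n2_wemb a : n2 (wemb a) = n2 a.
Proof. by rewrite !n2E -wemb_star -wembM /rt tau_wemb. Qed.

Lemma variance_wemb a : variance (wemb a) = variance a.
Proof. by rewrite /variance -wembM /rt !tau_wemb. Qed.

(** No operator bound for [wemb a] is given directly. Its square c = [wemb (star a * a)] has powers
    whose 2-norms are computed in [M], so [n2_power_contraction] bounds multiplication by c, and
    Cauchy-Schwarz returns to [wemb a]. *)
Lemma n2_wemb_mull K a G : obnd K a -> n2 (wemb a * G) <= K * n2 G.
Proof.
move=> h; have [K0 _] := h; have h2 := obndM (obnd_star h) h.
rewrite -(@ler_pXn2r _ 2)// ?nnegrE ?mulr_ge0 ?n2_ge0//.
rewrite n2sq starM -mulrA [star (wemb a) * _]mulrA -wemb_star -wembM.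
apply: (le_trans (ler_norm _)); apply: (le_trans (rt_CS_star _ _)).
have -> : (K * n2 G) ^+ 2 = n2 G * ((K * K) * n2 G) by ring.
rewrite ler_wpM2l ?n2_ge0//; apply: n2_power_contraction => [||k].
- by rewrite -wemb_star starM starK.
- exact: mulr_ge0.
- by rewrite -wembX n2_wemb; apply: n2_obnd; apply: obndX.
Qed.

Lemma n2_wemb_mulr K a G : obnd K a -> n2 (G * wemb a) <= K * n2 G.
Proof.
move=> h; rewrite -n2_star starM -wemb_star -[n2 G]n2_star.
by apply: n2_wemb_mull; apply: obnd_star.
Qed.

Lemma wemb_wword n (x : 'I_n -> walg M) w :
  wemb (wword x w) = wword (fun i => wemb (x i)) w.
Proof. by elim: w => [|j w IH]; rewrite ?wword_nil ?wemb1// !wword_cons wembM IH. Qed.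

Lemma wemb_wpol n (x : 'I_n -> walg M) a :
  wpol x a -> wpol (fun i => wemb (x i)) (wemb a).
Proof.
move=> [L ->]; exists L; rewrite raddf_sum.
by apply: eq_bigr => p _; rewrite /= wembZ wemb_wword.
Qed.

Lemma wemb_l2c n (x : 'I_n -> walg M) a :
  l2c (wpol x) a -> l2c (wpol (fun i => wemb (x i))) (wemb a).
Proof.
move=> h e e0; have [b hb ab] := h e e0; exists (wemb b); first exact: wemb_wpol.
by rewrite -raddfB n2_wemb.
Qed.

End Embedding.

Section PerturbedPolynomials.
Context {R : realType} {N : tracial_wspace R} (n : nat).
Variables (x s : 'I_n -> walg N).
Notation y := (perturbed x s).

(** The point is that [C] does not depend on [r]. *)
Lemma perturbed_word_near w : exists C, forall r, 0 <= r -> r <= 1 ->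
  obnd (r * C) (wword (y r) w - wword x w).
Proof.
elim: w => [|j w [C hC]].
  by exists 0 => r _ _; rewrite !wword_nil subrr mulr0; apply: obnd0.
have [a ha] := obnd_ex (x j); have [b hb] := obnd_ex (s j).
have [c hc] := obnd_ex (wword x w).
exists ((a + b) * C + b * c) => r r0 r1.
have -> : wword (y r) (j :: w) - wword x (j :: w) =
    y r j * (wword (y r) w - wword x w) + r%:C *: (s j * wword x w).
  by rewrite !wword_cons mulrBr -addrA; congr (_ + _); rewrite mulrDl opprD scalerAl subrK.
have hy : obnd (a + b) (y r j).
  apply: (obnd_le (obndD ha (obndZ r hb))); rewrite ger0_norm// lerD2l ler_piMl//.
  by case: hb.
apply: (obnd_le (obndD (obndM hy (hC r r0 r1)) (obndZ r (obndM hb hc)))).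
by rewrite ger0_norm// le_eqVlt; apply/orP; left; apply/eqP; ring.
Qed.

Lemma perturbed_pol_near (L : seq (R[i] * seq 'I_n)) : exists2 C, 0 <= C & forall r, 0 <= r -> r <= 1 ->
  obnd (r * C) (\sum_(p <- L) p.1 *: wword (y r) p.2 - \sum_(p <- L) p.1 *: wword x p.2).
Proof.
elim: L => [|[c w] L [C C0 hC]].
  by exists 0 => // r _ _; rewrite !big_nil subrr mulr0; apply: obnd0.
have [D hD] := perturbed_word_near w; have [a ha] := obnd_ex (c *: 1 : walg N).
exists (a * D + C); last first.
  move=> r r0 r1; rewrite !big_cons /= opprD addrACA -scalerBr.
  rewrite -[X in c *: X]mul1r scalerAl.
  apply: (obnd_le (obndD (obndM ha (hD r r0 r1)) (hC r r0 r1))).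
  by rewrite le_eqVlt; apply/orP; left; apply/eqP; ring.
have [h _] := hD 1 ler01 (lexx 1); rewrite mul1r in h.
by rewrite addr_ge0// mulr_ge0//; case: ha.
Qed.

End PerturbedPolynomials.

Section CentralVariance.
Context {R : realType} {M N : tracial_wspace R} {emb : op M -> op N}.
Hypothesis hemb : trace_embedding emb.
Variables (n : nat) (xM : 'I_n -> walg M) (s : 'I_n -> walg N).
Notation x := (fun i => wemb hemb (xM i)).
Notation y := (perturbed x s).
Hypothesis s_moment : forall i k, tau (s i ^+ k) = (semicircle_moment k : R)%:C.
Hypothesis s_free : free_family (fun i => [set (s i : op N)]).
Hypothesis sx_free : free_from (range (fun i => s i : op N)) (range (fun i => x i : op N)).
Hypothesis s_sa : forall i, star (s i) = s i.
Hypothesis xM_sa : forall i, star (xM i) = xM i.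

Variables (Z : walg M) (k0 : R).
Hypothesis Z_sa : star Z = Z.
Hypothesis Z_comm : forall i, Z * xM i = xM i * Z.
Hypothesis Z_l2 : l2c (wpol xM) Z.
Hypothesis Z_obnd : obnd k0 Z.

(** Kaplansky's theorem is applied in [M], where the bound of [Z] is known. The same noncommutative
    polynomial is then evaluated at [y] instead of [x], with an operator error of order [r]. One [e]
    comes from the density theorem, the other from this substitution. *)
Lemma perturbed_approximation (e : R) : 0 < e -> exists2 r0, 0 < r0 & forall r, 0 <= r -> r <= r0 ->
  exists P0, [/\ wpol (y r) P0, n2 (wemb hemb Z - P0) <= 2 * e,
    forall G, n2 (P0 * G) <= (k0 + 2 * e) * n2 G &
    forall G, n2 (G * P0) <= (k0 + 2 * e) * n2 G].
Proof.
move=> e0.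
have [a [[L aE] ha Za]] := kaplansky (wpol_wsubalg xM_sa) Z_sa Z_obnd Z_l2 e0.
have [C C0 hC] := perturbed_pol_near x s L.
have ae : wemb hemb a = \sum_(p <- L) p.1 *: wword x p.2.
  by rewrite aE raddf_sum; apply: eq_bigr => p _; rewrite /= wembZ wemb_wword.
pose r0 := Num.min 1 (e / (C + 1)).
exists r0 => [|r r0' rr]; first by rewrite lt_min ltr01 divr_gt0// ltr_wpDl.
exists (\sum_(p <- L) p.1 *: wword (y r) p.2).
have [r1 re] : r <= 1 /\ r <= e / (C + 1) by move: rr; rewrite le_min => /andP[].
have := hC r r0' r1; rewrite -ae; set P0 := \sum_(p <- L) _ => hP.
have {}hP : obnd e (P0 - wemb hemb a).
  apply: (obnd_le hP); apply: le_trans (div_succ_mul_le (ltW e0) C0).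
  by rewrite mulrC ler_wpM2l.
have [f0 _] := hP; have [g0 _] := ha.
split.
- by exists L.
- apply: (le_trans (n2_tri (wemb hemb a) _ _)); rewrite -raddfB n2_wemb n2BC.
  by have := n2_obnd hP; rewrite n2BC; have := Za; rewrite n2BC; lra.
- move=> G; rewrite -[P0](subrK (wemb hemb a)) mulrDl (le_trans (n2D _ _))//.
  have -> : k0 + 2 * e = e + (k0 + e) by ring.
  by rewrite [leRHS]mulrDl; apply: lerD; [exact: n2Ml | exact: n2_wemb_mull].
- move=> G; rewrite -[P0](subrK (wemb hemb a)) mulrDr (le_trans (n2D _ _))//.
  have -> : k0 + 2 * e = e + (k0 + e) by ring.
  by rewrite [leRHS]mulrDl; apply: lerD; [exact: n2Mr | exact: n2_wemb_mulr].
Qed.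

(** [r0] is chosen before [lam], which will be [r] times the norms of the conjugate variables and
    has no a priori bound. Hence the error is allowed to be proportional to the sum of the squares
    of [lam]. *)
Lemma central_variance_small (d : R) : 0 < d -> exists2 r0, 0 < r0 &
  forall r (lam : 'I_n -> R), 0 < r -> r <= r0 -> (forall i, 0 <= lam i) ->
  (forall i Q, wpol (y r) Q -> `|rt (s i * Q)| <= lam i * n2 Q) ->
  2 * (n%:R - 1) * variance Z <= (4 * k0 ^+ 2 + d) * \sum_(i < n) lam i ^+ 2 + d.
Proof.
move=> d0; have [k00 _] := Z_obnd.
have [K K0 hK] : exists2 K, 0 <= K & forall i, obnd K (s i).
  have /choice[f hf] : forall i, exists K, obnd K (s i) by move=> i; apply: obnd_ex.
  have f0 i : 0 <= f i by case: (hf i).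
  exists (\sum_i f i); first exact: sumr_ge0.
  move=> i; apply: (obnd_le (hf i)); rewrite (bigD1 i)//= lerDl.
  by apply: sumr_ge0.
(* [C1] collects the coefficients of [e] multiplying the sum of [lam i ^+ 2], and [C2] those that do
   not involve [lam]. *)
pose C1 := 16 * (k0 + 1) + 8 * (k0 + 2) * K.
pose C2 := n%:R * (8 * (k0 + 2) * K + 16 * K ^+ 2) + 2 * (4 * n%:R * K ^+ 2 + 4) * n2 Z.
have C10 : 0 <= C1 by rewrite addr_ge0// !mulr_ge0// addr_ge0.
have C20 : 0 <= C2.
  by rewrite addr_ge0 ?mulr_ge0 ?addr_ge0 ?mulr_ge0 ?sqr_ge0 ?addr_ge0 ?n2_ge0.
pose e := Num.min 1 (d / (C1 + C2 + 1)).
have e0 : 0 < e by rewrite lt_min ltr01 divr_gt0// ltr_wpDl// addr_ge0.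
have e1 : e <= 1 by rewrite ge_min lexx.
have eC : (C1 + C2) * e <= d.
  apply: le_trans (div_succ_mul_le (ltW d0) (addr_ge0 C10 C20)).
  by apply: ler_wpM2l; [exact: addr_ge0 | rewrite /e ge_min lexx orbT].
have [r0 r00 h] := perturbed_approximation e0; exists r0 => // r lam rp rr lam0 hlam.
have [P0 [p1 p2 p3 p4]] := h r (ltW rp) rr.
have x_sa i : star (x i) = x i by rewrite -wemb_star xM_sa.
have := variance_bound s_moment s_free sx_free s_sa x_sa rp (Z := wemb hemb Z)
  ltac:(by rewrite -wemb_star Z_sa) (fun i => ltac:(by rewrite -!wembM Z_comm))
  (wemb_l2c hemb Z_l2) hK p1 p2 p3 p4 lam0 hlam.
rewrite variance_wemb n2_wemb; set V := _ * variance Z; move: V => V hV.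
apply: (le_trans hV).
set Lam := \sum_(i < n) lam i ^+ 2.
have Lam0 : 0 <= Lam by apply: sumr_ge0 => i _; apply: sqr_ge0.
have c1 : C1 * e <= d by apply: le_trans eC; rewrite ler_wpM2r ?(ltW e0)// lerDl.
have sum_le : \sum_(i < n) (2 * (k0 + 2 * e) * lam i + 2 * K * (2 * e)) ^+ 2 <=
    (4 * k0 ^+ 2 + C1 * e) * Lam + n%:R * ((8 * (k0 + 2) * K + 16 * K ^+ 2) * e).
  have -> : n%:R * ((8 * (k0 + 2) * K + 16 * K ^+ 2) * e) =
      \sum_(i < n) ((8 * (k0 + 2) * K + 16 * K ^+ 2) * e).
    by rewrite sumr_const card_ord mulr_natl.
  rewrite mulr_sumr -big_split /=; apply: ler_sum => i _.
  have l0 := lam0 i; move: (lam i) l0 => l l0.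
  have ee : e ^+ 2 <= e by rewrite expr2 ler_piMl// ltW.
  have kk : (k0 + 2 * e) * e <= (k0 + 2) * e by rewrite ler_wpM2r ?(ltW e0)//; lra.
  (* Absorbs the cross terms, linear in [lam i], into the quadratic and the constant ones. *)
  have ll : 2 * l <= l ^+ 2 + 1 by have := sqr_ge0 (l - 1); rewrite sqrrB1 -mulr_natl; lra.
  have t1 : (k0 + 2 * e) * e * K * (2 * l) <= (k0 + 2) * e * K * (l ^+ 2 + 1).
    apply: ler_pM => //; last by rewrite ler_wpM2r.
      by rewrite !mulr_ge0 ?addr_ge0 ?mulr_ge0 ?(ltW e0).
    by rewrite mulr_ge0.
  have t2 : e ^+ 2 * l ^+ 2 <= e * l ^+ 2 by rewrite ler_wpM2r ?sqr_ge0.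
  have t3 : e ^+ 2 * K ^+ 2 <= e * K ^+ 2 by rewrite ler_wpM2r ?sqr_ge0.
  rewrite /C1; lra.
have c1L : C1 * e * Lam <= d * Lam - C2 * e * Lam.
  by rewrite -mulrBl ler_wpM2r//; lra.
have : C1 * e * Lam <= d * Lam by rewrite ler_wpM2r.
have c2 : C2 * e <= d by apply: le_trans eC; rewrite ler_wpM2r ?(ltW e0)// lerDr.
by move: sum_le c2; rewrite /C2; lra.
Qed.

(** With lam_i = r |xi_i|_2 and r = sqrt t the sum of squares is t times the Fisher information. If
    a conjugate variable is missing, the right-hand side is infinite. *)
Lemma central_variance_fisher (d : R) : 0 < d -> exists2 t0, 0 < t0 & forall t, 0 < t -> t <= t0 ->
  ((2 * (n%:R - 1) * variance Z - d)%:E <= (4 * k0 ^+ 2 + d)%:E *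
    (t%:E * free_fisher (fun i => (emb (xM i) + (Num.sqrt t)%:C *: (s i : op N))%R)))%E.
Proof.
move=> d0; have [r0 r00 h] := central_variance_small d0.
exists (r0 ^+ 2) => [|t t0 tr]; first exact: exprn_gt0.
have k0d : 0 < 4 * k0 ^+ 2 + d by rewrite ltr_wpDl// mulr_ge0// sqr_ge0.
pose r := Num.sqrt t; have rp : 0 < r by rewrite sqrtr_gt0.
have rr : r <= r0 by rewrite -[r0]ger0_norm ?(ltW r00)// -sqrtr_sqr ler_sqrt// sqr_ge0.
pose Y (i : 'I_n) : op N := emb (xM i) + r%:C *: (s i : op N).
rewrite -[X in free_fisher X]/Y /free_fisher; case: asboolP => [hxi|_]; last by rewrite !gt0_muley ?lte_fin// leey.
rewrite -!EFinM lee_fin.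
pose xi i := xget (fun=> 0) [set xi | conjugate_variable Y i xi].
have hc i : conjugate_variable Y i (xi i) by have [u hu] := hxi i; apply: xgetPex; exists u.
have Yy i : Y i = (y r i : op N) by [].
have x_sa i : star (x i) = x i by rewrite -wemb_star xM_sa.
have L20 i : 0 <= L2norm (xi i).
  apply: L2norm_ge0; have [[h1 h2] _] := hc i; split=> // k.
  by apply: (h1 k); [exact: tw_vN | move=> _ [j _ <-]; rewrite Yy; apply: wfunP].
have := h r (fun i => r * L2norm (xi i)) rp rr (fun i => mulr_ge0 (ltW rp) (L20 i)).
move=> /(_ (fun i Q => conjugate_variable_bound Yy (ltW rp) (hc i)
  (tau_semicircular_word r s_moment s_free sx_free i) (Q := Q))).
have -> : \sum_(i < n) (r * L2norm (xi i)) ^+ 2 = t * \sum_(i < n) L2norm (xi i) ^+ 2.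
  by rewrite mulr_sumr; apply: eq_bigr => i _; rewrite exprMn sqr_sqrtr// ltW.
by rewrite lerBlDr.
Qed.

End CentralVariance.

(** * Passage to the limit inferior *)

Lemma limf_einf_right_ge (R : realType) (f : R -> \bar R) (c : \bar R) (t0 : R) : 0 < t0 ->
  (forall t, 0 < t -> t <= t0 -> (c <= f t)%E) -> (c <= limf_einf f 0^'+)%E.
Proof.
move=> tp h; rewrite limf_einfE; apply: ereal_sup_ge.
exists (ereal_inf (f @` [set t | 0 < t /\ t <= t0])).
  exists [set t | 0 < t /\ t <= t0] => //.
  near=> t; split; first by near: t; exact: nbhs_right_gt.
  by near: t; exact: nbhs_right_le.
by apply: le_ereal_inf_tmp => _ [t [t1 t2] <-]; apply: h.
Unshelve. all: by end_near.
Qed.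

Lemma subee_fin (R : realType) (a : R) (x : \bar R) : x != -oo%E -> (a%:E - (a%:E - x))%E = x.
Proof. by case: x => [x| |] //= _; rewrite -!EFinB; congr _%:E; ring. Qed.

Section Inequality.
Context {R : realType} {M : tracial_wspace R} (n : nat).
Hypothesis hn : (2 <= n)%N.
Variable X : 'I_n -> op M.
Hypothesis hX : forall i, tw_alg M (X i) /\ selfadjoint (X i).
Context {N : tracial_wspace R} {emb : op M -> op N}.
Hypothesis hemb : trace_embedding emb.
Variable S : 'I_n -> op N.
Hypothesis hS : free_semicircular_family S.
Hypothesis hSX : free_from (range S) (range (emb \o X)).

Let x i : walg M := WAlg (hX i).1.
Let s i : walg N := WAlg (let: And3 h _ _ := hS.1 i in h).

Lemma fisher_ge0 (Y : 'I_n -> op N) : (0 <= free_fisher Y)%E.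
Proof.
rewrite /free_fisher; case: asboolP => _; last exact: leey.
by rewrite lee_fin sumr_ge0// => i _; apply: sqr_ge0.
Qed.

Notation L := (limf_einf (fun t : R =>
  t%:E * free_fisher (fun i => (emb \o X) i + (Num.sqrt t)%:C *: S i)%R)%E 0^'+).

Lemma liminf_fisher_ge0 : (0 <= L)%E.
Proof.
apply: (limf_einf_right_ge ltr01) => t t0 _.
by apply: mule_ge0; [rewrite lee_fin ltW | exact: fisher_ge0].
Qed.

Lemma codimension_liminf : (n%:R%:E - delta_star (emb \o X) S)%E = L.
Proof.
rewrite /delta_star; apply: subee_fin.
by apply/eqP => e; have := liminf_fisher_ge0; rewrite e.
Qed.

Lemma center_variance (Z : walg M) K : op_center (vN_gen (range X)) (Z : op M) -> star Z = Z ->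
  obnd K Z ->
  ((variance Z)%:E <= 2%:E * (L / (n%:R - 1)%:E) * (K ^+ 2)%:E)%E.
Proof.
move=> [WZ ZC] sZ hK; have [K0 _] := hK.
have n1 : 0 < n%:R - 1 :> R by rewrite subr_gt0 ltr1n.
have x_sa i : star (x i) = x i by apply/selfadjointP; case: (hX i).
have s_sa i : star (s i) = s i by apply/selfadjointP; case: (hS.1 i).
have s_moment i k : tau (s i ^+ k) = (semicircle_moment k : R)%:C.
  have [_ _ /(_ k) <-] := hS.1 i; congr (tw_tr N _); apply: funext => v.
  by elim: k => [|k IH]; rewrite ?expr0// exprS wmulE IH.
have Zx i : Z * x i = x i * Z.
  apply: walg_ext => v; have := ZC (X i); move=> /(_ _)/(congr1 (fun T => T v)); apply.
  by move=> B _ hB; apply: hB; exists i.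
have Zl : l2c (wpol x) Z.
  have [|t Lt e] := vN_gen_l2c (wpol_wsubalg x_sa) _ WZ.
    by move=> _ [i _ <-]; exists (x i) => //; apply: wpol_gen.
  by have -> : Z = t by apply: walg_ext => v; rewrite e.
have bound (d : R) : 0 < d ->
    (((2 * (n%:R - 1) * variance Z - d) / (4 * K ^+ 2 + d))%:E <= L)%E.
  move=> d0.
  have kd : 0 < 4 * K ^+ 2 + d by rewrite ltr_wpDl// mulr_ge0// sqr_ge0.
  have [t0 t00 h] := central_variance_fisher (hemb := hemb) (xM := x) (s := s) s_moment hS.2 hSX
    s_sa x_sa sZ Zx Zl hK d0.
  apply: (limf_einf_right_ge t00) => t tp tt; have := h t tp tt.
  by rewrite [_ / _]mulrC EFinM lee_pdivrMl.
have L0 := liminf_fisher_ge0.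
rewrite inver (negPf (lt0r_neq0 n1)).
move: bound L0; set l := L; case: l => [l| |] // bound L0; last first.
  (* Since [+oo * 0 = 0], an infinite limit inferior does not settle the case [K = 0]; there [Z]
     itself is zero. *)
  have [K00|K1] := eqVneq K 0.
    have -> : Z = 0.
      by apply: obnd_small => e e0; apply: (obnd_le hK); rewrite K00 ltW.
    by rewrite K00 /variance mul0r expr0n mule0 /rt raddf0 expr0n subr0.
  have i0 : (0 < ((n%:R - 1)^-1)%:E :> \bar R)%E by rewrite lte_fin invr_gt0.
  have k2 : (0 < (K ^+ 2)%:E)%E by rewrite lte_fin exprn_gt0// lt_def K1.
  by rewrite gt0_mulye// gt0_muley ?lte_fin// gt0_mulye// leey.
rewrite -!EFinM lee_fin.
have V : 2 * (n%:R - 1) * variance Z <= 4 * K ^+ 2 * l.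
  (* The errors [d] and [d * l] add up to [e]. *)
  apply/ler_addgt0Pr => e e0; pose d := e / (l + 1).
  have l0 : 0 <= l by rewrite -lee_fin.
  have l1 : 0 < l + 1 by rewrite ltr_wpDl.
  have d0 : 0 < d by rewrite divr_gt0.
  have := bound d d0; rewrite lee_fin ler_pdivrMr ?ltr_wpDl ?mulr_ge0 ?sqr_ge0//.
  have de : d * (l + 1) = e by rewrite divfK// gt_eqF.
  by rewrite -de; lra.
have -> : 2 * (l / (n%:R - 1)) * K ^+ 2 = (2 * l * K ^+ 2) / (n%:R - 1) by ring.
by rewrite ler_pdivlMr//; lra.
Qed.

End Inequality.

(** * Central projections *)

Section VonNeumannSubalgebra.
Context {R : realType} {M : tracial_wspace R}.
Notation A := (walg M).
Notation H := (tw_hilbert M).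
Implicit Types a b c d : A.

(** The infimum is attained: each quotient |a x| / |x| is a lower bound of the admissible
    constants. *)
Lemma obnd_opnorm a : obnd (opnorm (a : op M)) a.
Proof.
pose E := [set K : R | 0 <= K /\ forall x, `|a x| <= K%:C * `|x|].
have E0 : E !=set0.
  have [K [K0 hK]] := obnd_ex a; exists K; split=> // x.
  by rewrite !hnormE -rmorphM lecR.
split; first by apply: lb_le_inf => // K [].
move=> x; have [x0|x0] := eqVneq (hnorm x) 0.
  have [K [_ hK]] := obnd_ex a.
  by rewrite x0 mulr0; have := hK x; rewrite x0 mulr0.
rewrite -ler_pdivrMr ?lt_def ?x0 ?hnorm_ge0//; apply: lb_le_inf => // K [K0 hK].
rewrite ler_pdivrMr ?lt_def ?x0 ?hnorm_ge0//.
by have := hK x; rewrite !hnormE -rmorphM lecR.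
Qed.

Lemma norm2_variance a : star a = a ->
  norm2 ((a : op M) - tw_tr M a *: (idfun : op M)) ^+ 2 = variance a.
Proof.
move=> sa; rewrite -[norm2 _]/(n2 (a - tau a *: 1)) tau_sa// n2sq raddfB /= starZr star1 sa.
rewrite mulrBl !mulrBr !mulr_algl mulr_algr !rtB !rtZ rt1 /variance.
ring.
Qed.

Lemma vN_gen_sub (P : set (op M)) : P `<=` tw_alg M -> vN_gen P `<=` tw_alg M.
Proof. by move=> h T hT; apply: (hT _ (tw_vN M)). Qed.

Lemma vN_gen_von_neumann (P : set (op M)) : P `<=` tw_alg M -> von_neumann (vN_gen P).
Proof.
move=> hP; split; first split.
- by move=> T /(vN_gen_sub hP); apply: (usa_bounded walg_usa).
- by move=> B [hB _] _; apply: (usa_id hB).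
- by move=> c T U hT hU B vB PB; have [hB _] := vB; apply: (usa_lin hB); [exact: hT|exact: hU].
- by move=> T U hT hU B vB PB; have [hB _] := vB; apply: (usa_comp hB); [exact: hT|exact: hU].
(* Every von Neumann algebra in the intersection supplies an adjoint of [T]; by uniqueness they all
   coincide with [star t]. *)
- move=> T hT; pose t := WAlg (vN_gen_sub hP hT); exists (star t : H -> H); last exact: (starP t).
  move=> B vB PB; have [hB _] := vB; have [U BU TU] := usa_star hB (hT B vB PB).
  by rewrite wfun_star (adj_eq TU).
- move=> T bT h B vB PB; have [_ wB] := vB; apply: wB => // F e e0.
  by have [U hU hF] := h F e e0; exists U => //; apply: hU.
Qed.

Variable W : set (op M).
Hypothesis W_vN : von_neumann W.
Hypothesis W_sub : W `<=` tw_alg M.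

Definition central : set A := [set a | op_center W (a : op M)].

Lemma centralC a T (WT : W T) : central a -> a * WAlg (W_sub WT) = WAlg (W_sub WT) * a.
Proof. by move=> [_ h]; apply: walg_ext => v; apply: (congr1 (fun U => U v) (h _ WT)). Qed.

Lemma centralP a : W a -> (forall T (WT : W T), a * WAlg (W_sub WT) = WAlg (W_sub WT) * a) ->
  central a.
Proof. by move=> Wa h; split=> // T WT; apply: (congr1 (@wfun _ _) (h _ WT)). Qed.

Lemma W_star T : W T -> W (adj T).
Proof.
by have [hW _] := W_vN; move=> /(usa_star hW)[U WU TU]; rewrite (adj_eq TU).
Qed.

Lemma central_wsubalg : wsubalg central.
Proof.
have [hW _] := W_vN; split.
- by apply: centralP => [|T WT]; [exact: (usa_id hW) | rewrite mul1r mulr1].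
- move=> z a b ca cb; apply: centralP => [|T WT].
    by case: ca => Wa _; case: cb => Wb _; apply: (usa_lin hW).
  by rewrite mulrDl mulrDr -scalerAl -scalerAr !centralC.
- move=> a b ca cb; apply: centralP => [|T WT].
    by case: ca => Wa _; case: cb => Wb _; apply: (usa_comp hW).
  by rewrite -mulrA centralC// !mulrA centralC.
- move=> a ca; apply: centralP => [|T WT].
    by case: ca => Wa _; apply: W_star.
  apply: (can_inj starK); rewrite !starM starK.
  have -> : star (WAlg (W_sub WT)) = WAlg (W_sub (W_star WT)) by apply: walg_ext.
  by rewrite centralC.
Qed.

Definition central_projection d := [/\ central d, star d = d & d * d = d].

Lemma central_mulC a b : central a -> central b -> a * b = b * a.
Proof. by move=> ca [Wb _]; have := centralC Wb ca; congr (_ * _ = _ * _); apply: walg_ext. Qed.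

Lemma projection_unit_interval d : star d = d -> d * d = d -> unit_interval d.
Proof.
move=> sd dd; split=> //; first by rewrite -dd -{1}sd; apply: wle_star_mul.
apply/wle_subr.
have -> : 1 - d = star (1 - d) * (1 - d).
  by rewrite raddfB /= star1 sd mulrBl mul1r mulrBr mulr1 dd subrr subr0.
exact: wle_star_mul.
Qed.

Lemma central_projectionC d : central_projection d -> central_projection (1 - d).
Proof.
move=> [cd sd dd]; split.
- exact: (wsubB central_wsubalg (wsub1 central_wsubalg) cd).
- by rewrite raddfB /= star1 sd.
- by rewrite mulrBl mul1r mulrBr mulr1 dd subrr subr0.
Qed.

Lemma central_projectionM d e : central_projection d -> central_projection e ->
  central_projection (d * e).
Proof.
move=> [cd sd dd] [ce se ee]; split.
- exact: (wsubM central_wsubalg).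
- by rewrite starM sd se central_mulC.
- by rewrite mulrA -[d * e * d]mulrA (central_mulC ce cd) mulrA dd -mulrA ee.
Qed.

Lemma central_projectionD d e : central_projection d -> central_projection e -> d * e = 0 ->
  central_projection (d + e).
Proof.
move=> [cd sd dd] [ce se ee] de; split.
- exact: (wsubD central_wsubalg).
- by rewrite raddfD /= sd se.
- by rewrite mulrDl !mulrDr (central_mulC ce cd) de dd ee addr0 add0r.
Qed.

(** For w = (1 - e) v one has |d w|^2 = <d w, w> <= <e w, w> = 0. *)
Lemma central_projection_le d e : central_projection d -> central_projection e -> wle d e ->
  d * e = d.
Proof.
move=> [cd sd dd] [ce se ee] de; apply/eqP; rewrite -subr_eq0; apply/eqP.
apply: walg_ext => v; apply: hnorm_eq0; apply/eqP; rewrite -sqrf_eq0 eq_le sqr_ge0 andbT.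
have -> : d * e - d = - (d * (1 - e)) by rewrite mulrBr mulr1 opprB.
rewrite woppE hnormN wmulE -ripxx -rip_sa// -wmulE dd.
apply: (le_trans (de _)); rewrite -wmulE mulrBr mulr1 ee subrr wzeroE rip0l.
exact: lexx.
Qed.

(** Commutation and idempotence are closed conditions for the 2-norm, in which [s] is a limit of
    [D], and faithfulness turns a vanishing 2-norm into an equality. Membership in [W] uses strong
    convergence and weak closedness instead. *)
Lemma central_projection_sup (D : set A) s : D `<=` central_projection -> wchain D ->
  chain_sup D s -> unit_interval s -> central_projection s.
Proof.
move=> DP Dc hs s01; have ss := chain_sup_sa hs.
have near (e : R) : 0 < e -> exists2 d, D d & n2 (s - d) <= e.
  move=> e0; have [d hd /(_ _ hd (wle_refl _)) h] := chain_sup_rt hs (exprn_gt0 2 e0).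
  exists d => //; rewrite -ler_sqr ?nnegrE ?n2_ge0 ?(ltW e0)//; apply: le_trans h.
  rewrite -rtB; apply: unit_interval_n2; apply: unit_interval_sub => //.
    by have [_ sd dd] := DP _ hd; apply: projection_unit_interval.
  exact: (chain_sup_ub hs).
have near0 (a : A) (K : R) : 0 <= K -> (forall d, D d -> n2 a <= K * n2 (s - d)) -> a = 0.
  move=> K0 h; apply: n2_eq0; apply/eqP; rewrite eq_le n2_ge0 andbT.
  apply/ler_addgt0Pr => e e0; rewrite add0r.
  have [d hd nd] := near (e / (K + 1)) ltac:(by rewrite divr_gt0// ltr_wpDl).
  apply: (le_trans (h d hd)); apply: le_trans (div_succ_mul_le (ltW e0) K0).
  by rewrite ler_wpM2l.
have strong (F : seq H) (e : R) : 0 < e -> exists2 d, D d & forall d', D d' -> wle d d' ->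
    forall v, v \in F -> hnorm (s v - d' v) <= e.
  move=> e0; elim: F => [|v F [d hd IH]].
    by have [d hd _] := chain_sup_sot hs 0 e0; exists d.
  have [c hc IHc] := chain_sup_sot hs v e0.
  have [dc|cd] := Dc _ _ hd hc.
    exists c => // d' hd' cd' u; rewrite inE => /predU1P[->|]; first exact: IHc.
    by apply: IH => //; apply: wle_trans cd'.
  exists d => // d' hd' dd' u; rewrite inE => /predU1P[->|]; last exact: IH.
  by apply: IHc => //; apply: wle_trans dd'.
split => //.
- apply: centralP => [|T WT].
    have [hW wc] := W_vN; apply: wc; first by apply: (usa_bounded walg_usa); apply: wfunP.
    move=> F e e0; pose k := \sum_(p <- F) hnorm p.2 + 1.
    have k0 : 0 < k by rewrite ltr_wpDl// sumr_ge0// => p _; apply: hnorm_ge0.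
    have [d hd hF] := strong (map fst F) (e / 4 / k) ltac:(by rewrite !divr_gt0).
    exists (d : op M); first by have [[]] := DP _ hd.
    move=> p pF; apply: (le_lt_trans (inner_le _ _)); rewrite ltcR.
    have h1 := hF d hd (wle_refl _) _ (map_f fst pF).
    have h2 : hnorm p.2 <= k.
      rewrite /k (big_rem p)//= -addrA lerDl addr_ge0// sumr_ge0// => q _.
      exact: hnorm_ge0.
    have : hnorm (s p.1 - d p.1) * hnorm p.2 <= e / 4 / k * k.
      by rewrite ler_pM ?hnorm_ge0.
    rewrite divfK ?gt_eqF// -[((s : op M) - d) p.1]/(s p.1 - d p.1); lra.
  set t := WAlg _; have [K [K0 hK]] := obnd_ex t.
  apply/eqP; rewrite -subr_eq0; apply/eqP; apply: (near0 _ (K + K)); first exact: addr_ge0.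
  move=> d hd; have [cd _ _] := DP _ hd.
  have -> : s * t - t * s = (s - d) * t - t * (s - d).
    have e : d * t = t * d by apply: centralC.
    by rewrite mulrBl mulrBr e opprB addrA subrK.
  rewrite (le_trans (n2B _ _))// [leRHS]mulrDl; apply: lerD.
    exact: (n2Mr _ (conj K0 hK)).
  exact: (n2Ml _ (conj K0 hK)).
- apply/eqP; rewrite -subr_eq0; apply/eqP; apply: (near0 _ 3) => // d hd.
  have [_ sd dd] := DP _ hd.
  have -> : s * s - s = (s - d) * s + d * (s - d) - (s - d).
    by rewrite mulrBl mulrBr dd addrA subrK opprB addrA subrK.
  have h1 := n2Mr (s - d) (unit_interval_obnd s01).
  have h2 := n2Ml (s - d) (unit_interval_obnd (projection_unit_interval sd dd)).
  have := n2B ((s - d) * s + d * (s - d)) (s - d).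
  by have := n2D ((s - d) * s) (d * (s - d)); move: h1 h2; rewrite !mul1r; lra.
Qed.

End VonNeumannSubalgebra.

Section Factors.
Context {R : realType} {M : tracial_wspace R}.
Implicit Types a b c d e p : walg M.
Variable W : set (op M).
Hypothesis W_vN : von_neumann W.
Hypothesis W_sub : W `<=` tw_alg M.
Hypothesis W_diffuse : diffuse_center W.

Lemma projectionP d : projection (d : op M) <-> star d = d /\ d * d = d.
Proof.
split=> [[dd sd]|[sd dd]].
  by split; [exact/selfadjointP | apply: walg_ext => v; exact: (congr1 (fun T => T v) dd)].
by split; [exact: (congr1 (@wfun _ _) dd) | exact/selfadjointP].
Qed.

(** As [d] is not minimal, it has a proper nonzero central subprojection [e]; one of [e] and [d - e]
    has at most half the trace. *)
Lemma diffuse_split d : central_projection W d -> d <> 0 -> exists e,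
  [/\ central_projection W e, e <> 0, e * d = e & rt e <= rt d / 2].
Proof.
move=> hd d0; have [cd sd dd] := hd.
have [e [he e0 ed ne]] : exists e, [/\ central_projection W e, e <> 0, e * d = e & e <> d].
  apply: contrapT => h; apply: W_diffuse; exists (d : op M); split=> //.
  - exact/projectionP.
  - by move=> z; apply: d0; apply: walg_ext => v; rewrite z.
  move=> S cS pS le; apply: contrapT => /not_orP[S0 Sd]; apply: h.
  have [/W_sub AS _] := cS; pose e := WAlg AS.
  have [se ee] : star e = e /\ e * e = e by apply/projectionP.
  have he : central_projection W e by [].
  exists e; split=> //; first by move=> z; apply: S0; rewrite -[S]/(e : op M) z.
    by apply: (central_projection_le he hd); apply/op_leP.
  by move=> z; apply: Sd; rewrite -[S]/(e : op M) z.
have [rle|rlt] := leP (rt e) (rt d / 2); first by exists e.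
have de : d * (1 - e) = d - e.
  by have [ce _ _] := he; rewrite mulrBr mulr1 (central_mulC W_sub cd ce) ed.
exists (d - e); split.
- by rewrite -de; apply: central_projectionM => //; apply: central_projectionC.
- by move/eqP; rewrite subr_eq0 => /eqP z; apply: ne.
- by rewrite mulrBl dd ed.
- by rewrite rtB; lra.
Qed.

Lemma diffuse_small d (eps : R) : central_projection W d -> d <> 0 -> 0 < eps -> exists e,
  [/\ central_projection W e, e <> 0, e * d = e & rt e <= eps].
Proof.
move=> hd d0 eps0.
have [k hk] := geometric_small (rt d) (k := 2^-1) ltac:(by rewrite invr_ge0)
  ltac:(by rewrite invf_lt1 ?ltr1n) eps0.
suff [e [he e0 ed le]] : exists e,
    [/\ central_projection W e, e <> 0, e * d = e & rt e <= rt d * 2^-1 ^+ k].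
  by exists e; split=> //; apply: le_trans hk.
elim: k {hk} => [|k [e [he e0 ed le]]].
  by exists d; split=> //; [case: hd | rewrite expr0 mulr1].
have [f [hf f0 fe lf]] := diffuse_split he e0.
exists f; split=> //; first by rewrite -fe -mulrA ed.
by apply: (le_trans lf); rewrite exprSr mulrA ler_wpM2r// invr_ge0.
Qed.

Lemma diffuse_half_projection : exists2 d, central_projection W d & rt d = 2^-1.
Proof.
pose P := [set d | central_projection W d /\ rt d <= 2^-1].
have h0 : 0 < 2^-1 :> R by rewrite invr_gt0.
have [| | |m [hm tm] mmax] := @maximal_ex _ _ P 0.
- split; last by rewrite rt0 ltW.
  split; [exact: (wsub0 (central_wsubalg W_vN W_sub)) | exact: raddf0 | exact: mul0r].
- by move=> d [[_ sd dd] _]; apply: projection_unit_interval.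
- move=> D s DP Dc hs s01; split.
    by apply: (central_projection_sup W_vN W_sub (D := D)) => // d /DP[].
  apply/ler_addgt0Pr => e e0.
  have [d hd /(_ _ hd (wle_refl _)) h] := chain_sup_rt hs e0.
  by have [_ hd'] := DP _ hd; lra.
exists m => //; apply/eqP; rewrite eq_le tm /= leNgt; apply/negP => lt.
have hc := central_projectionC W_vN W_sub hm.
have c0 : 1 - m <> 0.
  by move=> /(congr1 rt); rewrite rtB rt1 rt0; lra.
have [e [he e0 ec le]] := diffuse_small hc c0 (eps := 2^-1 - rt m) ltac:(by rewrite subr_gt0).
have me : m * e = 0.
  have [cm _ mm] := hm; have [ce _ _] := he; rewrite (central_mulC W_sub cm ce) -ec.
  by rewrite -mulrA mulrBl mul1r mm subrr mulr0.
apply: e0; apply: (addrI m); rewrite addr0; apply: mmax.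
  by split; [exact: central_projectionD | rewrite rtD; lra].
apply/wle_subr; rewrite addrAC subrr add0r.
by have [_ se ee] := he; have [] := projection_unit_interval se ee.
Qed.

End Factors.

Lemma symmetry_obnd (R : realType) (M : tracial_wspace R) (u : walg M) :
  star u = u -> u * u = 1 -> obnd 1 u.
Proof.
move=> su uu; split=> // v; rewrite mul1r -ler_sqr ?nnegrE ?hnorm_ge0//.
by rewrite -!ripxx -rip_sa// -wmulE uu.
Qed.

Theorem theorem14 (R : realType) (M : tracial_wspace R) (n : nat)
    (hn : (2 <= n)%N) (X : 'I_n -> op M)
    (hX : forall i, tw_alg M (X i) /\ selfadjoint (X i))
    (N : tracial_wspace R) (emb : op M -> op N)
    (hemb : trace_embedding emb)
    (S : 'I_n -> op N) (hS : free_semicircular_family S)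
    (hSX : free_from (range S) (range (emb \o X))) :
  let W := vN_gen (range X) in
  let delta := delta_star (emb \o X) S in
  [/\ forall Z : op M, op_center W Z -> selfadjoint Z ->
        ((norm2 (Z - tw_tr M Z *: (idfun : op M)) ^+ 2)%:E <=
         2%:E * ((n%:R%:E - delta) / (n%:R - 1)%:E) * (opnorm Z ^+ 2)%:E)%E,
      (n%:R%:E - delta = 0)%E -> is_factor W
    & (((n%:R + 1) / 2)%:E < delta)%E ->
        (~ exists p : op M,
            [/\ op_center W p, projection p & tw_tr M p = 2^-1]) /\
        ~ diffuse_center W].
Proof.
move=> W delta.
have XM : range X `<=` tw_alg M by move=> _ [i _ <-]; case: (hX i).
have W_vN : von_neumann W := vN_gen_von_neumann XM.
have W_sub : W `<=` tw_alg M := vN_gen_sub XM.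
have bound := center_variance hn hX hemb hS hSX.
have codim := codimension_liminf X (emb := emb) S.
move: bound codim (liminf_fisher_ge0 X (emb := emb) S).
rewrite -/W -/delta; move: (limf_einf _ _) => L bound codim L0.
have n1 : 0 < n%:R - 1 :> R by rewrite subr_gt0 ltr1n.
have n1E : (n%:R - 1 == 0 :> R) = false by rewrite gt_eqF.
split.
- move=> Z cZ saZ; rewrite codim.
  have [/W_sub AZ _] := cZ; pose z := WAlg AZ.
  have sz : star z = z by apply/selfadjointP.
  by rewrite (norm2_variance sz); apply: bound => //; apply: (obnd_opnorm z).
- rewrite codim => L00.
  have scal (z : walg M) : central W z -> star z = z -> z = tau z *: 1.
    move=> cz sz; have [K hK] := obnd_ex z; have := bound z K cz sz hK.
    rewrite L00 mul0e mule0 mul0e lee_fin -(norm2_variance sz) => h.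
    apply/eqP; rewrite -subr_eq0; apply/eqP; apply: n2_eq0.
    by apply/eqP; rewrite -sqrf_eq0 eq_le sqr_ge0 andbT.
  move=> Z cZ; have [/W_sub AZ _] := cZ; pose z := WAlg AZ.
  have hC := central_wsubalg W_vN W_sub.
  have cz : central W z by [].
  have csz := wsub_star hC cz.
  have si : star ('i *: (z - star z)) = 'i *: (z - star z).
    rewrite -complexiE starZ raddfB /= starK -[z - star z]opprB scalerN -scaleNr.
    by congr (_ *: _); apply/eqP; rewrite eq_complex /= oppr0 !eqxx.
  have h1 := scal (z + star z) (wsubD hC cz csz) ltac:(by rewrite raddfD /= starK addrC).
  have h2 := scal _ (wsubZ hC 'i (wsubB hC cz csz)) si.
  (* A factor is defined by all of its central elements, so the general [z] is recovered from two
     self-adjoint ones to which [scal] applies. *)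
  have e : z = (2^-1)%:C *: ((z + star z) - 'i *: ('i *: (z - star z))).
    rewrite scalerA -expr2 sqrCi scaleN1r opprK addrACA subrr addr0.
    rewrite -[z + z]mulr2n -[z *+ 2]scaler_nat scalerA -(rmorph_nat (real_complex R)) -rmorphM /= mulVf//.
    by rewrite scale1r.
  move: h1 h2 e; set a := z + star z; set b := 'i *: (z - star z) => h1 h2 e.
  exists ((2^-1)%:C * (tau a - 'i * tau b)).
  have {}e : z = ((2^-1)%:C * (tau a - 'i * tau b)) *: 1.
    by rewrite e {1}h1 {1}h2 scalerA -scalerBl scalerA.
  exact: (congr1 (@wfun _ _) e).
- move=> hdelta.
  have hL : (L < ((n%:R - 1) / 2)%:E)%E.
    move: hdelta L0; rewrite -codim; case: (delta) => [r| |]//=.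
      by rewrite -?EFinB !lte_fin => h _; lra.
  have no_half (p : walg M) : central_projection W p -> rt p <> 2^-1.
    move=> [cp sp pp] hp; pose u := 2%:C *: p - 1.
    have su : star u = u by rewrite raddfB /= starZr sp star1.
    have uu : u * u = 1.
      have qq : 2%:C *: p * (2%:C *: p) = 2%:C *: p + 2%:C *: p.
        rewrite -[LHS]scalerAl -[X in _ *: X]scalerAr pp -{1}mulr2n -[RHS]scaler_nat.
        by rewrite -(rmorph_nat (real_complex R)).
      by rewrite /u mulrBl !mulrBr !mulr1 !mul1r qq addrK opprB addrC subrK.
    have hC := central_wsubalg W_vN W_sub.
    have := bound u 1 (wsubB hC (wsubZ hC _ cp) (wsub1 hC)) su (symmetry_obnd su uu).
    have -> : variance u = 1.
      by rewrite /variance uu rtB rtZ rt1 hp divff ?subrr ?expr0n ?subr0.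
    move: hL L0; case: (L) => [l| |]//=; rewrite inver n1E -!EFinM !lee_fin lte_fin.
    rewrite expr1n mulr1 mulrA ler_pdivlMr//; lra.
  split=> [[p [cp pp tp]]|hdiff].
    have [/W_sub Ap _] := cp; pose q := WAlg Ap.
    have [sq qq] : star q = q /\ q * q = q by apply/projectionP.
    by apply: (no_half q) => //; rewrite /rt /tau tp -(rmorph_nat (real_complex R)) -fmorphV.
  by have [d hd] := diffuse_half_projection W_vN W_sub hdiff; apply: no_half.
Qed.
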